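(* Let $(M,T)$ be an ideal triangulated compact 3-manifold whose boundary consists of surfaces of negative Euler characteristic, and let $n$ be the number of edges of $T$. The curvature map $\Pi:L(M,T)\to\mathbb{R}^n$ sending a metric $x$ to its curvature $K(x)=(K_1(x),\dots,K_n(x))$ is a local diffeomorphism. In particular, a hyperbolic cone metric associated to an ideal triangulation is locally determined by its cone angles, i.e. every $x\in L(M,T)$ has a neighborhood in $L(M,T)$ in which distinct metrics have distinct vectors of cone angles.
   Context: Hyperideal tetrahedra. $\mathbb{H}^3$ denotes hyperbolic 3-space. A hyperideal tetrahedron is a compact convex polyhedron in $\mathbb{H}^3$ which is diffeomorphic (via a diffeomorphism of open neighborhoods) to a truncated tetrahedron in Euclidean 3-space (four hexagonal faces and four triangular faces, one triangular face for each vertex of the original tetrahedron) and whose four hexagonal faces are right-angled hyperbolic hexagons. Its six edges are the intersections of pairs of its hexagonal faces, and its six dihedral angles are the interior dihedral angles at these edges. A hyperideal tetrahedron is determined up to isometry by its six edge lengths. Ideal triangulations. Let $M$ be a compact 3-manifold with boundary consisting of surfaces of negative Euler characteristic. An ideal triangulation $T$ of $M$ is given by a finite collection of 3-simplexes together with an identification of their faces in pairs by (affine) homeomorphisms, such that the quotient space with a small regular neighborhood of each vertex removed is homeomorphic to $M$. The images of the edges, triangles and tetrahedra of the simplexes (truncated at the vertices) are called the edges, triangles and tetrahedra of $T$. Let $E=\{e_1,\dots,e_n\}$ be the set of edges of $T$. Cone metrics. A hyperbolic cone metric associated to $T$ is an assignment $x:E\to\mathbb{R}_{>0}$ such that for each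 tetrahedron $t$ of $T$, the six numbers that $x$ assigns to the six edges of $t$ are the corresponding edge lengths of a hyperideal tetrahedron in $\mathbb{H}^3$ (gluing these hyperideal tetrahedra isometrically along their hexagonal faces gives a hyperbolic cone metric on $M$). The set of all of these is denoted $L(M,T)$, and is regarded as an open subset of $\mathbb{R}^n=\mathbb{R}^E$ with coordinates $x_i=x(e_i)$. Curvature. For $x\in L(M,T)$, the cone angle at the edge $e_i$ is the sum of the dihedral angles at $e_i$ of all the hyperideal tetrahedra around $e_i$ (counted with multiplicity, when several edges of a tetrahedron are identified to $e_i$), and the PL curvature $K_i(x)$ at $e_i$ is $2\pi$ minus the cone angle at $e_i$. *)

(* Defs.v *)
From HB Require Import structures.
From Stdlib Require Import Relations.Relation_Operators.
From mathcomp Require Import all_boot all_order all_algebra all_fingroup.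
From mathcomp Require Import all_classical all_reals all_analysis.

Set Implicit Arguments.
Unset Strict Implicit.
Unset Printing Implicit Defensive.

Import Order.TTheory GRing.Theory Num.Theory.
Import numFieldNormedType.Exports.

Local Open Scope classical_set_scope.
Local Open Scope ring_scope.

(* Meant for an open set [U], where continuity at the points of [U] in the
   ambient space is continuity on [U]. *)
Fixpoint Ck_on (R : realType) (V W : normedModType R) (k : nat) (U : set V)
    (f : V -> W) : Prop :=
  match k with
  | 0%N => forall x, U x -> {for x, continuous f}
  | k'.+1 => (forall x, U x -> differentiable f x) /\
             (forall v : V, Ck_on k' U (fun x => 'D_v f x))
  end.

Definition smooth_on (R : realType) (V W : normedModType R) (U : set V)
    (f : V -> W) : Prop := forall k, Ck_on k U f.

Definition diffeomorphism (R : realType) (V W : normedModType R)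
    (A : set V) (B : set W) (f : V -> W) : Prop :=
  [/\ open A, open B, f @` A = B, smooth_on A f &
      exists g : W -> V, smooth_on B g /\ forall x, A x -> g (f x) = x].

Definition local_diffeomorphism (R : realType) (V W : normedModType R)
    (D : set V) (f : V -> W) : Prop :=
  forall x, D x -> exists A : set V, exists B : set W,
    [/\ A x, A `<=` D & diffeomorphism A B f].

Definition homeomorphism (X Y : topologicalType) (A : set X) (B : set Y)
    (f : X -> Y) : Prop :=
  [/\ f @` A = B, {within A, continuous f} &
      exists g : Y -> X,
        {within B, continuous g} /\ forall x, A x -> g (f x) = x].

Definition homeomorphic (X Y : topologicalType) (A : set X) (B : set Y) : Prop :=
  exists f : X -> Y, homeomorphism A B f.

Definition half_space (R : realType) : set 'rV[R]_3 := [set w | 0 <= w 0 0].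
Arguments half_space : clear implicits.

(* Interior points are covered too: a small ball of R^3 is homeomorphic to an
   open subset of the half-space lying off its bounding plane. *)
Definition boundary_chart (R : realType) (M : topologicalType) (U : set M)
    (f : M -> 'rV[R]_3) : Prop :=
  open U /\ exists2 O : set 'rV[R]_3,
    open O & homeomorphism U (half_space R `&` O) f.

Definition manifold3_with_boundary (R : realType) (M : topologicalType) : Prop :=
  [/\ hausdorff_space M, @second_countable M &
      forall p : M, exists (U : set M) (f : M -> 'rV[R]_3),
        U p /\ boundary_chart U f].

Definition manifold_boundary (R : realType) (M : topologicalType) : set M :=
  [set p | exists (U : set M) (f : M -> 'rV[R]_3),
     [/\ U p, boundary_chart U f & f p 0 0 = 0]].

Arguments manifold_boundary : clear implicits.

Definition is_complex (m : nat) (K : {set {set 'I_m}}) : Prop :=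
  finset.set0 \notin K /\
  forall s s' : {set 'I_m}, s \in K -> s' \subset s -> s' != finset.set0 -> s' \in K.

Definition realization (R : realType) (m : nat) (K : {set {set 'I_m}}) :
    set 'rV[R]_m :=
  [set w | [/\ forall i, 0 <= w 0 i, \sum_i w 0 i = 1 &
               [set i | w 0 i != 0]%SET \in K]].

Arguments realization R {m} K.

Definition has_euler_characteristic (R : realType) (X : topologicalType)
    (S : set X) (chi : int) : Prop :=
  exists (m : nat) (K : {set {set 'I_m}}),
    [/\ is_complex K, homeomorphic (realization R K) S &
        chi = \sum_(s in K) (-1) ^+ #|s|.-1].

Definition negative_boundary (R : realType) (M : topologicalType) : Prop :=
  forall p : M, manifold_boundary R M p ->
    exists chi : int,
      has_euler_characteristic R
        (connected_component (manifold_boundary R M) p) chi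
      /\ chi < 0.

(* The simplex is the convex hull of 0 and of the three vectors of the standard
   basis; [bary x v] is the barycentric coordinate at the vertex [v]. *)
Definition bary (R : realType) (x : 'rV[R]_3) (v : 'I_4) : R :=
  if unlift ord0 v is Some j then x 0 j else 1 - \sum_j x 0 j.

Definition simplex (R : realType) : set 'rV[R]_3 :=
  [set x | forall v, 0 <= bary x v].
Arguments simplex : clear implicits.

Definition truncated_tetrahedron (R : realType) : set 'rV[R]_3 :=
  [set x | forall v, 0 <= bary x v <= 2 / 3].
Arguments truncated_tetrahedron : clear implicits.

(* [std_hexagon c] lies in the face opposite to the vertex [c], and
   [std_triangle v] cuts off the vertex [v]. *)
Definition std_hexagon (R : realType) (c : 'I_4) : set 'rV[R]_3 :=
  truncated_tetrahedron R `&` [set x | bary x c = 0].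

Arguments std_hexagon : clear implicits.

Definition std_triangle (R : realType) (v : 'I_4) : set 'rV[R]_3 :=
  truncated_tetrahedron R `&` [set x | bary x v = 2 / 3].

Arguments std_triangle : clear implicits.

(* The endpoint near [a] of the truncation of the edge joining [a] to [b]. *)
Definition std_vertex (R : realType) (a b : 'I_4) : 'rV[R]_3 :=
  \row_j (if lift ord0 j == a then 2 / 3
          else if lift ord0 j == b then 1 / 3 else 0).

Definition dotv (R : realType) (u v : 'rV[R]_3) : R := \sum_i u 0 i * v 0 i.

(* The projective (Beltrami-Klein) model of hyperbolic 3-space: geodesics are
   chords of the unit ball, and totally geodesic planes and half-spaces are the
   traces of the affine ones. *)
Definition H3 (R : realType) : set 'rV[R]_3 := [set x | dotv x x < 1].
Arguments H3 : clear implicits.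

Definition arcosh (R : realType) (t : R) : R := ln (t + Num.sqrt (t ^+ 2 - 1)).

Definition hyp_dist (R : realType) (p q : 'rV[R]_3) : R :=
  arcosh ((1 - dotv p q) / Num.sqrt ((1 - dotv p p) * (1 - dotv q q))).

(* The Riemannian metric of the Klein model at [p]. *)
Definition hyp_metric (R : realType) (p u v : 'rV[R]_3) : R :=
  dotv u v / (1 - dotv p p) + dotv p u * dotv p v / (1 - dotv p p) ^+ 2.

(* The angle at [p] between the geodesics from [p] to [q] and from [p] to [r]. *)
Definition hyp_angle (R : realType) (p q r : 'rV[R]_3) : R :=
  acos (hyp_metric p (q - p) (r - p) /
        Num.sqrt (hyp_metric p (q - p) (q - p) * hyp_metric p (r - p) (r - p))).

Record halfspace (R : realType) : Type :=
  HalfSpace { normal : 'rV[R]_3; offset : R }.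

Definition hs_set (R : realType) (h : halfspace R) : set 'rV[R]_3 :=
  [set x | dotv (normal h) x <= offset h].

Definition hs_plane (R : realType) (h : halfspace R) : set 'rV[R]_3 :=
  [set x | dotv (normal h) x = offset h].

(* At a point [p] of both bounding planes, the outward normals of [h] and [h']
   for [hyp_metric p] have inner product [hs_form h h'] up to the factor
   [1 - dotv p p], whence the formula for the interior dihedral angle. *)
Definition hs_form (R : realType) (h h' : halfspace R) : R :=
  dotv (normal h) (normal h') - offset h * offset h'.

Definition interior_angle (R : realType) (h h' : halfspace R) : R :=
  acos (- hs_form h h' / Num.sqrt (hs_form h h * hs_form h' h')).

(* The half-spaces of the hexagonal and triangular faces, and a map carrying
   the standard truncated tetrahedron onto the polyhedron, which labels faces,
   edges and vertices. *)
Record tetrahedron (R : realType) : Type := Tetrahedron {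
  hex_side : 'I_4 -> halfspace R;
  tri_side : 'I_4 -> halfspace R;
  marking : 'rV[R]_3 -> 'rV[R]_3
}.

Definition polyhedron (R : realType) (P : tetrahedron R) : set 'rV[R]_3 :=
  [set x | H3 R x /\
     forall v, hs_set (hex_side P v) x /\ hs_set (tri_side P v) x].

Definition tet_vertex (R : realType) (P : tetrahedron R) (a b : 'I_4) :
    'rV[R]_3 :=
  marking P (std_vertex R a b).

(* In the hexagonal face [c], with [a], [b], [d] the other indices, the vertex
   [tet_vertex P a b] is adjacent to [tet_vertex P b a] and to
   [tet_vertex P a d]. *)
Definition right_angled_hexagon (R : realType) (P : tetrahedron R) (c : 'I_4) :
    Prop :=
  forall a b d : 'I_4, uniq [:: a; b; c; d] ->
    hyp_angle (tet_vertex P a b) (tet_vertex P b a) (tet_vertex P a d) = pi / 2.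

Definition hyperideal (R : realType) (P : tetrahedron R) : Prop :=
  [/\ compact (polyhedron P),
      exists U V : set 'rV[R]_3,
        [/\ truncated_tetrahedron R `<=` U, V `<=` H3 R &
            diffeomorphism U V (marking P)],
      marking P @` truncated_tetrahedron R = polyhedron P,
      forall v,
        marking P @` std_hexagon R v = polyhedron P `&` hs_plane (hex_side P v) /\
        marking P @` std_triangle R v = polyhedron P `&` hs_plane (tri_side P v)
    & forall c, right_angled_hexagon P c].

(* The length of the edge coming from the edge of the simplex joining the
   vertices [a] and [b]. *)
Definition edge_length (R : realType) (P : tetrahedron R) (a b : 'I_4) : R :=
  hyp_dist (tet_vertex P a b) (tet_vertex P b a).

(* The dihedral angle at the intersection of the hexagonal faces [c] and [d]. *)
Definition dihedral_angle (R : realType) (P : tetrahedron R) (c d : 'I_4) : R :=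
  interior_angle (hex_side P c) (hex_side P d).

(* The face of the simplex [t] opposite to its vertex [f] is glued to the face
   of the simplex [(glue t f).1] opposite to its vertex [(glue t f).2 f], by
   the affine map given on vertices by the restriction of [(glue t f).2]. *)
Record face_pairing : Type := FacePairing {
  ntet : nat;
  glue : 'I_ntet -> 'I_4 -> 'I_ntet * 'S_4;
  glueK : forall t f,
    glue (glue t f).1 ((glue t f).2 f) = (t, ((glue t f).2^-1)%g);
  glue_neq : forall t f, ((glue t f).1, (glue t f).2 f) <> (t, f)
}.

Definition glued_points (R : realType) (T : face_pairing)
    (z z' : 'I_(ntet T) * 'rV[R]_3) : Prop :=
  exists f : 'I_4,
    [/\ bary z.2 f = 0, z'.1 = (glue z.1 f).1 &
        forall v, bary z'.2 ((glue z.1 f).2 v) = bary z.2 v].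

(* [q] exhibits [Q] as the quotient of the disjoint union of the simplices by
   the equivalence relation generated by the face identifications. *)
Definition is_quotient_space (R : realType) (T : face_pairing)
    (Q : topologicalType) (q : 'I_(ntet T) -> 'rV[R]_3 -> Q) : Prop :=
  [/\ forall z, exists t, exists2 x, simplex R x & q t x = z,
      forall t x t' x', simplex R x -> simplex R x' ->
        (q t x = q t' x' <->
         clos_refl_sym_trans _ (@glued_points R T) (t, x) (t', x'))
    & forall A : set Q, open A <->
        forall t, exists2 O : set 'rV[R]_3, open O &
          simplex R `&` q t @^-1` A = simplex R `&` O].

(* The value 2/3 > 1/2 makes the neighborhoods of the vertices of a simplex
   pairwise disjoint. *)
Definition vertex_nbhd (R : realType) (T : face_pairing) (Q : topologicalType)
    (q : 'I_(ntet T) -> 'rV[R]_3 -> Q) : set Q :=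
  [set z | exists t x, [/\ simplex R x, exists v, 2 / 3 < bary x v & q t x = z]].

Definition ideal_triangulation (R : realType) (M : topologicalType)
    (T : face_pairing) : Prop :=
  exists (Q : topologicalType) (q : 'I_(ntet T) -> 'rV[R]_3 -> Q),
    is_quotient_space q /\ homeomorphic (~` vertex_nbhd q) [set: M].

(* The edges of the simplices are the pairs [(t, s)] with [s] a set of two
   vertices; an edge of the triangulation is a class of such pairs. *)
Definition tet_edge (T : face_pairing) : {set 'I_(ntet T) * {set 'I_4}} :=
  [set y : 'I_(ntet T) * {set 'I_4} | #|y.2| == 2]%SET.

Definition glued_edges (T : face_pairing) : rel ('I_(ntet T) * {set 'I_4}) :=
  fun y z => [exists f, (f \notin y.2) &&
    (z == ((glue y.1 f).1, [set (glue y.1 f).2 v | v in y.2]%SET))].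

Definition edges (T : face_pairing) : {set {set 'I_(ntet T) * {set 'I_4}}} :=
  equivalence_partition (connect (@glued_edges T)) (tet_edge T).

Definition nedges (T : face_pairing) : nat := #|edges T|.

Definition edge (T : face_pairing) (i : 'I_(nedges T)) :
    {set 'I_(ntet T) * {set 'I_4}} :=
  enum_val i.

Definition has_lengths (R : realType) (T : face_pairing)
    (x : 'rV[R]_(nedges T)) (P : 'I_(ntet T) -> tetrahedron R) : Prop :=
  forall t, hyperideal (P t) /\
    forall (i : 'I_(nedges T)) (a b : 'I_4), a != b ->
      (t, [set a; b]%SET) \in edge i -> edge_length (P t) a b = x 0 i.

Definition cone_metrics (R : realType) (T : face_pairing) :
    set 'rV[R]_(nedges T) :=
  [set x : 'rV[R]_(nedges T) |
     (forall i, 0 < x 0 i) /\ exists P, has_lengths x P].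

Arguments cone_metrics : clear implicits.

(* A choice of hyperideal tetrahedra with the prescribed lengths; these are
   unique up to isometry, so that the angles do not depend on the choice. *)
Definition metric_tetrahedra (R : realType) (T : face_pairing)
    (x : 'rV[R]_(nedges T)) : 'I_(ntet T) -> tetrahedron R :=
  if pselect (exists P, has_lengths x P) is left e then projT1 (cid e)
  else fun=> Tetrahedron (fun=> HalfSpace 0 0) (fun=> HalfSpace 0 0) id.

(* The hexagonal faces [c] and [d] meet along the edge joining the two vertices
   other than [c] and [d]. *)
Definition cone_angles (R : realType) (T : face_pairing)
    (x : 'rV[R]_(nedges T)) : 'rV[R]_(nedges T) :=
  \row_i \sum_t \sum_(c : 'I_4)
    \sum_(d : 'I_4 | (c < d)%N && ((t, ~: [set c; d])%SET \in edge i))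
      dihedral_angle (metric_tetrahedra x t) c d.

Definition curvature (R : realType) (T : face_pairing)
    (x : 'rV[R]_(nedges T)) : 'rV[R]_(nedges T) :=
  \row_i (2 * pi - cone_angles x 0 i).

(* Main.v *)
(** In the hyperboloid model, a hyperideal tetrahedron with edge lengths [l a b]
    is given by unit spacelike vectors [T 0], ..., [T 3], normal to its triangular
    faces, whose Gram matrix [G] has entries [1] on the diagonal and
    [- cosh (l a b)] elsewhere. Hence [det G < 0], and the normals of the hexagonal
    faces are, up to scaling, the vectors dual to the [T a], so that the dihedral
    angle between the faces [c] and [d] is
    [acos (- H c d / sqrt (H c c * H d d))] where [H = G^-1].
    Conversely, if [det G < 0] then such [T a] exist, and the polyhedron is the
    projectivized cone of the combinations of the [T a] with nonnegative
    coefficients and nonpositive products with every [T a]. A marking is obtained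
    by increasing the off-diagonal entries of [- G] row by row, which relates this
    cone to the one over the standard truncated tetrahedron. So the cone metrics
    form the open set defined by [l > 0] and [det G < 0], on which the angles are
    smooth.

    Let [G] vary by [A]. As [dH = - H A H], the dihedral angle at the edge [a b],
    between the faces [c] and [d], varies by
    [- tau H A c d / sqrt (H c c * H d d - H c d ^ 2)], and the minor under the root
    is [sinh (l a b) ^ 2 / - det G]. Therefore the sum over the six edges of the
    products of the variations of the length and of the angle is [sqrt (- det G)]
    times the sum of [A a b * tau H A c d / sinh (l a b) ^ 2], a quadratic form in
    [A]. It is positive definite: on the space where [tau] vanishes at three edges
    it is explicitly positive, and a complementary block has leading minors that
    are positive when all off-diagonal entries of [G] are [-1] and, by the first
    fact, cannot vanish along the segment from there to [G]. Summing over the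
    tetrahedra, the derivative of the cone angles along [v], paired with [v], is
    positive for [v <> 0], and the inverse function theorem applies. *)
Require Import Defs.
From HB Require Import structures.
From mathcomp Require Import all_boot all_order all_algebra perm.
From mathcomp Require Import all_classical all_reals all_analysis.
From mathcomp Require Import ring lra.
Set Implicit Arguments.
Unset Strict Implicit.
Unset Printing Implicit Defensive.
Import Order.TTheory GRing.Theory Num.Theory.
Import numFieldNormedType.Exports.
Local Open Scope classical_set_scope.
Local Open Scope ring_scope.

(** * Determinant and cofactors of the Gram matrix *)

(** The cofactors off the diagonal have no fixed sign, since dihedral angles may be obtuse, so the
    variation form in six variables does not simply expand into positive terms. What helps is a
    duality: [tau] ignores diagonal rescalings of [H], just as [G] is normalized by its unit
    diagonal, and [A] is recovered from the values of [tau] by a formula of the same shape that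
    involves only [G], whose off-diagonal entries all have the same sign. The three edges where
    [tau] is made to vanish issue from one vertex; the form then becomes a ternary form in the
    values of [tau] at the other three edges, with positive coefficients. A degenerate complementary
    block would give a nonzero variation supported on the three edges and with [tau] zero there, on
    which the form vanishes, against this positivity. The segment is straight in the entries of [G],
    not in the lengths, so that the minors are polynomials in its parameter; that [det G] stays
    negative along it is an inequality of its own. *)

(* [- gdel] is the determinant of the matrix with [1] on the diagonal and
   [- a i j] elsewhere; the diagonal cofactors of this matrix are values of
   [- kap], and the other ones are values of [cofo]. *)
Definition kap (R : comRingType) (x y z : R) : R :=
  x ^+ 2 + y ^+ 2 + z ^+ 2 + 2 * x * y * z - 1.

Definition cofo (R : comRingType) (x w p q r s : R) : R :=
  x * (1 - w ^+ 2) + p * q + r * s + w * (p * s + r * q).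

Definition gdel (R : comRingType) (a12 a13 a14 a23 a24 a34 : R) : R :=
  a12 ^+ 2 + a13 ^+ 2 + a14 ^+ 2 + a23 ^+ 2 + a24 ^+ 2 + a34 ^+ 2
  + 2 * (a12 * a13 * a23 + a12 * a14 * a24 + a13 * a14 * a34 + a23 * a24 * a34)
  - ((a12 * a34) ^+ 2 + (a13 * a24) ^+ 2 + (a14 * a23) ^+ 2)
  + 2 * (a12 * a34 * (a13 * a24) + a12 * a34 * (a14 * a23)
         + a13 * a24 * (a14 * a23)) - 1.

(** Numerator of the coefficient with which the variation of an edge enters [tau] at the two faces
    meeting along this same edge. Here [k], [k'], [y] are the cofactors of these two faces, and [p],
    [q], [r], [s] those linking them to the other two. *)
Definition diagf (R : comRingType) (p q r s y k k' : R) : R :=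
  (p * r + s * q) * (k * k') + y * (p * s * k' + q * r * k).

(** Sylvester's criterion with its case of equality: [E1] and [E2] complete the square twice. *)
Lemma posdef3 (R : realFieldType) (A B C D E F X Y Z : R) :
  0 < A -> 0 < A * B - D ^+ 2 ->
  0 < A * B * C + 2 * D * E * F - A * F ^+ 2 - B * E ^+ 2 - C * D ^+ 2 ->
  0 <= A * X ^+ 2 + B * Y ^+ 2 + C * Z ^+ 2
       + 2 * (D * X * Y + E * X * Z + F * Y * Z) ?= iff
  ((X == 0) && (Y == 0) && (Z == 0)).
Proof.
move=> A0 AB AC.
set m := A * B - D ^+ 2 in AB; set d := _ - C * D ^+ 2 in AC.
set q := (X in _ <= X ?= iff _).
have E1 : A * q = (A * X + D * Y + E * Z) ^+ 2 + (m * Y ^+ 2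
    + 2 * (A * F - D * E) * Y * Z + (A * C - E ^+ 2) * Z ^+ 2).
  by rewrite /q /m; ring.
have E2 : m * (A * q) = m * (A * X + D * Y + E * Z) ^+ 2
    + (m * Y + (A * F - D * E) * Z) ^+ 2 + A * d * Z ^+ 2.
  by rewrite E1 /m /d; ring.
have mA : 0 < m * A by rewrite mulr_gt0.
have h1 : 0 <= m * (A * X + D * Y + E * Z) ^+ 2 by rewrite mulr_ge0 ?sqr_ge0 ?ltW.
have h2 : 0 <= (m * Y + (A * F - D * E) * Z) ^+ 2 by rewrite sqr_ge0.
have h3 : 0 <= A * d * Z ^+ 2 by rewrite mulr_ge0 ?sqr_ge0 // ltW ?mulr_gt0.
apply/leifP; case: ifPn => [/andP[/andP[/eqP X0 /eqP Y0] /eqP Z0]|].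
  by apply/eqP; rewrite /q X0 Y0 Z0; ring.
apply: contraR; rewrite -leNgt => q0.
have q1 : m * (A * q) <= 0 by rewrite mulrA pmulr_rle0.
have z0 : Z = 0.
  have : A * d * Z ^+ 2 <= 0 by lra.
  by rewrite pmulr_rle0 ?mulr_gt0 // => zz; apply/eqP; rewrite -sqrf_eq0 eq_le zz sqr_ge0.
have y0 : Y = 0.
  have : (m * Y + (A * F - D * E) * Z) ^+ 2 <= 0 by lra.
  rewrite z0 mulr0 addr0 => yy; have : (m * Y) ^+ 2 == 0 by rewrite eq_le yy sqr_ge0.
  by rewrite sqrf_eq0 mulf_eq0 gt_eqF //= => /eqP.
have x0 : X = 0.
  have : m * (A * X + D * Y + E * Z) ^+ 2 <= 0 by lra.
  rewrite pmulr_rle0 // z0 y0 !mulr0 !addr0 => xx.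
  have : (A * X) ^+ 2 == 0 by rewrite eq_le xx sqr_ge0.
  by rewrite sqrf_eq0 mulf_eq0 gt_eqF //= => /eqP.
by rewrite x0 y0 z0 !eqxx.
Qed.

(** If both were negative, [z] would be too. Then multiplying the last two hypotheses by the
    positive numbers [x * z] and [- (x * kk)] and adding them leaves
    [- (x * y * (kj * kk - z ^+ 2))], which is negative. *)
Lemma not_both_neg (R : realFieldType) (x y z kj kk : R) :
  0 < kj -> 0 < kk -> 0 < kj * kk - z ^+ 2 ->
  0 < x * kk + y * z -> 0 < y * kj + x * z -> ~ (x < 0 /\ y < 0).
Proof.
move=> kj0 kk0 E V1 V2 [x0 y0].
have z0 : z < 0.
  rewrite ltNge; apply/negP => z0; have : y * z <= 0 by rewrite mulr_le0_ge0 // ltW.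
  have : x * kk < 0 by rewrite nmulr_rlt0.
  by move: V1; lra.
have h1 : 0 < (y * z + x * kk) * (x * z) by rewrite mulr_gt0 ?nmulr_rgt0 // addrC.
have h2 : 0 < (x * z + y * kj) * (- (x * kk)).
  by rewrite mulr_gt0 ?oppr_gt0 ?nmulr_rlt0 // addrC.
have : 0 < - (x * y * (kj * kk - z ^+ 2)).
  apply: lt_le_trans (addr_gt0 h1 h2) _; rewrite le_eqVlt; apply/orP; left.
  by apply/eqP; ring.
have xy : 0 < x * y by rewrite nmulr_rgt0.
by rewrite oppr_gt0 pmulr_rlt0 // ltNge ltW.
Qed.

(** The two expressions [e1] and [e2] are positive as soon as [c13 * c24], respectively [c14 * c23],
    is nonnegative. If both products are negative, one of [c13], [c24] and one of [c14], [c23] are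
    negative, and [not_both_neg] excludes each of the four combinations. *)
Lemma diagf_gt0 (R : realFieldType) (c12 c13 c14 c23 c24 c34 k1 k2 k3 k4 : R) :
  0 < k1 -> 0 < k2 -> 0 < k3 -> 0 < k4 ->
  0 < k1 * k2 - c12 ^+ 2 -> 0 < k3 * k4 - c34 ^+ 2 ->
  0 < c14 * k3 + c13 * c34 -> 0 < c13 * k4 + c14 * c34 ->
  0 < c23 * k4 + c24 * c34 -> 0 < c24 * k3 + c23 * c34 ->
  0 < c13 * k2 + c23 * c12 -> 0 < c23 * k1 + c13 * c12 ->
  0 < c14 * k2 + c24 * c12 -> 0 < c24 * k1 + c14 * c12 ->
  0 < diagf c13 c14 c24 c23 c34 k3 k4.
Proof.
move=> k1p k2p k3p k4p E12 E34 V1 V2 V3 V4 V5 V6 V7 V8.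
have e1 : diagf c13 c14 c24 c23 c34 k3 k4 =
    (c14 * k3 + c13 * c34) * (c23 * k4 + c24 * c34) + c13 * c24 * (k3 * k4 - c34 ^+ 2).
  by rewrite /diagf; ring.
have e2 : diagf c13 c14 c24 c23 c34 k3 k4 =
    (c13 * k4 + c14 * c34) * (c24 * k3 + c23 * c34) + c14 * c23 * (k3 * k4 - c34 ^+ 2).
  by rewrite /diagf; ring.
have [h|h] := leP 0 (c13 * c24).
  by rewrite e1 ltr_pwDl ?mulr_gt0 // mulr_ge0 // ltW.
have [h'|h'] := leP 0 (c14 * c23).
  by rewrite e2 ltr_pwDl ?mulr_gt0 // mulr_ge0 // ltW.
exfalso.
have n1 : ~ (c13 < 0 /\ c14 < 0) by exact: (@not_both_neg _ _ _ c34 k3 k4).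
have n2 : ~ (c13 < 0 /\ c23 < 0) by exact: (@not_both_neg _ _ _ c12 k1 k2).
have n3 : ~ (c24 < 0 /\ c14 < 0).
  by apply: (@not_both_neg _ _ _ c12 k2 k1) => //; rewrite (mulrC k2).
have n4 : ~ (c24 < 0 /\ c23 < 0).
  by apply: (@not_both_neg _ _ _ c34 k4 k3) => //; rewrite (mulrC k4).
have [c13n|c13p] := ltP c13 0.
  have [c14n|c14p] := ltP c14 0; first by apply: n1.
  have c23n : c23 < 0.
    by rewrite ltNge; apply/negP => q; move: h'; rewrite ltNge mulr_ge0.
  by apply: n2.
have c24n : c24 < 0.
  by rewrite ltNge; apply/negP => q; move: h; rewrite ltNge mulr_ge0.
have [c14n|c14p] := ltP c14 0; first by apply: n3.
have c23n : c23 < 0.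
  by rewrite ltNge; apply/negP => q; move: h'; rewrite ltNge mulr_ge0.
by apply: n4.
Qed.

Lemma kap_gt0 (R : realDomainType) (x y z : R) : 1 < x -> 1 < y -> 1 < z -> 0 < kap x y z.
Proof.
move=> x1 y1 z1; rewrite /kap.
have h : 0 < 2 * x * y * z by rewrite !mulr_gt0 //; lra.
have : 1 < x ^+ 2 by rewrite exprn_egt1.
have := sqr_ge0 y; have := sqr_ge0 z; lra.
Qed.

(** [2 * obt] and [quart] are the coefficients of [t ^+ 3] and [t ^+ 4] in [gdel] at the entries
    [1 + t * b]. [quart] is Heron's polynomial, symmetric in [P], [Q], [S]: 16 times the squared
    area of a triangle with sides the square roots of these. *)
Definition obt (R : comRingType) (b12 b13 b14 b23 b24 b34 : R) : R :=
  let P := b12 * b34 in let Q := b13 * b24 in let S := b14 * b23 in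
  (b12 + b34) * (Q + S - P) + (b13 + b24) * (P + S - Q) + (b14 + b23) * (P + Q - S)
  + b12 * (b13 * b23 + b14 * b24) + b34 * (b13 * b14 + b23 * b24).

Definition quart (R : comRingType) (b12 b13 b14 b23 b24 b34 : R) : R :=
  let P := b12 * b34 in let Q := b13 * b24 in let S := b14 * b23 in
  4 * Q * S - (P - Q - S) ^+ 2.

(** Only the factor [Q + S - P] can be negative. Positivity of [quart] bounds its square by
    [4 * Q * S], and by the inequality of the means this is at most the square of either of the sums
    [b13 * b23 + b14 * b24] and [b13 * b14 + b23 * b24] that accompany [b12] and [b34]. *)
Lemma obt_ge0_dominant (R : realDomainType) (b12 b13 b14 b23 b24 b34 : R) :
  0 <= b12 -> 0 <= b13 -> 0 <= b14 -> 0 <= b23 -> 0 <= b24 -> 0 <= b34 ->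
  b13 * b24 + b14 * b23 <= b12 * b34 ->
  0 < quart b12 b13 b14 b23 b24 b34 -> 0 <= obt b12 b13 b14 b23 b24 b34.
Proof.
move=> h12 h13 h14 h23 h24 h34; rewrite /quart /obt /=.
set P := b12 * b34; set Q := b13 * b24; set S := b14 * b23 => PQS q.
have Q0 : 0 <= Q by rewrite mulr_ge0.
have S0 : 0 <= S by rewrite mulr_ge0.
have bound x : 0 <= x -> 4 * Q * S <= x ^+ 2 -> 0 <= Q + S - P + x.
  move=> x0 qx; have : (P - Q - S) ^+ 2 <= x ^+ 2 by lra.
  by rewrite ler_pXn2r ?nnegrE //; lra.
have h1 : 0 <= Q + S - P + (b13 * b23 + b14 * b24).
  apply: bound; first by rewrite addr_ge0 ?mulr_ge0.
  rewrite -subr_ge0 (_ : _ - _ = (b13 * b23 - b14 * b24) ^+ 2) ?sqr_ge0 //.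
  by rewrite /Q /S; ring.
have h2 : 0 <= Q + S - P + (b13 * b14 + b23 * b24).
  apply: bound; first by rewrite addr_ge0 ?mulr_ge0.
  rewrite -subr_ge0 (_ : _ - _ = (b13 * b14 - b23 * b24) ^+ 2) ?sqr_ge0 //.
  by rewrite /Q /S; ring.
have h3 : 0 <= (b13 + b24) * (P + S - Q).
  by apply: mulr_ge0; [exact: addr_ge0|lra].
have h4 : 0 <= (b14 + b23) * (P + Q - S).
  by apply: mulr_ge0; [exact: addr_ge0|lra].
have h5 := mulr_ge0 h12 h1; have h6 := mulr_ge0 h34 h2.
by move: h3 h4 h5 h6; rewrite !mulrDr !mulrDl; lra.
Qed.

(** A relabelling of the vertices turns a dominant product into [b12 * b34]; when none of the three
    dominates, every summand is nonnegative. *)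
Lemma obt_ge0 (R : realDomainType) (b12 b13 b14 b23 b24 b34 : R) :
  0 <= b12 -> 0 <= b13 -> 0 <= b14 -> 0 <= b23 -> 0 <= b24 -> 0 <= b34 ->
  0 < quart b12 b13 b14 b23 b24 b34 -> 0 <= obt b12 b13 b14 b23 b24 b34.
Proof.
move=> h12 h13 h14 h23 h24 h34 q.
have [PQS|nP] := lerP (b13 * b24 + b14 * b23) (b12 * b34).
  exact: obt_ge0_dominant.
have [QPS|nQ] := lerP (b12 * b34 + b14 * b23) (b13 * b24).
  rewrite (_ : obt _ _ _ _ _ _ = obt b13 b12 b14 b23 b34 b24); last first.
    by rewrite /obt; ring.
  apply: obt_ge0_dominant => //.
  by move: q; rewrite /quart (_ : _ - _ = 4 * (b12 * b34) * (b14 * b23)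
       - (b13 * b24 - b12 * b34 - b14 * b23) ^+ 2) //; ring.
have [SPQ|nS] := lerP (b12 * b34 + b13 * b24) (b14 * b23).
  rewrite (_ : obt _ _ _ _ _ _ = obt b14 b13 b12 b34 b24 b23); last first.
    by rewrite /obt; ring.
  apply: obt_ge0_dominant => //; first by rewrite addrC.
  by move: q; rewrite /quart (_ : _ - _ = 4 * (b13 * b24) * (b12 * b34)
       - (b14 * b23 - b13 * b24 - b12 * b34) ^+ 2) //; ring.
have sum_ge0 (u v w z x : R) : 0 <= u -> 0 <= v -> 0 <= w -> 0 <= z -> 0 <= x ->
  0 <= u + v + w + z + x by lra.
have prod_ge0 (u v w : R) : 0 <= u -> 0 <= v -> 0 <= w -> 0 <= (u + v) * w.
  by move=> u0 v0 w0; rewrite mulr_ge0 ?addr_ge0.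
apply: sum_ge0; try (apply: prod_ge0 => //; lra).
  by rewrite mulr_ge0 ?addr_ge0 ?mulr_ge0.
by rewrite mulr_ge0 ?addr_ge0 ?mulr_ge0.
Qed.

(** In [t], [gdel] is a quartic with constant term 16 and nonnegative coefficients [c1], [c2]. If
    [c4] is positive, so that [quart] is, then [c3] is nonnegative and all terms are. Otherwise the
    quartic is at least [t ^+ 3] times its value at 1, since [t ^+ k >= t ^+ 3] for [k <= 3] while
    [t ^+ 4 <= t ^+ 3] meets the nonpositive [c4]. *)
Lemma gdel_segment (R : realDomainType) (b12 b13 b14 b23 b24 b34 t : R) :
  0 <= b12 -> 0 <= b13 -> 0 <= b14 -> 0 <= b23 -> 0 <= b24 -> 0 <= b34 ->
  0 <= t <= 1 ->
  0 < gdel (1 + b12) (1 + b13) (1 + b14) (1 + b23) (1 + b24) (1 + b34) ->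
  0 < gdel (1 + t * b12) (1 + t * b13) (1 + t * b14) (1 + t * b23)
           (1 + t * b24) (1 + t * b34).
Proof.
move=> h12 h13 h14 h23 h24 h34 /andP[t0 t1].
pose c1 := 8 * (b12 + b13 + b14 + b23 + b24 + b34).
pose c2 := 4 * ((b12 + b34) * (b13 + b14 + b23 + b24)
                + (b13 + b24) * (b14 + b23)).
pose c3 := 2 * obt b12 b13 b14 b23 b24 b34.
pose c4 := quart b12 b13 b14 b23 b24 b34.
have E s : gdel (1 + s * b12) (1 + s * b13) (1 + s * b14) (1 + s * b23)
    (1 + s * b24) (1 + s * b34) = 16 + c1 * s + c2 * s ^+ 2 + c3 * s ^+ 3 + c4 * s ^+ 4.
  by rewrite /gdel /c1 /c2 /c3 /c4 /obt /quart /=; ring.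
have := E 1; rewrite !mul1r !expr1n !mulr1 => -> g1; rewrite E.
have c10 : 0 <= c1 by rewrite /c1 mulr_ge0 // !addr_ge0.
have c20 : 0 <= c2 by rewrite /c2 mulr_ge0 // addr_ge0 // mulr_ge0 // !addr_ge0.
have t2 : 0 <= t ^+ 2 by rewrite sqr_ge0.
have t3 : 0 <= t ^+ 3 by rewrite exprn_ge0.
have t4 : 0 <= t ^+ 4 by rewrite exprn_ge0.
have [c40|c40] := ltP 0 c4.
  have c30 : 0 <= c3 by rewrite /c3 mulr_ge0 // obt_ge0.
  have := mulr_ge0 c10 t0; have := mulr_ge0 c20 t2.
  have := mulr_ge0 c30 t3; have := mulr_ge0 (ltW c40) t4; lra.
have t21 : 0 <= t ^+ 2 - t ^+ 3.
  by rewrite (_ : _ - _ = t ^+ 2 * (1 - t)) ?mulr_ge0 ?subr_ge0 //; ring.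
have t11 : 0 <= t - t ^+ 3.
  by rewrite (_ : _ - _ = t * (1 + t) * (1 - t)) ?mulr_ge0 ?subr_ge0 ?addr_ge0 //; ring.
have t41 : 0 <= t ^+ 3 - t ^+ 4.
  by rewrite (_ : _ - _ = t ^+ 3 * (1 - t)) ?mulr_ge0 ?subr_ge0 //; ring.
have t31 : 0 <= 1 - t ^+ 3 by rewrite subr_ge0 exprn_ile1.
have h1 := mulr_ge0 c10 t11; have h2 := mulr_ge0 c20 t21.
have h4 : 0 <= (- c4) * (t ^+ 3 - t ^+ 4) by rewrite mulr_ge0 ?oppr_ge0.
have [tz|tz] := eqVneq t 0; first by rewrite tz !expr0n /= !mulr0 !addr0.
have g3 : 0 < t ^+ 3 * (16 + c1 + c2 + c3 + c4).
  by rewrite mulr_gt0 // exprn_gt0 // lt0r tz.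
rewrite (_ : _ + c4 * t ^+ 4 = 16 * (1 - t ^+ 3) + t ^+ 3 * (16 + c1 + c2 + c3 + c4)
  + c1 * (t - t ^+ 3) + c2 * (t ^+ 2 - t ^+ 3) + - c4 * (t ^+ 3 - t ^+ 4)); last by ring.
have := mulr_ge0 (ler0n R 16) t31; move: h1 h2 h4 g3.
set x1 := c1 * _; set x2 := c2 * _; set x3 := - c4 * _; set x4 := t ^+ 3 * _; lra.
Qed.

(** * Variation of the inverse Gram matrix *)

(** The ordinals number the vertices from 0, whereas names such as [a12], ..., [a34] number them
    from 1: [a12] belongs to the entry at [o0], [o1]. *)
Notation o0 := (@Ordinal 4 0 isT).
Notation o1 := (@Ordinal 4 1 isT).
Notation o2 := (@Ordinal 4 2 isT).
Notation o3 := (@Ordinal 4 3 isT).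
Notation q0 := (@Ordinal 3 0 isT).
Notation q1 := (@Ordinal 3 1 isT).
Notation q2 := (@Ordinal 3 2 isT).

Lemma sum4 (V : nmodType) (F : 'I_4 -> V) :
  \sum_i F i = F o0 + F o1 + F o2 + F o3.
Proof.
rewrite !big_ord_recl big_ord0 addr0 !addrA.
by congr (F _ + F _ + F _ + F _); exact: val_inj.
Qed.

Lemma forall4 (P : 'I_4 -> Prop) : P o0 -> P o1 -> P o2 -> P o3 -> forall i, P i.
Proof.
move=> p0 p1 p2 p3 [[|[|[|[|i]]]] hi] //.
- by rewrite (_ : Ordinal hi = o0) //; exact: val_inj.
- by rewrite (_ : Ordinal hi = o1) //; exact: val_inj.
- by rewrite (_ : Ordinal hi = o2) //; exact: val_inj.
- by rewrite (_ : Ordinal hi = o3) //; exact: val_inj.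
Qed.

Lemma forall3 (P : 'I_3 -> Prop) : P q0 -> P q1 -> P q2 -> forall i, P i.
Proof.
move=> p0 p1 p2 [[|[|[|i]]] hi] //.
- by rewrite (_ : Ordinal hi = q0) //; exact: val_inj.
- by rewrite (_ : Ordinal hi = q1) //; exact: val_inj.
- by rewrite (_ : Ordinal hi = q2) //; exact: val_inj.
Qed.

Definition sym4 (R : Type) (d0 d1 d2 d3 x01 x02 x03 x12 x13 x23 : R) : 'M[R]_4 :=
  \matrix_(i, j)
    nth d0 (nth [::] [:: [:: d0; x01; x02; x03]; [:: x01; d1; x12; x13];
                         [:: x02; x12; d2; x23]; [:: x03; x13; x23; d3]] i) j.

Lemma eq_mx4 (R : Type) (A B : 'M[R]_4) :
  A o0 o0 = B o0 o0 -> A o0 o1 = B o0 o1 -> A o0 o2 = B o0 o2 -> A o0 o3 = B o0 o3 ->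
  A o1 o0 = B o1 o0 -> A o1 o1 = B o1 o1 -> A o1 o2 = B o1 o2 -> A o1 o3 = B o1 o3 ->
  A o2 o0 = B o2 o0 -> A o2 o1 = B o2 o1 -> A o2 o2 = B o2 o2 -> A o2 o3 = B o2 o3 ->
  A o3 o0 = B o3 o0 -> A o3 o1 = B o3 o1 -> A o3 o2 = B o3 o2 -> A o3 o3 = B o3 o3 ->
  A = B.
Proof.
move=> *; apply/matrixP; apply: forall4; apply: forall4; assumption.
Qed.

(* [- H A H] is the variation of [H = G^-1] when [G] varies by [A]; [tau] is the
   variation of [H i j], up to sign, after rescaling [H] back to its original
   diagonal. *)
Definition tau (R : fieldType) n (H A : 'M[R]_n) i j : R :=
  let M := H *m A *m H in M i j - H i j / 2 * (M i i / H i i + M j j / H j j).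

(** With [L] diagonal, the matrix of the values of [tau], zero on the diagonal, is
    [M - L *m H - H *m L]; conjugation by [G = H^-1] turns it into [N = A - G *m L - L *m G]. As [A]
    vanishes and [G] is 1 on the diagonal, the diagonal of [N] gives back [L]. *)
Lemma tau_inv (R : numFieldType) n (G H A : 'M[R]_n) :
  G *m H = 1%:M -> (forall i, H i i != 0) ->
  (forall i, G i i = 1) -> (forall i, A i i = 0) ->
  let N := G *m (\matrix_(i, j) if i == j then 0 else tau H A i j) *m G in
  forall i j, A i j = N i j - G i j / 2 * (N i i + N j j).
Proof.
move=> GH H0 G1 A0 N; have HG := mulmx1C GH.
have [M EM] : exists M, M = H *m A *m H by eexists.
pose l i := M i i / (2 * H i i).
pose L : 'M[R]_n := diag_mx (\row_i l i).
have EN : N = A - G *m L - L *m G.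
  have -> : N = G *m (M - L *m H - H *m L) *m G.
    congr (_ *m _ *m _); apply/matrixP => i j.
    rewrite mul_diag_mx mul_mx_diag !mxE; have [<-|ij] := eqVneq i j.
      by rewrite /l; field; rewrite H0.
    by rewrite /tau -EM /l; field; rewrite !H0.
  rewrite !mulmxBr !mulmxBl EM !mulmxA GH !mul1mx -!mulmxA HG !mulmx1.
  by rewrite addrAC.
have ENij i j : N i j = A i j - G i j * (l i + l j).
  by rewrite EN mul_diag_mx mul_mx_diag !mxE; ring.
by move=> i j; rewrite !ENij !G1 !A0; field.
Qed.

Lemma tau_sym (R : fieldType) n (H A : 'M[R]_n) i j :
  H^T = H -> A^T = A -> tau H A i j = tau H A j i.
Proof.
move=> HT AT; have MT : (H *m A *m H)^T = H *m A *m H.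
  by rewrite !trmx_mul HT AT mulmxA.
have E (B : 'M[R]_n) : B^T = B -> B i j = B j i by move=> {1}<-; rewrite mxE.
by rewrite /tau (E H HT) (E _ MT) [_ / _ + _]addrC.
Qed.

(** [tau] is taken to vanish at the edges 12, 13, 14 issuing from one vertex. In the sum of the
    products of [A] and [tau] there remain the edges of the opposite face, whose variations are
    expressed here by the values of [tau] at these same three edges. *)
Lemma tau_inv4 (R : numFieldType) (a12 a13 a14 a23 a24 a34 : R)
    (A12 A13 A14 A23 A24 A34 : R) (H : 'M[R]_4) :
  let G := sym4 1 1 1 1 (- a12) (- a13) (- a14) (- a23) (- a24) (- a34) in
  let A := sym4 0 0 0 0 A12 A13 A14 A23 A24 A34 in
  G *m H = 1%:M -> H^T = H -> (forall i, H i i != 0) ->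
  tau H A o2 o3 = 0 -> tau H A o1 o3 = 0 -> tau H A o1 o2 = 0 ->
  [/\ A34 = (a13 * a24 + a14 * a23 + a34 * (a13 * a23 + a14 * a24)) * tau H A o0 o1
          + (a34 ^+ 2 - 1) * (a14 * tau H A o0 o2 + a13 * tau H A o0 o3),
      A24 = (a12 * a34 + a14 * a23 + a24 * (a12 * a23 + a14 * a34)) * tau H A o0 o2
          + (a24 ^+ 2 - 1) * (a14 * tau H A o0 o1 + a12 * tau H A o0 o3) &
      A23 = (a12 * a34 + a13 * a24 + a23 * (a12 * a24 + a13 * a34)) * tau H A o0 o3
          + (a23 ^+ 2 - 1) * (a13 * tau H A o0 o1 + a12 * tau H A o0 o2)].
Proof.
move=> G A GH HT H0 t23 t13 t12.
have G1 i : G i i = 1 by move: i; apply: forall4; rewrite mxE.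
have A0 i : A i i = 0 by move: i; apply: forall4; rewrite mxE.
have AT : A^T = A by apply: eq_mx4; rewrite !mxE.
have ts i j : tau H A i j = tau H A j i by exact: tau_sym.
have := tau_inv GH H0 G1 A0; set T := \matrix_(i, j) _ => /= E.
have ET : T = sym4 0 0 0 0 (tau H A o0 o1) (tau H A o0 o2) (tau H A o0 o3) 0 0 0.
  by apply: eq_mx4; rewrite !mxE //= 1?ts ?t12 ?t13 ?t23 // ts ?t12 ?t13 ?t23.
move: E; rewrite ET; move: (tau H A o0 o1) (tau H A o0 o2) (tau H A o0 o3).
move=> u v w E; have := E o2 o3; have := E o1 o3; have := E o1 o2.
rewrite /A /G ![(_ *m sym4 _ _ _ _ _ _ _ _ _ _) _ _]mxE !sum4
  ![(sym4 _ _ _ _ _ _ _ _ _ _ *m sym4 _ _ _ _ _ _ _ _ _ _) _ _]mxE !sum4 !mxE /=.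
by move=> -> -> ->; split; field.
Qed.

Lemma tau_eq0 (R : numFieldType) n (G H A : 'M[R]_n) :
  G *m H = 1%:M -> (forall i, H i i != 0) ->
  (forall i, G i i = 1) -> (forall i, A i i = 0) ->
  (forall i j, i != j -> tau H A i j = 0) -> A = 0.
Proof.
move=> GH H0 G1 A0 t0; have := tau_inv GH H0 G1 A0; set T := \matrix_(i, j) _.
have -> : T = 0.
  by apply/matrixP => i j; rewrite !mxE; case: eqVneq => // /t0.
move=> /= E; apply/matrixP => i j; rewrite E mulmx0 mul0mx !mxE.
by rewrite addr0 mulr0 subr0.
Qed.

Ltac expand_tau := rewrite /tau ![(_ *m sym4 _ _ _ _ _ _ _ _ _ _) _ _]mxE !sum4
  ![(sym4 _ _ _ _ _ _ _ _ _ _ *m sym4 _ _ _ _ _ _ _ _ _ _) _ _]mxE !sum4 !mxE /=.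

(** The six values of [tau], written so as to separate the variation of the edge where the two faces
    meet from those of the other five edges, which share a minor of [H] as a factor. *)
Lemma tau01E (R : numFieldType) (h0 h1 h2 h3 h01 h02 h03 h12 h13 h23 : R)
    (A12 A13 A14 A23 A24 A34 : R) :
  h0 != 0 -> h1 != 0 ->
  tau (sym4 h0 h1 h2 h3 h01 h02 h03 h12 h13 h23)
      (sym4 0 0 0 0 A12 A13 A14 A23 A24 A34) o0 o1 =
  A34 * (h02 * h13 + h03 * h12
         - h01 * (h02 * h03 / h0 + h12 * h13 / h1))
  + (h0 * h1 - h01 ^+ 2) * (A12 + A13 * (h12 / h1)
       + A23 * (h02 / h0) + A14 * (h13 / h1) + A24 * (h03 / h0)).
Proof. by move=> h00 h10; expand_tau; field; rewrite h00 h10. Qed.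

Lemma tau02E (R : numFieldType) (h0 h1 h2 h3 h01 h02 h03 h12 h13 h23 : R)
    (A12 A13 A14 A23 A24 A34 : R) :
  h0 != 0 -> h2 != 0 ->
  tau (sym4 h0 h1 h2 h3 h01 h02 h03 h12 h13 h23)
      (sym4 0 0 0 0 A12 A13 A14 A23 A24 A34) o0 o2 =
  A24 * (h01 * h23 + h03 * h12
         - h02 * (h01 * h03 / h0 + h12 * h23 / h2))
  + (h0 * h2 - h02 ^+ 2) * (A13 + A12 * (h12 / h2)
       + A23 * (h01 / h0) + A14 * (h23 / h2) + A34 * (h03 / h0)).
Proof. by move=> h00 h20; expand_tau; field; rewrite h00 h20. Qed.

Lemma tau03E (R : numFieldType) (h0 h1 h2 h3 h01 h02 h03 h12 h13 h23 : R)
    (A12 A13 A14 A23 A24 A34 : R) :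
  h0 != 0 -> h3 != 0 ->
  tau (sym4 h0 h1 h2 h3 h01 h02 h03 h12 h13 h23)
      (sym4 0 0 0 0 A12 A13 A14 A23 A24 A34) o0 o3 =
  A23 * (h01 * h23 + h02 * h13
         - h03 * (h01 * h02 / h0 + h13 * h23 / h3))
  + (h0 * h3 - h03 ^+ 2) * (A14 + A12 * (h13 / h3)
       + A24 * (h01 / h0) + A13 * (h23 / h3) + A34 * (h02 / h0)).
Proof. by move=> h00 h30; expand_tau; field; rewrite h00 h30. Qed.

Lemma tau12E (R : numFieldType) (h0 h1 h2 h3 h01 h02 h03 h12 h13 h23 : R)
    (A12 A13 A14 A23 A24 A34 : R) :
  h1 != 0 -> h2 != 0 ->
  tau (sym4 h0 h1 h2 h3 h01 h02 h03 h12 h13 h23)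
      (sym4 0 0 0 0 A12 A13 A14 A23 A24 A34) o1 o2 =
  A14 * (h01 * h23 + h13 * h02
         - h12 * (h01 * h13 / h1 + h02 * h23 / h2))
  + (h1 * h2 - h12 ^+ 2) * (A23 + A12 * (h02 / h2)
       + A13 * (h01 / h1) + A24 * (h23 / h2) + A34 * (h13 / h1)).
Proof. by move=> h10 h20; expand_tau; field; rewrite h10 h20. Qed.

Lemma tau13E (R : numFieldType) (h0 h1 h2 h3 h01 h02 h03 h12 h13 h23 : R)
    (A12 A13 A14 A23 A24 A34 : R) :
  h1 != 0 -> h3 != 0 ->
  tau (sym4 h0 h1 h2 h3 h01 h02 h03 h12 h13 h23)
      (sym4 0 0 0 0 A12 A13 A14 A23 A24 A34) o1 o3 =
  A13 * (h01 * h23 + h12 * h03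
         - h13 * (h01 * h12 / h1 + h03 * h23 / h3))
  + (h1 * h3 - h13 ^+ 2) * (A24 + A12 * (h03 / h3)
       + A14 * (h01 / h1) + A23 * (h23 / h3) + A34 * (h12 / h1)).
Proof. by move=> h10 h30; expand_tau; field; rewrite h10 h30. Qed.

Lemma tau23E (R : numFieldType) (h0 h1 h2 h3 h01 h02 h03 h12 h13 h23 : R)
    (A12 A13 A14 A23 A24 A34 : R) :
  h2 != 0 -> h3 != 0 ->
  tau (sym4 h0 h1 h2 h3 h01 h02 h03 h12 h13 h23)
      (sym4 0 0 0 0 A12 A13 A14 A23 A24 A34) o2 o3 =
  A12 * (h02 * h13 + h12 * h03
         - h23 * (h02 * h12 / h2 + h03 * h13 / h3))
  + (h2 * h3 - h23 ^+ 2) * (A34 + A13 * (h03 / h3)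
       + A14 * (h02 / h2) + A23 * (h13 / h3) + A24 * (h12 / h2)).
Proof. by move=> h20 h30; expand_tau; field; rewrite h20 h30. Qed.

(** * Positive definiteness of the variation form *)

(** The cofactors of the last row form a kernel vector, nonzero unless the leading minor
    [A * B - D ^+ 2] vanishes. In that case [(- D, A, 0)] works: its product with the last row is
    [A * F - D * E], whose square is a combination of this minor and the determinant. *)
Lemma kernel3 (R : realFieldType) (A B C D E F : R) :
  0 < A -> A * B * C + 2 * D * E * F - A * F ^+ 2 - B * E ^+ 2 - C * D ^+ 2 = 0 ->
  exists X Y Z : R, [/\ (X, Y, Z) != (0, 0, 0), A * X + D * Y + E * Z = 0,
    D * X + B * Y + F * Z = 0 & E * X + F * Y + C * Z = 0].
Proof.
move=> A0 det; have An : A != 0 by rewrite gt_eqF.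
have [m0|mn] := eqVneq (A * B - D ^+ 2) 0.
  exists (- D), A, 0; split.
  - by apply/eqP => -[_ A00]; rewrite A00 eqxx in An.
  - by ring.
  - by rewrite -[RHS]m0; ring.
  - have : (A * F - D * E) ^+ 2 = 0.
      rewrite (_ : _ ^+ 2 = (A * B - D ^+ 2) * (A * C - E ^+ 2) - A *
        (A * B * C + 2 * D * E * F - A * F ^+ 2 - B * E ^+ 2 - C * D ^+ 2)); last by ring.
      by rewrite det m0; ring.
    by move/eqP; rewrite sqrf_eq0 => /eqP h; rewrite -[RHS]h; ring.
exists (D * F - B * E), (D * E - A * F), (A * B - D ^+ 2); split.
- by apply/eqP => -[_ _ m0]; rewrite m0 eqxx in mn.
- by ring.
- by ring.
- by rewrite -[RHS]det; ring.
Qed.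

Lemma solve3 (R : fieldType) (A B C D E F x y z : R) :
  A * B * C + 2 * D * E * F - A * F ^+ 2 - B * E ^+ 2 - C * D ^+ 2 != 0 ->
  exists X Y Z : R, [/\ A * X + D * Y + E * Z = x,
    D * X + B * Y + F * Z = y & E * X + F * Y + C * Z = z].
Proof.
set d := _ - C * D ^+ 2 => d0.
exists (((B * C - F ^+ 2) * x + (E * F - D * C) * y + (D * F - B * E) * z) / d),
  (((E * F - D * C) * x + (A * C - E ^+ 2) * y + (D * E - A * F) * z) / d),
  (((D * F - B * E) * x + (D * E - A * F) * y + (A * B - D ^+ 2) * z) / d).
by split; rewrite /d in d0 *; field.
Qed.

(** [tau] at the faces [c] and [d] divided by the minor of [H] at these faces, as a linear form in
    the variations of the six edges: [Aab] belongs to the edge where the two faces meet, [Acd] to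
    the opposite one. The 6 by 6 matrix formed by these linear forms is symmetric. *)
Definition tform (R : comUnitRingType) (n Aab Acd Aac Aad Abc Abd cac cad cbc cbd kc kd : R) :
    R :=
  n * Aab + Acd - cad / kd * Aac - cac / kc * Aad - cbd / kd * Abc - cbc / kc * Abd.

(** An orthogonal splitting. The block on the edges 12, 13, 14 is positive definite by Sylvester's
    criterion, so some [(X, Y, Z)] supported there has the same values [t12], [t13], [t14] as the
    given variation. The difference of the two is orthogonal to the block, and the form is the sum
    of its values on both. *)
Lemma posdef_split (R : realFieldType) (n12 n13 n14 n23 n24 n34 : R)
    (c12 c13 c14 c23 c24 c34 k1 k2 k3 k4 : R) :
  0 < n12 -> 0 < n12 * n13 - (- (c14 / k4)) ^+ 2 ->
  0 < n12 * n13 * n14 + 2 * - (c14 / k4) * - (c13 / k3) * - (c12 / k2)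
    - n12 * (- (c12 / k2)) ^+ 2 - n13 * (- (c13 / k3)) ^+ 2 - n14 * (- (c14 / k4)) ^+ 2 ->
  (forall A12 A13 A14 A23 A24 A34 : R,
    tform n12 A12 A34 A13 A14 A23 A24 c13 c14 c23 c24 k3 k4 = 0 ->
    tform n13 A13 A24 A12 A14 A23 A34 c12 c14 c23 c34 k2 k4 = 0 ->
    tform n14 A14 A23 A12 A13 A24 A34 c12 c13 c24 c34 k2 k3 = 0 ->
    [|| A12 != 0, A13 != 0, A14 != 0, A23 != 0, A24 != 0 | A34 != 0] ->
    0 < A23 * tform n23 A23 A14 A12 A24 A13 A34 c12 c24 c13 c34 k1 k4
      + A24 * tform n24 A24 A13 A12 A23 A14 A34 c12 c23 c14 c34 k1 k3
      + A34 * tform n34 A34 A12 A13 A23 A14 A24 c13 c23 c14 c24 k1 k2) ->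
  forall A12 A13 A14 A23 A24 A34 : R,
    [|| A12 != 0, A13 != 0, A14 != 0, A23 != 0, A24 != 0 | A34 != 0] ->
    0 < A12 * tform n12 A12 A34 A13 A14 A23 A24 c13 c14 c23 c24 k3 k4
      + A13 * tform n13 A13 A24 A12 A14 A23 A34 c12 c14 c23 c34 k2 k4
      + A14 * tform n14 A14 A23 A12 A13 A24 A34 c12 c13 c24 c34 k2 k3
      + A23 * tform n23 A23 A14 A12 A24 A13 A34 c12 c24 c13 c34 k1 k4
      + A24 * tform n24 A24 A13 A12 A23 A14 A34 c12 c23 c14 c34 k1 k3
      + A34 * tform n34 A34 A12 A13 A23 A14 A24 c13 c23 c14 c24 k1 k2.
Proof.
move=> n0 m0 d0 HU A12 A13 A14 A23 A24 A34 An.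
set t12 := tform n12 A12 A34 A13 A14 A23 A24 c13 c14 c23 c24 k3 k4.
set t13 := tform n13 A13 A24 A12 A14 A23 A34 c12 c14 c23 c34 k2 k4.
set t14 := tform n14 A14 A23 A12 A13 A24 A34 c12 c13 c24 c34 k2 k3.
set t23 := tform n23 A23 A14 A12 A24 A13 A34 c12 c24 c13 c34 k1 k4.
set t24 := tform n24 A24 A13 A12 A23 A14 A34 c12 c23 c14 c34 k1 k3.
set t34 := tform n34 A34 A12 A13 A23 A14 A24 c13 c23 c14 c24 k1 k2.
have [X [Y [Z [e1 e2 e3]]]] := solve3 t12 t13 t14 (lt0r_neq0 d0).
have := HU (A12 - X) (A13 - Y) (A14 - Z) A23 A24 A34.
set s12 := tform n12 _ _ _ _ _ _ _ _ _ _ _ _; set s13 := tform n13 _ _ _ _ _ _ _ _ _ _ _ _.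
set s14 := tform n14 _ _ _ _ _ _ _ _ _ _ _ _; set s23 := tform n23 _ _ _ _ _ _ _ _ _ _ _ _.
set s24 := tform n24 _ _ _ _ _ _ _ _ _ _ _ _; set s34 := tform n34 _ _ _ _ _ _ _ _ _ _ _ _.
have E12 : s12 = 0.
  by rewrite -(subrr t12) -{2}e1 /s12 /t12 /tform; ring.
have E13 : s13 = 0.
  by rewrite -(subrr t13) -{2}e2 /s13 /t13 /tform; ring.
have E14 : s14 = 0.
  by rewrite -(subrr t14) -{2}e3 /s14 /t14 /tform; ring.
move=> /(_ E12 E13 E14) HU'.
have [q0 qe] := posdef3 X Y Z n0 m0 d0.
set q := (X in 0 <= X) in q0 qe.
have -> : A12 * t12 + A13 * t13 + A14 * t14 + A23 * t23 + A24 * t24 + A34 * t34 =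
    q + (A23 * s23 + A24 * s24 + A34 * s34)
    + (A12 + X) * s12 + (A13 + Y) * s13 + (A14 + Z) * s14.
  by rewrite /q /t12 /t13 /t14 /t23 /t24 /t34 /s12 /s13 /s14 /s23 /s24 /s34 /tform; ring.
rewrite E12 E13 E14 !mulr0 !addr0.
have [|An'] := boolP [|| A12 - X != 0, A13 - Y != 0, A14 - Z != 0,
  A23 != 0, A24 != 0 | A34 != 0]; first by move=> /HU' h; rewrite ltr_wpDl.
move: An'; rewrite !negb_or !negbK !subr_eq0.
move=> /and5P[/eqP x1 /eqP x2 /eqP x3 /eqP x4 /andP[/eqP x5 /eqP x6]].
rewrite x4 x5 x6 !mul0r !addr0 lt0r q0 andbT eq_sym qe.
move: An; rewrite x4 x5 x6 x1 x2 x3 eqxx /= !orbF.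
by rewrite !negb_and orbA.
Qed.

(** [minor2] and [minor3] are the leading minors of orders 2 and 3 of the block on the edges 12, 13,
    14, with the denominators cleared. As polynomials over any commutative ring they can also be
    evaluated in [{poly R}]. *)
Definition minor2 (R : comRingType) (c12 c13 c14 c23 c24 c34 k2 k3 k4 : R) : R :=
  diagf c13 c14 c24 c23 c34 k3 k4 * diagf c12 c14 c34 c23 c24 k2 k4
  - c14 ^+ 2 * (k2 * k3 * (k3 * k4 - c34 ^+ 2) * (k2 * k4 - c24 ^+ 2)).

Definition minor3 (R : comRingType) (c12 c13 c14 c23 c24 c34 k2 k3 k4 : R) : R :=
  let F12 := diagf c13 c14 c24 c23 c34 k3 k4 in
  let F13 := diagf c12 c14 c34 c23 c24 k2 k4 in
  let F14 := diagf c12 c13 c34 c24 c23 k2 k3 in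
  let E34 := (k3 * k4 - c34 ^+ 2) in let E24 := (k2 * k4 - c24 ^+ 2) in let E23 :=
      (k2 * k3 - c23 ^+ 2) in
  F12 * F13 * F14 - 2 * c12 * c13 * c14 * (k2 * k3 * k4 * E34 * E24 * E23)
  - F12 * c12 ^+ 2 * (k3 * k4 * E24 * E23) - F13 * c13 ^+ 2 * (k2 * k4 * E34 * E23)
  - F14 * c14 ^+ 2 * (k2 * k3 * E34 * E24).

(** Compatibility with ring morphisms serves for the evaluation of polynomials: it identifies the
    minors along a segment with the values of one polynomial. *)
Lemma kap_rmorph (R S : comRingType) (f : {rmorphism R -> S}) x y z :
  f (kap x y z) = kap (f x) (f y) (f z).
Proof. by rewrite /kap !(rmorphB, rmorphD, rmorphN, rmorphM, rmorphXn, rmorph1, rmorph_nat). Qed.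

Lemma cofo_rmorph (R S : comRingType) (f : {rmorphism R -> S}) x w p q r s :
  f (cofo x w p q r s) = cofo (f x) (f w) (f p) (f q) (f r) (f s).
Proof. by rewrite /cofo !(rmorphB, rmorphD, rmorphN, rmorphM, rmorphXn, rmorph1, rmorph_nat). Qed.

Lemma diagf_rmorph (R S : comRingType) (f : {rmorphism R -> S}) p q r s y k k' :
  f (diagf p q r s y k k') = diagf (f p) (f q) (f r) (f s) (f y) (f k) (f k').
Proof. by rewrite /diagf !(rmorphD, rmorphM). Qed.

Lemma minor2_rmorph (R S : comRingType) (f : {rmorphism R -> S}) c12 c13 c14 c23 c24 c34 k2 k3
    k4 :
  f (minor2 c12 c13 c14 c23 c24 c34 k2 k3 k4) =
  minor2 (f c12) (f c13) (f c14) (f c23) (f c24) (f c34) (f k2) (f k3) (f k4).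
Proof.
by rewrite /minor2 !(rmorphB, rmorphM, rmorphXn) !diagf_rmorph.
Qed.

Lemma minor3_rmorph (R S : comRingType) (f : {rmorphism R -> S}) c12 c13 c14 c23 c24 c34 k2 k3
    k4 :
  f (minor3 c12 c13 c14 c23 c24 c34 k2 k3 k4) =
  minor3 (f c12) (f c13) (f c14) (f c23) (f c24) (f c34) (f k2) (f k3) (f k4).
Proof.
by rewrite /minor3 /= !(rmorphB, rmorphM, rmorphXn, rmorph_nat) !diagf_rmorph.
Qed.

Lemma minor2E (R : fieldType) (c12 c13 c14 c23 c24 c34 k2 k3 k4 : R) :
  k2 != 0 -> k3 != 0 -> k4 != 0 -> (k3 * k4 - c34 ^+ 2) != 0 -> (k2 * k4 - c24 ^+ 2) != 0 ->
  (diagf c13 c14 c24 c23 c34 k3 k4 / (k3 * k4 * (k3 * k4 - c34 ^+ 2)))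
      * (diagf c12 c14 c34 c23 c24 k2 k4 / (k2 * k4 * (k2 * k4 - c24 ^+ 2)))
      - (- (c14 / k4)) ^+ 2 =
  minor2 c12 c13 c14 c23 c24 c34 k2 k3 k4
      / (k2 * k3 * k4 ^+ 2 * (k3 * k4 - c34 ^+ 2) * (k2 * k4 - c24 ^+ 2)).
Proof.
move=> *; rewrite /minor2; move: (diagf _ _ _ _ _ k3 k4) (diagf _ _ _ _ _ k2 k4) => F12 F13.
by field; do ?[apply/andP; split].
Qed.

Lemma minor3E (R : fieldType) (c12 c13 c14 c23 c24 c34 k2 k3 k4 : R) :
  k2 != 0 -> k3 != 0 -> k4 != 0 -> (k3 * k4 - c34 ^+ 2) != 0 -> (k2 * k4 - c24 ^+ 2) != 0 ->
      (k2 * k3 - c23 ^+ 2) != 0 ->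
  let n12 := (diagf c13 c14 c24 c23 c34 k3 k4 / (k3 * k4 * (k3 * k4 - c34 ^+ 2))) in
  let n13 := (diagf c12 c14 c34 c23 c24 k2 k4 / (k2 * k4 * (k2 * k4 - c24 ^+ 2))) in
  let n14 := (diagf c12 c13 c34 c24 c23 k2 k3 / (k2 * k3 * (k2 * k3 - c23 ^+ 2))) in
  n12 * n13 * n14 + 2 * - (c14 / k4) * - (c13 / k3) * - (c12 / k2)
    - n12 * (- (c12 / k2)) ^+ 2 - n13 * (- (c13 / k3)) ^+ 2 - n14 * (- (c14 / k4)) ^+ 2 =
  minor3 c12 c13 c14 c23 c24 c34 k2 k3 k4 / (k2 ^+ 2 * k3 ^+ 2 * k4 ^+ 2 * (k3 * k4 - c34 ^+ 2)
      * (k2 * k4 - c24 ^+ 2) * (k2 * k3 - c23 ^+ 2)).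
Proof.
move=> k20 k30 k40 e34 e24 e23; rewrite /minor3 /=.
move: (diagf _ _ _ _ _ k3 k4) (diagf _ _ _ _ _ k2 k4) (diagf _ _ _ _ _ k2 k3) => F12 F13 F14.
by field; rewrite k20 k30 k40 e34 e24 e23.
Qed.

Lemma gram_inverse (R : fieldType) (a12 a13 a14 a23 a24 a34 : R) :
  let D := gdel a12 a13 a14 a23 a24 a34 in D != 0 ->
  sym4 1 1 1 1 (- a12) (- a13) (- a14) (- a23) (- a24) (- a34) *m
  sym4 (kap a23 a24 a34 / D) (kap a13 a14 a34 / D) (kap a12 a14 a24 / D) (kap a12 a13 a23 / D)
    (- (cofo a12 a34 a13 a23 a14 a24 / D)) (- (cofo a13 a24 a12 a23 a14 a34 / D))
        (- (cofo a14 a23 a12 a24 a13 a34 / D)) (- (cofo a23 a14 a12 a13 a24 a34 / D))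
        (- (cofo a24 a13 a12 a14 a23 a34 / D)) (- (cofo a34 a12 a13 a14 a23 a24 / D)) = 1%:M.
Proof.
move=> D D0; apply: eq_mx4; rewrite !mxE !sum4 !mxE /=.
all: by rewrite /kap /cofo; move: D0; rewrite /D /gdel => D0; field.
Qed.

Lemma tau12_tform (R : numFieldType) (D c12 c13 c14 c23 c24 c34 k1 k2 k3 k4 A12 A13 A14 A23 A24
    A34 : R) :
  D != 0 -> k1 != 0 -> k2 != 0 -> (k1 * k2 - c12 ^+ 2) != 0 ->
  tau (sym4 (k1 / D) (k2 / D) (k3 / D) (k4 / D)
       (- (c12 / D)) (- (c13 / D)) (- (c14 / D)) (- (c23 / D)) (- (c24 / D)) (- (c34 / D)))
    (sym4 0 0 0 0 A12 A13 A14 A23 A24 A34) o0 o1 =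
  (k1 * k2 - c12 ^+ 2) / D ^+ 2 *
    tform (diagf c13 c23 c24 c14 c12 k1 k2 / (k1 * k2 * (k1 * k2 - c12 ^+ 2))) A34 A12 A13 A23
        A14 A24 c13 c23 c14 c24 k1 k2.
Proof.
move=> D0 kc0 kd0 e0; rewrite tau01E ?mulf_neq0 ?invr_neq0 // /tform /diagf.
by field; rewrite D0 kc0 kd0 e0.
Qed.

Lemma tau13_tform (R : numFieldType) (D c12 c13 c14 c23 c24 c34 k1 k2 k3 k4 A12 A13 A14 A23 A24
    A34 : R) :
  D != 0 -> k1 != 0 -> k3 != 0 -> (k1 * k3 - c13 ^+ 2) != 0 ->
  tau (sym4 (k1 / D) (k2 / D) (k3 / D) (k4 / D)
       (- (c12 / D)) (- (c13 / D)) (- (c14 / D)) (- (c23 / D)) (- (c24 / D)) (- (c34 / D)))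
    (sym4 0 0 0 0 A12 A13 A14 A23 A24 A34) o0 o2 =
  (k1 * k3 - c13 ^+ 2) / D ^+ 2 *
    tform (diagf c12 c23 c34 c14 c13 k1 k3 / (k1 * k3 * (k1 * k3 - c13 ^+ 2))) A24 A13 A12 A23
        A14 A34 c12 c23 c14 c34 k1 k3.
Proof.
move=> D0 kc0 kd0 e0; rewrite tau02E ?mulf_neq0 ?invr_neq0 // /tform /diagf.
by field; rewrite D0 kc0 kd0 e0.
Qed.

Lemma tau14_tform (R : numFieldType) (D c12 c13 c14 c23 c24 c34 k1 k2 k3 k4 A12 A13 A14 A23 A24
    A34 : R) :
  D != 0 -> k1 != 0 -> k4 != 0 -> (k1 * k4 - c14 ^+ 2) != 0 ->
  tau (sym4 (k1 / D) (k2 / D) (k3 / D) (k4 / D)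
       (- (c12 / D)) (- (c13 / D)) (- (c14 / D)) (- (c23 / D)) (- (c24 / D)) (- (c34 / D)))
    (sym4 0 0 0 0 A12 A13 A14 A23 A24 A34) o0 o3 =
  (k1 * k4 - c14 ^+ 2) / D ^+ 2 *
    tform (diagf c12 c24 c34 c13 c14 k1 k4 / (k1 * k4 * (k1 * k4 - c14 ^+ 2))) A23 A14 A12 A24
        A13 A34 c12 c24 c13 c34 k1 k4.
Proof.
move=> D0 kc0 kd0 e0; rewrite tau03E ?mulf_neq0 ?invr_neq0 // /tform /diagf.
by field; rewrite D0 kc0 kd0 e0.
Qed.

Lemma tau23_tform (R : numFieldType) (D c12 c13 c14 c23 c24 c34 k1 k2 k3 k4 A12 A13 A14 A23 A24
    A34 : R) :
  D != 0 -> k2 != 0 -> k3 != 0 -> (k2 * k3 - c23 ^+ 2) != 0 ->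
  tau (sym4 (k1 / D) (k2 / D) (k3 / D) (k4 / D)
       (- (c12 / D)) (- (c13 / D)) (- (c14 / D)) (- (c23 / D)) (- (c24 / D)) (- (c34 / D)))
    (sym4 0 0 0 0 A12 A13 A14 A23 A24 A34) o1 o2 =
  (k2 * k3 - c23 ^+ 2) / D ^+ 2 *
    tform (diagf c12 c13 c34 c24 c23 k2 k3 / (k2 * k3 * (k2 * k3 - c23 ^+ 2))) A14 A23 A12 A13
        A24 A34 c12 c13 c24 c34 k2 k3.
Proof.
move=> D0 kc0 kd0 e0; rewrite tau12E ?mulf_neq0 ?invr_neq0 // /tform /diagf.
by field; rewrite D0 kc0 kd0 e0.
Qed.

Lemma tau24_tform (R : numFieldType) (D c12 c13 c14 c23 c24 c34 k1 k2 k3 k4 A12 A13 A14 A23 A24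
    A34 : R) :
  D != 0 -> k2 != 0 -> k4 != 0 -> (k2 * k4 - c24 ^+ 2) != 0 ->
  tau (sym4 (k1 / D) (k2 / D) (k3 / D) (k4 / D)
       (- (c12 / D)) (- (c13 / D)) (- (c14 / D)) (- (c23 / D)) (- (c24 / D)) (- (c34 / D)))
    (sym4 0 0 0 0 A12 A13 A14 A23 A24 A34) o1 o3 =
  (k2 * k4 - c24 ^+ 2) / D ^+ 2 *
    tform (diagf c12 c14 c34 c23 c24 k2 k4 / (k2 * k4 * (k2 * k4 - c24 ^+ 2))) A13 A24 A12 A14
        A23 A34 c12 c14 c23 c34 k2 k4.
Proof.
move=> D0 kc0 kd0 e0; rewrite tau13E ?mulf_neq0 ?invr_neq0 // /tform /diagf.
by field; rewrite D0 kc0 kd0 e0.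
Qed.

Lemma tau34_tform (R : numFieldType) (D c12 c13 c14 c23 c24 c34 k1 k2 k3 k4 A12 A13 A14 A23 A24
    A34 : R) :
  D != 0 -> k3 != 0 -> k4 != 0 -> (k3 * k4 - c34 ^+ 2) != 0 ->
  tau (sym4 (k1 / D) (k2 / D) (k3 / D) (k4 / D)
       (- (c12 / D)) (- (c13 / D)) (- (c14 / D)) (- (c23 / D)) (- (c24 / D)) (- (c34 / D)))
    (sym4 0 0 0 0 A12 A13 A14 A23 A24 A34) o2 o3 =
  (k3 * k4 - c34 ^+ 2) / D ^+ 2 *
    tform (diagf c13 c14 c24 c23 c34 k3 k4 / (k3 * k4 * (k3 * k4 - c34 ^+ 2))) A12 A34 A13 A14
        A23 A24 c13 c14 c23 c24 k3 k4.
Proof.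
move=> D0 kc0 kd0 e0; rewrite tau23E ?mulf_neq0 ?invr_neq0 // /tform /diagf.
by field; rewrite D0 kc0 kd0 e0.
Qed.

(** Jacobi's identity: a minor of order 2 of the cofactor matrix is the determinant, here [- gdel],
    times the complementary minor [1 - a ^+ 2] of the Gram matrix. *)
Lemma cofactor_minor_gt0 (R : realDomainType) (a12 a13 a14 a23 a24 a34 : R) :
  1 < a12 -> 1 < a13 -> 1 < a14 -> 1 < a23 -> 1 < a24 -> 1 < a34 ->
      0 < gdel a12 a13 a14 a23 a24 a34 ->
  [/\ 0 < (kap a23 a24 a34) * (kap a13 a14 a34) - (cofo a12 a34 a13 a23 a14 a24) ^+ 2,
    0 < (kap a23 a24 a34) * (kap a12 a14 a24) - (cofo a13 a24 a12 a23 a14 a34) ^+ 2 &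
    0 < (kap a23 a24 a34) * (kap a12 a13 a23) - (cofo a14 a23 a12 a24 a13 a34) ^+ 2] /\
  [/\ 0 < (kap a13 a14 a34) * (kap a12 a14 a24) - (cofo a23 a14 a12 a13 a24 a34) ^+ 2,
    0 < (kap a13 a14 a34) * (kap a12 a13 a23) - (cofo a24 a13 a12 a14 a23 a34) ^+ 2 &
    0 < (kap a12 a14 a24) * (kap a12 a13 a23) - (cofo a34 a12 a13 a14 a23 a24) ^+ 2].
Proof.
move=> h12 h13 h14 h23 h24 h34 D0.
have s (x : R) : 1 < x -> 0 < x ^+ 2 - 1 by move=> x1; rewrite subr_gt0 exprn_egt1.
split; split.
- by rewrite (_ : _ - _ = gdel a12 a13 a14 a23 a24 a34 * (a34 ^+ 2 - 1)) ?mulr_gt0 ?s //;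
    rewrite /kap /cofo /gdel; ring.
- by rewrite (_ : _ - _ = gdel a12 a13 a14 a23 a24 a34 * (a24 ^+ 2 - 1)) ?mulr_gt0 ?s //;
    rewrite /kap /cofo /gdel; ring.
- by rewrite (_ : _ - _ = gdel a12 a13 a14 a23 a24 a34 * (a23 ^+ 2 - 1)) ?mulr_gt0 ?s //;
    rewrite /kap /cofo /gdel; ring.
- by rewrite (_ : _ - _ = gdel a12 a13 a14 a23 a24 a34 * (a14 ^+ 2 - 1)) ?mulr_gt0 ?s //;
    rewrite /kap /cofo /gdel; ring.
- by rewrite (_ : _ - _ = gdel a12 a13 a14 a23 a24 a34 * (a13 ^+ 2 - 1)) ?mulr_gt0 ?s //;
    rewrite /kap /cofo /gdel; ring.
- by rewrite (_ : _ - _ = gdel a12 a13 a14 a23 a24 a34 * (a12 ^+ 2 - 1)) ?mulr_gt0 ?s //;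
    rewrite /kap /cofo /gdel; ring.
Qed.

(** The eight sums required by [diagf_gt0] are again minors of order 2 of the cofactor matrix, up to
    sign. By Jacobi's identity they are [gdel] times a sum of the shape [a14 + a12 * a24]. *)
Lemma diagf12_gt0 (R : realFieldType) (a12 a13 a14 a23 a24 a34 : R) :
  1 < a12 -> 1 < a13 -> 1 < a14 -> 1 < a23 -> 1 < a24 -> 1 < a34 ->
      0 < gdel a12 a13 a14 a23 a24 a34 ->
  0 < diagf (cofo a13 a24 a12 a23 a14 a34) (cofo a14 a23 a12 a24 a13 a34)
      (cofo a24 a13 a12 a14 a23 a34) (cofo a23 a14 a12 a13 a24 a34)
      (cofo a34 a12 a13 a14 a23 a24) (kap a12 a14 a24) (kap a12 a13 a23).
Proof.
move=> h12 h13 h14 h23 h24 h34 D0.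
have [[e12 e13 e14] [e23 e24 e34]] := cofactor_minor_gt0 h12 h13 h14 h23 h24 h34 D0.
have V (x y : R) : 1 < x -> 0 < y -> 0 < gdel a12 a13 a14 a23 a24 a34 * (x + y).
  by move=> x1 y0; rewrite mulr_gt0 // addr_gt0 // (lt_trans ltr01).
have M (x y : R) : 1 < x -> 1 < y -> 0 < x * y by move=> x1 y1;
    rewrite mulr_gt0 // (lt_trans ltr01).
apply: (@diagf_gt0 _ (cofo a12 a34 a13 a23 a14 a24) (cofo a13 a24 a12 a23 a14 a34)
    (cofo a14 a23 a12 a24 a13 a34) (cofo a23 a14 a12 a13 a24 a34) (cofo a24 a13 a12 a14 a23 a34)
    (cofo a34 a12 a13 a14 a23 a24) (kap a23 a24 a34) (kap a13 a14 a34) (kap a12 a14 a24)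
    (kap a12 a13 a23)).
- exact: kap_gt0.
- exact: kap_gt0.
- exact: kap_gt0.
- exact: kap_gt0.
- by move: e12; rewrite ?[_ * kap a23 a24 a34]mulrC.
- by move: e34; rewrite ?[_ * kap a12 a14 a24]mulrC.
- by rewrite (_ : _ + _ = gdel a12 a13 a14 a23 a24 a34 * (a14 + a12 * a24)) ?V ?M //;
    rewrite /kap /cofo /gdel; ring.
- by rewrite (_ : _ + _ = gdel a12 a13 a14 a23 a24 a34 * (a13 + a12 * a23)) ?V ?M //;
    rewrite /kap /cofo /gdel; ring.
- by rewrite (_ : _ + _ = gdel a12 a13 a14 a23 a24 a34 * (a23 + a12 * a13)) ?V ?M //;
    rewrite /kap /cofo /gdel; ring.
- by rewrite (_ : _ + _ = gdel a12 a13 a14 a23 a24 a34 * (a24 + a12 * a14)) ?V ?M //;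
    rewrite /kap /cofo /gdel; ring.
- by rewrite (_ : _ + _ = gdel a12 a13 a14 a23 a24 a34 * (a13 + a14 * a34)) ?V ?M //;
    rewrite /kap /cofo /gdel; ring.
- by rewrite (_ : _ + _ = gdel a12 a13 a14 a23 a24 a34 * (a23 + a24 * a34)) ?V ?M //;
    rewrite /kap /cofo /gdel; ring.
- by rewrite (_ : _ + _ = gdel a12 a13 a14 a23 a24 a34 * (a14 + a13 * a34)) ?V ?M //;
    rewrite /kap /cofo /gdel; ring.
- by rewrite (_ : _ + _ = gdel a12 a13 a14 a23 a24 a34 * (a24 + a23 * a34)) ?V ?M //;
    rewrite /kap /cofo /gdel; ring.
Qed.

(** The ternary form obtained by inserting [tau_inv4], with [x], [y], [z] the values of [tau] at the
    edges 34, 24, 23. Cleared of denominators, its leading minors are sums of positive terms, and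
    the determinant has the factor [kap a23 a24 a34]. *)
Lemma face_block_gt0 (R : realFieldType) (a12 a13 a14 a23 a24 a34 x y z : R) :
  1 < a12 -> 1 < a13 -> 1 < a14 -> 1 < a23 -> 1 < a24 -> 1 < a34 ->
  let s34 := a34 ^+ 2 - 1 in let s24 := a24 ^+ 2 - 1 in let s23 := a23 ^+ 2 - 1 in
  let m12 := a13 * a24 + a14 * a23 + a34 * (a13 * a23 + a14 * a24) in
  let m13 := a12 * a34 + a14 * a23 + a24 * (a12 * a23 + a14 * a34) in
  let m14 := a12 * a34 + a13 * a24 + a23 * (a12 * a24 + a13 * a34) in
  0 <= (m12 * x + s34 * (a14 * y + a13 * z)) * x / s34
     + (m13 * y + s24 * (a14 * x + a12 * z)) * y / s24
     + (m14 * z + s23 * (a13 * x + a12 * y)) * z / s23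
    ?= iff ((x == 0) && (y == 0) && (z == 0)).
Proof.
move=> h12 h13 h14 h23 h24 h34 s34 s24 s23 m12 m13 m14.
have s (u : R) : 1 < u -> 0 < u ^+ 2 - 1 by move=> x1; rewrite subr_gt0 exprn_egt1.
have p (u : R) : 1 < u -> 0 < u by apply: lt_trans.
have p12 := p _ h12; have p13 := p _ h13; have p14 := p _ h14.
have p23 := p _ h23; have p24 := p _ h24; have p34 := p _ h34.
have s340 : 0 < s34 by exact: s. have s240 : 0 < s24 by exact: s.
have s230 : 0 < s23 by exact: s.
have m120 : 0 < m12 by do ?[apply: addr_gt0 | apply: mulr_gt0].
have m130 : 0 < m13 by do ?[apply: addr_gt0 | apply: mulr_gt0].
have minor : 0 < m12 * m13 - a14 ^+ 2 * s34 * s24.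
  have q1 : 0 < (a13 * a24 + a14 * a23 + a34 * a13 * a23) * m13.
    by do ?[apply: addr_gt0 | apply: mulr_gt0].
  have q2 : 0 < a14 * a24 * a34 * (a12 * a34 + a14 * a23 + a24 * a12 * a23).
    by do ?[apply: addr_gt0 | apply: mulr_gt0].
  have q3 : 0 < a14 ^+ 2 * (s34 + a24 ^+ 2)
    by rewrite mulr_gt0 ?exprn_gt0 // addr_gt0 // exprn_gt0.
  rewrite (_ : _ - _ = (a13 * a24 + a14 * a23 + a34 * a13 * a23) * m13
    + a14 * a24 * a34 * (a12 * a34 + a14 * a23 + a24 * a12 * a23)
    + a14 ^+ 2 * (s34 + a24 ^+ 2)); last by rewrite /m12 /m13 /s34 /s24; ring.
  by rewrite !addr_gt0.
have det : 0 < m12 * m13 * m14 + 2 * a12 * a13 * a14 * s34 * s24 * s23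
    - m12 * a12 ^+ 2 * s24 * s23 - m13 * a13 ^+ 2 * s34 * s23
    - m14 * a14 ^+ 2 * s34 * s24.
  rewrite (_ : _ - _ = kap a23 a24 a34 *
    (a12 ^+ 2 * (a13 * a23 * a34 + a13 * a24 + a14 * a23 + a14 * a24 * a34)
     + a13 ^+ 2 * (a12 * a23 * a24 + a12 * a34 + a14 * a23 + a14 * a24 * a34)
     + a14 ^+ 2 * (a12 * a23 * a24 + a12 * a34 + a13 * a23 * a34 + a13 * a24)
     + 2 * a12 * a13 * a14 * (a23 * a24 * a34 + 1))); last first.
    by rewrite /kap /m12 /m13 /m14 /s34 /s24 /s23; ring.
  apply: mulr_gt0; first exact: kap_gt0.
  by do ?[apply: addr_gt0 | apply: mulr_gt0 | apply: exprn_gt0].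
have := @posdef3 R (m12 / s34) (m13 / s24) (m14 / s23) a14 a13 a12 x y z.
rewrite (_ : m12 / s34 * x ^+ 2 + _ + _ + _ =
  (m12 * x + s34 * (a14 * y + a13 * z)) * x / s34
     + (m13 * y + s24 * (a14 * x + a12 * z)) * y / s24
     + (m14 * z + s23 * (a13 * x + a12 * y)) * z / s23); last first.
  by field; rewrite !lt0r_neq0.
apply; first by rewrite divr_gt0.
  rewrite (_ : _ - _ = (m12 * m13 - a14 ^+ 2 * s34 * s24) / (s34 * s24)).
    by rewrite divr_gt0 // mulr_gt0.
  by field; rewrite !lt0r_neq0.
rewrite (_ : _ - _ = (m12 * m13 * m14 + 2 * a12 * a13 * a14 * s34 * s24 * s23
    - m12 * a12 ^+ 2 * s24 * s23 - m13 * a13 ^+ 2 * s34 * s23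
    - m14 * a14 ^+ 2 * s34 * s24) / (s34 * s24 * s23)).
  by rewrite divr_gt0 // !mulr_gt0.
by field; rewrite !lt0r_neq0.
Qed.

(** In terms of [tau], each remaining [tform] is [gdel] times [tau / (a ^+ 2 - 1)], so the sum is
    [gdel] times the form of [face_block_gt0]. It vanishes only if all six values of [tau] do, and
    then [A = 0] by [tau_eq0]. *)
Lemma face_form_gt0 (R : realFieldType) (a12 a13 a14 a23 a24 a34 A12 A13 A14 A23 A24 A34 : R) :
  1 < a12 -> 1 < a13 -> 1 < a14 -> 1 < a23 -> 1 < a24 -> 1 < a34 ->
      0 < gdel a12 a13 a14 a23 a24 a34 ->
  let c12 := cofo a12 a34 a13 a23 a14 a24 in
  let c13 := cofo a13 a24 a12 a23 a14 a34 in
  let c14 := cofo a14 a23 a12 a24 a13 a34 in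
  let c23 := cofo a23 a14 a12 a13 a24 a34 in
  let c24 := cofo a24 a13 a12 a14 a23 a34 in
  let c34 := cofo a34 a12 a13 a14 a23 a24 in
  let k1 := kap a23 a24 a34 in
  let k2 := kap a13 a14 a34 in
  let k3 := kap a12 a14 a24 in
  let k4 := kap a12 a13 a23 in
  tform (diagf c13 c14 c24 c23 c34 k3 k4 / (k3 * k4 * (k3 * k4 - c34 ^+ 2))) A12 A34 A13 A14 A23
      A24 c13 c14 c23 c24 k3 k4 = 0 ->
  tform (diagf c12 c14 c34 c23 c24 k2 k4 / (k2 * k4 * (k2 * k4 - c24 ^+ 2))) A13 A24 A12 A14 A23
      A34 c12 c14 c23 c34 k2 k4 = 0 ->
  tform (diagf c12 c13 c34 c24 c23 k2 k3 / (k2 * k3 * (k2 * k3 - c23 ^+ 2))) A14 A23 A12 A13 A24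
      A34 c12 c13 c24 c34 k2 k3 = 0 ->
  [|| A12 != 0, A13 != 0, A14 != 0, A23 != 0, A24 != 0 | A34 != 0] ->
  0 < A23 * tform (diagf c12 c24 c34 c13 c14 k1 k4 / (k1 * k4 * (k1 * k4 - c14 ^+ 2))) A23 A14
      A12 A24 A13 A34 c12 c24 c13 c34 k1 k4
    + A24 * tform (diagf c12 c23 c34 c14 c13 k1 k3 / (k1 * k3 * (k1 * k3 - c13 ^+ 2))) A24 A13
        A12 A23 A14 A34 c12 c23 c14 c34 k1 k3
    + A34 * tform (diagf c13 c23 c24 c14 c12 k1 k2 / (k1 * k2 * (k1 * k2 - c12 ^+ 2))) A34 A12
        A13 A23 A14 A24 c13 c23 c14 c24 k1 k2.
Proof.
move=> h12 h13 h14 h23 h24 h34 D0 c12 c13 c14 c23 c24 c34 k1 k2 k3 k4 t12 t13 t14 An.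
have [[e12 e13 e14] [e23 e24 e34]] := cofactor_minor_gt0 h12 h13 h14 h23 h24 h34 D0.
have k10 : 0 < k1 by exact: kap_gt0. have k20 : 0 < k2 by exact: kap_gt0.
have k30 : 0 < k3 by exact: kap_gt0. have k40 : 0 < k4 by exact: kap_gt0.
pose D := gdel a12 a13 a14 a23 a24 a34.
have Dn : D != 0 by rewrite gt_eqF.
have s (u : R) : 1 < u -> 0 < u ^+ 2 - 1 by move=> x1; rewrite subr_gt0 exprn_egt1.
pose H := sym4 (k1 / D) (k2 / D) (k3 / D) (k4 / D) (- (c12 / D)) (- (c13 / D)) (- (c14 / D))
    (- (c23 / D)) (- (c24 / D)) (- (c34 / D)).
pose A := sym4 0 0 0 0 A12 A13 A14 A23 A24 A34.
have GH : sym4 1 1 1 1 (- a12) (- a13) (- a14) (- a23) (- a24) (- a34) *m H =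
    1%:M by exact: gram_inverse.
have HT : H^T = H by apply: eq_mx4; rewrite !mxE.
have Hn i : H i i != 0.
  by move: i; apply: forall4; rewrite mxE /= mulf_neq0 ?invr_neq0 // gt_eqF.
have nt (u : R) : 0 < u -> u != 0 by move=> u0; rewrite gt_eqF.
have t23 : tau H A o2 o3 = 0 by rewrite tau34_tform ?nt // t12 mulr0.
have t24 : tau H A o1 o3 = 0 by rewrite tau24_tform ?nt // t13 mulr0.
have t34 : tau H A o1 o2 = 0 by rewrite tau23_tform ?nt // t14 mulr0.
have [] := tau_inv4 GH HT Hn t23 t24 t34.
set x := tau H A o0 o1; set y := tau H A o0 o2; set z := tau H A o0 o3 => E34 E24 E23.
have x34 : tform (diagf c13 c23 c24 c14 c12 k1 k2 / (k1 * k2 * (k1 * k2 - c12 ^+ 2))) A34 A12 A13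
    A23 A14 A24 c13 c23 c14 c24 k1 k2 = D * (x / (a34 ^+ 2 - 1)).
  rewrite /x tau12_tform ?nt //; set t := tform _ _ _ _ _ _ _ _ _ _ _ _ _.
  rewrite (_ : k1 * k2 - c12 ^+ 2 = D * (a34 ^+ 2 - 1)).
    by field; rewrite Dn nt ?s.
  by rewrite /k1 /k2 /c12 /D /kap /cofo /gdel; ring.
have y24 : tform (diagf c12 c23 c34 c14 c13 k1 k3 / (k1 * k3 * (k1 * k3 - c13 ^+ 2))) A24 A13 A12
    A23 A14 A34 c12 c23 c14 c34 k1 k3 = D * (y / (a24 ^+ 2 - 1)).
  rewrite /y tau13_tform ?nt //; set t := tform _ _ _ _ _ _ _ _ _ _ _ _ _.
  rewrite (_ : k1 * k3 - c13 ^+ 2 = D * (a24 ^+ 2 - 1)).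
    by field; rewrite Dn nt ?s.
  by rewrite /k1 /k3 /c13 /D /kap /cofo /gdel; ring.
have z23 : tform (diagf c12 c24 c34 c13 c14 k1 k4 / (k1 * k4 * (k1 * k4 - c14 ^+ 2))) A23 A14 A12
    A24 A13 A34 c12 c24 c13 c34 k1 k4 = D * (z / (a23 ^+ 2 - 1)).
  rewrite /z tau14_tform ?nt //; set t := tform _ _ _ _ _ _ _ _ _ _ _ _ _.
  rewrite (_ : k1 * k4 - c14 ^+ 2 = D * (a23 ^+ 2 - 1)).
    by field; rewrite Dn nt ?s.
  by rewrite /k1 /k4 /c14 /D /kap /cofo /gdel; ring.
rewrite x34 y24 z23.
have [q0 qe] := face_block_gt0 x y z h12 h13 h14 h23 h24 h34.
set q := (X in 0 <= X) in q0 qe.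
have -> : A23 * (D * (z / (a23 ^+ 2 - 1))) + A24 * (D * (y / (a24 ^+ 2 - 1)))
    + A34 * (D * (x / (a34 ^+ 2 - 1))) = D * q.
  by rewrite E34 E24 E23 /q; ring.
rewrite mulr_gt0 // lt0r q0 andbT eq_sym qe; apply/negP.
move=> /andP[/andP[/eqP x0 /eqP y0] /eqP z0].
have A00 : A = 0.
  apply: (tau_eq0 GH Hn); try by apply: forall4; rewrite mxE.
  have ts i j : tau H A i j = tau H A j i.
    have AT : A^T = A by apply: eq_mx4; rewrite !mxE.
    exact: tau_sym.
  by apply: forall4; apply: forall4 => // _; rewrite 1?ts // ts.
move: An; rewrite -[A12]/(nth 0 [:: 0; A12] 1).
have E i j : A i j = 0 by rewrite A00 mxE.
have := E o0 o1; have := E o0 o2; have := E o0 o3; have := E o1 o2; have := E o1 o3.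
have := E o2 o3; rewrite !mxE /= => -> -> -> -> -> ->.
by rewrite eqxx.
Qed.

Definition gram2 (R : comRingType) (a12 a13 a14 a23 a24 a34 : R) : R :=
  minor2 (cofo a12 a34 a13 a23 a14 a24) (cofo a13 a24 a12 a23 a14 a34)
      (cofo a14 a23 a12 a24 a13 a34) (cofo a23 a14 a12 a13 a24 a34)
      (cofo a24 a13 a12 a14 a23 a34) (cofo a34 a12 a13 a14 a23 a24) (kap a13 a14 a34)
      (kap a12 a14 a24) (kap a12 a13 a23).

Definition gram3 (R : comRingType) (a12 a13 a14 a23 a24 a34 : R) : R :=
  minor3 (cofo a12 a34 a13 a23 a14 a24) (cofo a13 a24 a12 a23 a14 a34)
      (cofo a14 a23 a12 a24 a13 a34) (cofo a23 a14 a12 a13 a24 a34)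
      (cofo a24 a13 a12 a14 a23 a34) (cofo a34 a12 a13 a14 a23 a24) (kap a13 a14 a34)
      (kap a12 a14 a24) (kap a12 a13 a23).

(** A kernel vector [(X, Y, Z)] of the block, extended by 0 to the edges 23, 24, 34, satisfies the
    hypotheses of [face_form_gt0], but all three summands there have a factor 0. *)
Lemma gram3_neq0 (R : realFieldType) (a12 a13 a14 a23 a24 a34 : R) :
  1 < a12 -> 1 < a13 -> 1 < a14 -> 1 < a23 -> 1 < a24 -> 1 < a34 ->
      0 < gdel a12 a13 a14 a23 a24 a34 ->
  gram3 a12 a13 a14 a23 a24 a34 != 0.
Proof.
move=> h12 h13 h14 h23 h24 h34 D0.
have [[e12 e13 e14] [e23 e24 e34]] := cofactor_minor_gt0 h12 h13 h14 h23 h24 h34 D0.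
have F12 := diagf12_gt0 h12 h13 h14 h23 h24 h34 D0.
have := @face_form_gt0 R a12 a13 a14 a23 a24 a34 _ _ _ 0 0 0 h12 h13 h14 h23 h24 h34 D0 => /=.
rewrite /gram3.
move: F12 e12 e13 e14 e23 e24 e34.
have k10 : 0 < kap a23 a24 a34 by exact: kap_gt0.
have k20 : 0 < kap a13 a14 a34 by exact: kap_gt0.
have k30 : 0 < kap a12 a14 a24 by exact: kap_gt0.
have k40 : 0 < kap a12 a13 a23 by exact: kap_gt0.
move: k10 k20 k30 k40.
set k1 := kap a23 a24 a34.
set k2 := kap a13 a14 a34.
set k3 := kap a12 a14 a24.
set k4 := kap a12 a13 a23.
set c12 := cofo a12 a34 a13 a23 a14 a24.
set c13 := cofo a13 a24 a12 a23 a14 a34.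
set c14 := cofo a14 a23 a12 a24 a13 a34.
set c23 := cofo a23 a14 a12 a13 a24 a34.
set c24 := cofo a24 a13 a12 a14 a23 a34.
set c34 := cofo a34 a12 a13 a14 a23 a24.
move=> k10 k20 k30 k40 F12 e12 e13 e14 e23 e24 e34 H; apply/eqP => m30.
have n0 : 0 < (diagf c13 c14 c24 c23 c34 k3 k4 / (k3 * k4 * (k3 * k4 - c34 ^+ 2)))
    by rewrite divr_gt0 // !mulr_gt0.
have nt (u : R) : 0 < u -> u != 0 by move=> u0; rewrite gt_eqF.
have [|X [Y [Z [XYZ r1 r2 r3]]]] :=
    kernel3 (B := (diagf c12 c14 c34 c23 c24 k2 k4 / (k2 * k4 * (k2 * k4 - c24 ^+ 2))))
   (C := (diagf c12 c13 c34 c24 c23 k2 k3 / (k2 * k3 * (k2 * k3 - c23 ^+ 2)))) (D :=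
       - (c14 / k4)) (E := - (c13 / k3)) (F := - (c12 / k2)) n0.
  by rewrite minor3E ?nt // m30 mul0r.
suff : 0 < (0 : R) by rewrite ltxx.
have := H X Y Z; rewrite !mul0r !addr0; apply.
- by rewrite -[RHS]r1 /tform; ring.
- by rewrite -[RHS]r2 /tform; ring.
- by rewrite -[RHS]r3 /tform; ring.
- rewrite eqxx !orbF -!negb_and; apply: contra XYZ => /and3P[/eqP-> /eqP-> /eqP->].
  by rewrite eqxx.
Qed.

Lemma gram2_rmorph (R S : comRingType) (f : {rmorphism R -> S}) a12 a13 a14 a23 a24 a34 :
  f (gram2 a12 a13 a14 a23 a24 a34) = gram2 (f a12) (f a13) (f a14) (f a23) (f a24) (f a34).
Proof. by rewrite /gram2 minor2_rmorph !cofo_rmorph !kap_rmorph. Qed.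

Lemma gram3_rmorph (R S : comRingType) (f : {rmorphism R -> S}) a12 a13 a14 a23 a24 a34 :
  f (gram3 a12 a13 a14 a23 a24 a34) = gram3 (f a12) (f a13) (f a14) (f a23) (f a24) (f a34).
Proof. by rewrite /gram3 minor3_rmorph !cofo_rmorph !kap_rmorph. Qed.

(* Both minors are positive at [a = 1] and cannot vanish on the segment from
   there to [a], hence are positive at [a]. *)
Lemma gram_segment_gt0 (R : rcfType)
    (f : forall S : comRingType, S -> S -> S -> S -> S -> S -> S) (a12 a13 a14 a23 a24 a34 : R) :
  (forall (S1 S2 : comRingType) (g : {rmorphism S1 -> S2}) x12 x13 x14 x23 x24 x34,
     g (f S1 x12 x13 x14 x23 x24 x34) =
     f S2 (g x12) (g x13) (g x14) (g x23) (g x24) (g x34)) ->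
  0 < f R 1 1 1 1 1 1 ->
  (forall a12 a13 a14 a23 a24 a34 : R,
  1 < a12 -> 1 < a13 -> 1 < a14 -> 1 < a23 -> 1 < a24 -> 1 < a34 ->
      0 < gdel a12 a13 a14 a23 a24 a34 ->
   f R a12 a13 a14 a23 a24 a34 != 0) ->
  1 < a12 -> 1 < a13 -> 1 < a14 -> 1 < a23 -> 1 < a24 -> 1 < a34 ->
      0 < gdel a12 a13 a14 a23 a24 a34 ->
  0 < f R a12 a13 a14 a23 a24 a34.
Proof.
move=> fm f1 fn  h12 h13 h14 h23 h24 h34 D0.
pose b (a : R) : {poly R} := 1 + (a - 1) *: 'X.
pose p : {poly R} := f _ (b a12) (b a13) (b a14) (b a23) (b a24) (b a34).
have pt t : p.[t] = f R (1 + t * (a12 - 1)) (1 + t * (a13 - 1)) (1 + t * (a14 - 1))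
    (1 + t * (a23 - 1)) (1 + t * (a24 - 1)) (1 + t * (a34 - 1)).
  rewrite -[p.[t]]/(horner_eval t p) /p fm /b /= /horner_eval !hornerE.
  by rewrite !(mulrC t).
have p1 : p.[1] = f R a12 a13 a14 a23 a24 a34 by rewrite pt !mul1r ![1 + _]addrC !subrK.
have p0 : 0 < p.[0] by rewrite pt !mul0r !addr0.
rewrite -p1 ltNge; apply/negP => pneg.
have [|t] := @poly_ivt R (- p) 0 1 ler01.
  by rewrite !hornerN oppr_le0 oppr_ge0 (ltW p0).
rewrite rootN => /andP[t0 t1] /eqP.
have [->|tn] := eqVneq t 0; first by move=> p00; rewrite p00 ltxx in p0.
have tp : 0 < t by rewrite lt0r tn.
have one (a : R) : 1 < a -> 1 < 1 + t * (a - 1).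
  by move=> a1; rewrite ltrDl mulr_gt0 // subr_gt0.
have bge (a : R) : 1 < a -> 0 <= a - 1 by move=> a1; rewrite subr_ge0 ltW.
rewrite pt; apply/eqP/fn; try exact: one.
apply: gdel_segment; rewrite ?bge ?t0 //.
by rewrite ![1 + _]addrC !subrK.
Qed.

Lemma gram3_gt0 (R : rcfType) (a12 a13 a14 a23 a24 a34 : R) :
  1 < a12 -> 1 < a13 -> 1 < a14 -> 1 < a23 -> 1 < a24 -> 1 < a34 ->
      0 < gdel a12 a13 a14 a23 a24 a34 ->
  0 < gram3 a12 a13 a14 a23 a24 a34.
Proof.
apply: (gram_segment_gt0 (f := @gram3)) => [*||]; first exact: gram3_rmorph.
  (* At this point all values of [kap] and [cofo] are 4, so the minors [k * k' - c ^+ 2] vanish and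
     only the product of the three [diagf], each equal to 1024, is left. *)
  by rewrite /gram3 /minor3 /diagf /cofo /kap /=; lra.
exact: gram3_neq0.
Qed.

(** The first diagonal entry times the determinant is the product of the two minors of order 2
    containing that entry as first principal one, minus a square. Were [minor2] zero, this would be
    nonpositive, against [gram3_gt0], which is why the determinant is treated before. *)
Lemma gram2_gt0 (R : rcfType) (a12 a13 a14 a23 a24 a34 : R) :
  1 < a12 -> 1 < a13 -> 1 < a14 -> 1 < a23 -> 1 < a24 -> 1 < a34 ->
      0 < gdel a12 a13 a14 a23 a24 a34 ->
  0 < gram2 a12 a13 a14 a23 a24 a34.
Proof.
apply: (gram_segment_gt0 (f := @gram2)) => [*||]; first exact: gram2_rmorph.
  by rewrite /gram2 /minor2 /diagf /cofo /kap /=; lra.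
move=> {a12 a13 a14 a23 a24 a34} a12 a13 a14 a23 a24 a34  h12 h13 h14 h23 h24 h34 D0.
have [[e12 e13 e14] [e23 e24 e34]] := cofactor_minor_gt0 h12 h13 h14 h23 h24 h34 D0.
have F12 := diagf12_gt0 h12 h13 h14 h23 h24 h34 D0.
have := gram3_gt0 h12 h13 h14 h23 h24 h34 D0.
rewrite /gram3 /gram2.
move: F12 e12 e13 e14 e23 e24 e34.
have k10 : 0 < kap a23 a24 a34 by exact: kap_gt0.
have k20 : 0 < kap a13 a14 a34 by exact: kap_gt0.
have k30 : 0 < kap a12 a14 a24 by exact: kap_gt0.
have k40 : 0 < kap a12 a13 a23 by exact: kap_gt0.
move: k10 k20 k30 k40.
set k1 := kap a23 a24 a34.
set k2 := kap a13 a14 a34.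
set k3 := kap a12 a14 a24.
set k4 := kap a12 a13 a23.
set c12 := cofo a12 a34 a13 a23 a14 a24.
set c13 := cofo a13 a24 a12 a23 a14 a34.
set c14 := cofo a14 a23 a12 a24 a13 a34.
set c23 := cofo a23 a14 a12 a13 a24 a34.
set c24 := cofo a24 a13 a12 a14 a23 a34.
set c34 := cofo a34 a12 a13 a14 a23 a24.
move=> k10 k20 k30 k40 F12 e12 e13 e14 e23 e24 e34 m3; apply/eqP => m20.
have nt (u : R) : 0 < u -> u != 0 by move=> u0; rewrite gt_eqF.
have n0 : 0 < (diagf c13 c14 c24 c23 c34 k3 k4 / (k3 * k4 * (k3 * k4 - c34 ^+ 2)))
    by rewrite divr_gt0 // !mulr_gt0.
have m2 := @minor2E R c12 c13 c14 c23 c24 c34 k2 k3 k4 (nt _ k20) (nt _ k30) (nt _ k40)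
    (nt _ e34) (nt _ e24).
rewrite m20 mul0r in m2.
have m30 := @minor3E R c12 c13 c14 c23 c24 c34 k2 k3 k4 (nt _ k20) (nt _ k30) (nt _ k40)
    (nt _ e34) (nt _ e24) (nt _ e23).
move: m30 m2 n0; set n12 := (diagf c13 c14 c24 c23 c34 k3 k4 / (k3 * k4 * (k3 * k4 - c34 ^+ 2)));
    set n13 := (diagf c12 c14 c34 c23 c24 k2 k4 / (k2 * k4 * (k2 * k4 - c24 ^+ 2)));
    set n14 := (diagf c12 c13 c34 c24 c23 k2 k3 / (k2 * k3 * (k2 * k3 - c23 ^+ 2))).
set d := - (c14 / k4); set e := - (c13 / k3); set g := - (c12 / k2) => /= det m2 n0.
have : 0 < n12 * (n12 * n13 * n14 + 2 * d * e * g - n12 * g ^+ 2 - n13 * e ^+ 2 - n14 * d ^+ 2).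
  by rewrite mulr_gt0 // det divr_gt0 // !mulr_gt0 ?exprn_gt0.
rewrite (_ : _ * _ = (n12 * n13 - d ^+ 2) * (n12 * n14 - e ^+ 2) - (n12 * g - d * e) ^+ 2);
    last by ring.
by rewrite m2 mul0r sub0r oppr_gt0 ltNge sqr_ge0.
Qed.

Lemma tform_posdef (R : rcfType) (a12 a13 a14 a23 a24 a34 : R) :
  1 < a12 -> 1 < a13 -> 1 < a14 -> 1 < a23 -> 1 < a24 -> 1 < a34 ->
      0 < gdel a12 a13 a14 a23 a24 a34 ->
  let c12 := cofo a12 a34 a13 a23 a14 a24 in
  let c13 := cofo a13 a24 a12 a23 a14 a34 in
  let c14 := cofo a14 a23 a12 a24 a13 a34 in
  let c23 := cofo a23 a14 a12 a13 a24 a34 in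
  let c24 := cofo a24 a13 a12 a14 a23 a34 in
  let c34 := cofo a34 a12 a13 a14 a23 a24 in
  let k1 := kap a23 a24 a34 in
  let k2 := kap a13 a14 a34 in
  let k3 := kap a12 a14 a24 in
  let k4 := kap a12 a13 a23 in
  forall A12 A13 A14 A23 A24 A34 : R,
      [|| A12 != 0, A13 != 0, A14 != 0, A23 != 0, A24 != 0 | A34 != 0] ->
  0 < A12 * tform (diagf c13 c14 c24 c23 c34 k3 k4 / (k3 * k4 * (k3 * k4 - c34 ^+ 2))) A12 A34
      A13 A14 A23 A24 c13 c14 c23 c24 k3 k4
    + A13 * tform (diagf c12 c14 c34 c23 c24 k2 k4 / (k2 * k4 * (k2 * k4 - c24 ^+ 2))) A13 A24
        A12 A14 A23 A34 c12 c14 c23 c34 k2 k4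
    + A14 * tform (diagf c12 c13 c34 c24 c23 k2 k3 / (k2 * k3 * (k2 * k3 - c23 ^+ 2))) A14 A23
        A12 A13 A24 A34 c12 c13 c24 c34 k2 k3
    + A23 * tform (diagf c12 c24 c34 c13 c14 k1 k4 / (k1 * k4 * (k1 * k4 - c14 ^+ 2))) A23 A14
        A12 A24 A13 A34 c12 c24 c13 c34 k1 k4
    + A24 * tform (diagf c12 c23 c34 c14 c13 k1 k3 / (k1 * k3 * (k1 * k3 - c13 ^+ 2))) A24 A13
        A12 A23 A14 A34 c12 c23 c14 c34 k1 k3
    + A34 * tform (diagf c13 c23 c24 c14 c12 k1 k2 / (k1 * k2 * (k1 * k2 - c12 ^+ 2))) A34 A12
        A13 A23 A14 A24 c13 c23 c14 c24 k1 k2.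
Proof.
move=> h12 h13 h14 h23 h24 h34 D0 c12 c13 c14 c23 c24 c34 k1 k2 k3 k4.
have [[e12 e13 e14] [e23 e24 e34]] := cofactor_minor_gt0 h12 h13 h14 h23 h24 h34 D0.
have F12 := diagf12_gt0 h12 h13 h14 h23 h24 h34 D0.
have m2 : 0 < minor2 c12 c13 c14 c23 c24 c34 k2 k3 k4 := gram2_gt0 h12 h13 h14 h23 h24 h34 D0.
have m3 : 0 < minor3 c12 c13 c14 c23 c24 c34 k2 k3 k4 := gram3_gt0 h12 h13 h14 h23 h24 h34 D0.
have HU := fun A12 A13 A14 A23 A24 A34 =>
  @face_form_gt0 R a12 a13 a14 a23 a24 a34 A12 A13 A14 A23 A24 A34 h12 h13 h14 h23 h24 h34 D0.
have k20 : 0 < k2 by exact: kap_gt0.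
have k30 : 0 < k3 by exact: kap_gt0. have k40 : 0 < k4 by exact: kap_gt0.
have nt (u : R) : 0 < u -> u != 0 by move=> u0; rewrite gt_eqF.
apply: posdef_split.
- by rewrite divr_gt0 // !mulr_gt0.
- by rewrite minor2E ?nt // divr_gt0 // !mulr_gt0 ?exprn_gt0.
- by rewrite minor3E ?nt // divr_gt0 // !mulr_gt0 ?exprn_gt0.
- exact: HU.
Qed.

Definition gram (R : ringType) (a12 a13 a14 a23 a24 a34 : R) : 'M[R]_4 :=
  sym4 1 1 1 1 (- a12) (- a13) (- a14) (- a23) (- a24) (- a34).

Definition gram_inv (R : fieldType) (a12 a13 a14 a23 a24 a34 : R) : 'M[R]_4 :=
  let D := gdel a12 a13 a14 a23 a24 a34 in
  sym4 (kap a23 a24 a34 / D) (kap a13 a14 a34 / D) (kap a12 a14 a24 / D) (kap a12 a13 a23 / D)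
    (- (cofo a12 a34 a13 a23 a14 a24 / D)) (- (cofo a13 a24 a12 a23 a14 a34 / D))
        (- (cofo a14 a23 a12 a24 a13 a34 / D)) (- (cofo a23 a14 a12 a13 a24 a34 / D))
        (- (cofo a24 a13 a12 a14 a23 a34 / D)) (- (cofo a34 a12 a13 a14 a23 a24 / D)).

Lemma gram_mul_inv (R : fieldType) (a12 a13 a14 a23 a24 a34 : R) :
  gdel a12 a13 a14 a23 a24 a34 != 0 ->
      gram a12 a13 a14 a23 a24 a34 *m gram_inv a12 a13 a14 a23 a24 a34 = 1%:M.
Proof. exact: gram_inverse. Qed.

Lemma gram_inv_diag_gt0 (R : realFieldType) (a12 a13 a14 a23 a24 a34 : R) :
  1 < a12 -> 1 < a13 -> 1 < a14 -> 1 < a23 -> 1 < a24 -> 1 < a34 ->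
      0 < gdel a12 a13 a14 a23 a24 a34 ->
  forall i, 0 < gram_inv a12 a13 a14 a23 a24 a34 i i.
Proof.
by move=> h12 h13 h14 h23 h24 h34 D0; apply: forall4; rewrite mxE /= divr_gt0 // kap_gt0.
Qed.

Lemma gram_inv_minor12 (R : fieldType) (a12 a13 a14 a23 a24 a34 : R) :
  let H := gram_inv a12 a13 a14 a23 a24 a34 in gdel a12 a13 a14 a23 a24 a34 != 0 ->
  H o0 o0 * H o1 o1 - H o0 o1 ^+ 2 = (a34 ^+ 2 - 1) / gdel a12 a13 a14 a23 a24 a34.
Proof.
move=> H D0; rewrite !mxE /=.
by move: D0; rewrite /kap /cofo /gdel => D0; field.
Qed.

Lemma gram_inv_minor13 (R : fieldType) (a12 a13 a14 a23 a24 a34 : R) :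
  let H := gram_inv a12 a13 a14 a23 a24 a34 in gdel a12 a13 a14 a23 a24 a34 != 0 ->
  H o0 o0 * H o2 o2 - H o0 o2 ^+ 2 = (a24 ^+ 2 - 1) / gdel a12 a13 a14 a23 a24 a34.
Proof.
move=> H D0; rewrite !mxE /=.
by move: D0; rewrite /kap /cofo /gdel => D0; field.
Qed.

Lemma gram_inv_minor14 (R : fieldType) (a12 a13 a14 a23 a24 a34 : R) :
  let H := gram_inv a12 a13 a14 a23 a24 a34 in gdel a12 a13 a14 a23 a24 a34 != 0 ->
  H o0 o0 * H o3 o3 - H o0 o3 ^+ 2 = (a23 ^+ 2 - 1) / gdel a12 a13 a14 a23 a24 a34.
Proof.
move=> H D0; rewrite !mxE /=.
by move: D0; rewrite /kap /cofo /gdel => D0; field.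
Qed.

Lemma gram_inv_minor23 (R : fieldType) (a12 a13 a14 a23 a24 a34 : R) :
  let H := gram_inv a12 a13 a14 a23 a24 a34 in gdel a12 a13 a14 a23 a24 a34 != 0 ->
  H o1 o1 * H o2 o2 - H o1 o2 ^+ 2 = (a14 ^+ 2 - 1) / gdel a12 a13 a14 a23 a24 a34.
Proof.
move=> H D0; rewrite !mxE /=.
by move: D0; rewrite /kap /cofo /gdel => D0; field.
Qed.

Lemma gram_inv_minor24 (R : fieldType) (a12 a13 a14 a23 a24 a34 : R) :
  let H := gram_inv a12 a13 a14 a23 a24 a34 in gdel a12 a13 a14 a23 a24 a34 != 0 ->
  H o1 o1 * H o3 o3 - H o1 o3 ^+ 2 = (a13 ^+ 2 - 1) / gdel a12 a13 a14 a23 a24 a34.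
Proof.
move=> H D0; rewrite !mxE /=.
by move: D0; rewrite /kap /cofo /gdel => D0; field.
Qed.

Lemma gram_inv_minor34 (R : fieldType) (a12 a13 a14 a23 a24 a34 : R) :
  let H := gram_inv a12 a13 a14 a23 a24 a34 in gdel a12 a13 a14 a23 a24 a34 != 0 ->
  H o2 o2 * H o3 o3 - H o2 o3 ^+ 2 = (a12 ^+ 2 - 1) / gdel a12 a13 a14 a23 a24 a34.
Proof.
move=> H D0; rewrite !mxE /=.
by move: D0; rewrite /kap /cofo /gdel => D0; field.
Qed.

Lemma tau_posdef (R : rcfType) (a12 a13 a14 a23 a24 a34 A12 A13 A14 A23 A24 A34 : R) :
  1 < a12 -> 1 < a13 -> 1 < a14 -> 1 < a23 -> 1 < a24 -> 1 < a34 ->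
      0 < gdel a12 a13 a14 a23 a24 a34 ->
  [|| A12 != 0, A13 != 0, A14 != 0, A23 != 0, A24 != 0 | A34 != 0] ->
  let H := gram_inv a12 a13 a14 a23 a24 a34 in let A := sym4 0 0 0 0 A12 A13 A14 A23 A24 A34 in
  0 < A12 * tau H A o2 o3 / (a12 ^+ 2 - 1)
    + A13 * tau H A o1 o3 / (a13 ^+ 2 - 1)
    + A14 * tau H A o1 o2 / (a14 ^+ 2 - 1)
    + A23 * tau H A o0 o3 / (a23 ^+ 2 - 1)
    + A24 * tau H A o0 o2 / (a24 ^+ 2 - 1)
    + A34 * tau H A o0 o1 / (a34 ^+ 2 - 1).
Proof.
move=> h12 h13 h14 h23 h24 h34 D0 An.
have [[e12 e13 e14] [e23 e24 e34]] := cofactor_minor_gt0 h12 h13 h14 h23 h24 h34 D0.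
have k10 : 0 < kap a23 a24 a34 by exact: kap_gt0.
have k20 : 0 < kap a13 a14 a34 by exact: kap_gt0.
have k30 : 0 < kap a12 a14 a24 by exact: kap_gt0.
have k40 : 0 < kap a12 a13 a23 by exact: kap_gt0.
have nt (u : R) : 0 < u -> u != 0 by move=> u0; rewrite gt_eqF.
have := tform_posdef h12 h13 h14 h23 h24 h34 D0 An.
have s (u : R) : 1 < u -> u ^+ 2 - 1 != 0 by move=> x1; rewrite nt // subr_gt0 exprn_egt1.
have Dn := nt _ D0.
rewrite /gram_inv /=.
rewrite tau12_tform ?nt //.
rewrite tau13_tform ?nt //.
rewrite tau14_tform ?nt //.
rewrite tau23_tform ?nt //.
rewrite tau24_tform ?nt //.
rewrite tau34_tform ?nt //.
rewrite (_ : kap a23 a24 a34 * kap a13 a14 a34 - cofo a12 a34 a13 a23 a14 a24 ^+ 2 =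
    gdel a12 a13 a14 a23 a24 a34 * (a34 ^+ 2 - 1)); last by rewrite /kap /cofo /gdel; ring.
rewrite (_ : kap a23 a24 a34 * kap a12 a14 a24 - cofo a13 a24 a12 a23 a14 a34 ^+ 2 =
    gdel a12 a13 a14 a23 a24 a34 * (a24 ^+ 2 - 1)); last by rewrite /kap /cofo /gdel; ring.
rewrite (_ : kap a23 a24 a34 * kap a12 a13 a23 - cofo a14 a23 a12 a24 a13 a34 ^+ 2 =
    gdel a12 a13 a14 a23 a24 a34 * (a23 ^+ 2 - 1)); last by rewrite /kap /cofo /gdel; ring.
rewrite (_ : kap a13 a14 a34 * kap a12 a14 a24 - cofo a23 a14 a12 a13 a24 a34 ^+ 2 =
    gdel a12 a13 a14 a23 a24 a34 * (a14 ^+ 2 - 1)); last by rewrite /kap /cofo /gdel; ring.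
rewrite (_ : kap a13 a14 a34 * kap a12 a13 a23 - cofo a24 a13 a12 a14 a23 a34 ^+ 2 =
    gdel a12 a13 a14 a23 a24 a34 * (a13 ^+ 2 - 1)); last by rewrite /kap /cofo /gdel; ring.
rewrite (_ : kap a12 a14 a24 * kap a12 a13 a23 - cofo a34 a12 a13 a14 a23 a24 ^+ 2 =
    gdel a12 a13 a14 a23 a24 a34 * (a12 ^+ 2 - 1)); last by rewrite /kap /cofo /gdel; ring.
have E (u t w : R) : w != 0 ->
    u * (gdel a12 a13 a14 a23 a24 a34 * w / gdel a12 a13 a14 a23 a24 a34 ^+ 2 * t) / w =
        u * t / gdel a12 a13 a14 a23 a24 a34.
  by move=> w0; field; rewrite Dn.
by rewrite !E ?s // -!mulrDl => Q; rewrite divr_gt0.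
Qed.

Lemma det3 (R : comRingType) (a b c d e f g h i : R) :
  \det (\matrix_(k < 3, l < 3)
    nth 0 (nth [::] [:: [:: a; b; c]; [:: d; e; f]; [:: g; h; i]] k) l) =
  a * (e * i - f * h) - b * (d * i - f * g) + c * (d * h - e * g).
Proof.
have row (n : nat) (A : 'M[R]_n.+1) : \det A = \sum_j A ord0 j * cofactor A ord0 j.
  exact: expand_det_row.
rewrite row !big_ord_recl big_ord0 /cofactor !row !big_ord_recl !big_ord0 /cofactor.
by rewrite !det_mx11 !mxE /= /bump /=; ring.
Qed.

Lemma det_gram (R : comRingType) (a12 a13 a14 a23 a24 a34 : R) :
  \det (gram a12 a13 a14 a23 a24 a34) = - gdel a12 a13 a14 a23 a24 a34.
Proof.
have E (j : 'I_4) : row' ord0 (col' j (gram a12 a13 a14 a23 a24 a34)) =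
    \matrix_(k < 3, l < 3) nth 0 (nth [::] [::
      [:: gram a12 a13 a14 a23 a24 a34 o1 (lift j q0);
          gram a12 a13 a14 a23 a24 a34 o1 (lift j q1);
          gram a12 a13 a14 a23 a24 a34 o1 (lift j q2)];
      [:: gram a12 a13 a14 a23 a24 a34 o2 (lift j q0);
          gram a12 a13 a14 a23 a24 a34 o2 (lift j q1);
          gram a12 a13 a14 a23 a24 a34 o2 (lift j q2)];
      [:: gram a12 a13 a14 a23 a24 a34 o3 (lift j q0);
          gram a12 a13 a14 a23 a24 a34 o3 (lift j q1);
          gram a12 a13 a14 a23 a24 a34 o3 (lift j q2)]] k) l.
  by apply/matrixP; apply: forall3; apply: forall3; rewrite !mxE.
rewrite (expand_det_row _ ord0) sum4 /cofactor !E !det3 !mxE /= /bump /= /gdel.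
by ring.
Qed.

(** * Hyperideal tetrahedra in the hyperboloid model *)

Definition mink (R : comRingType) (u v : 'rV[R]_4) : R :=
  u 0 o0 * v 0 o0 + u 0 o1 * v 0 o1 + u 0 o2 * v 0 o2 - u 0 o3 * v 0 o3.

Definition mink_mx (R : ringType) : 'M[R]_4 := sym4 1 1 1 (-1) 0 0 0 0 0 0.

Lemma mink_mxE (R : comRingType) m n (A : 'M[R]_(m, 4)) (B : 'M[R]_(n, 4)) i j :
  (A *m mink_mx R *m B^T) i j = mink (row i A) (row j B).
Proof.
rewrite !mxE sum4 !mxE !sum4 !mxE /= /mink !mxE; ring.
Qed.

Lemma minkC (R : comRingType) (u v : 'rV[R]_4) : mink u v = mink v u.
Proof. by rewrite /mink; ring. Qed.

Lemma minkDl (R : comRingType) (u v w : 'rV[R]_4) :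
  mink (u + v) w = mink u w + mink v w.
Proof. by rewrite /mink !mxE; ring. Qed.

Lemma minkZl (R : comRingType) (a : R) (u v : 'rV[R]_4) :
  mink (a *: u) v = a * mink u v.
Proof. by rewrite /mink !mxE; ring. Qed.

Lemma minkNl (R : comRingType) (u v : 'rV[R]_4) : mink (- u) v = - mink u v.
Proof. by rewrite /mink !mxE; ring. Qed.

Lemma mink0l (R : comRingType) (v : 'rV[R]_4) : mink 0 v = 0.
Proof. by rewrite /mink !mxE; ring. Qed.

Definition minkE := (minkDl, minkNl, minkZl, mink0l).

(** A nonzero vector orthogonal to a timelike one is spacelike. The last coordinate of [z] is
    eliminated by orthogonality, after which Lagrange's identity displays the squares. *)
Lemma mink_orth_gt0 (R : realFieldType) (z p : 'rV[R]_4) :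
  mink p p < 0 -> mink z p = 0 -> z != 0 -> 0 < mink z z.
Proof.
move=> pp zp z0.
have zE : z = \row_j nth 0 [:: z 0 o0; z 0 o1; z 0 o2; z 0 o3] j.
  by apply/rowP; apply: forall4; rewrite mxE.
move: z0; rewrite {1}zE; move: pp zp; rewrite /mink.
move: (z 0 o0) (z 0 o1) (z 0 o2) (z 0 o3) (p 0 o0) (p 0 o1) (p 0 o2) (p 0 o3).
move=> a b c d x y w t pp zp z0 {zE}.
have t0 : 0 < t * t.
  have := sqr_ge0 x; have := sqr_ge0 y; have := sqr_ge0 w; rewrite !expr2; lra.
have E : t * t * (a * a + b * b + c * c - d * d) =
    (a * a + b * b + c * c) * (t * t - x * x - y * y - w * w)
    + ((a * y - b * x) ^+ 2 + (a * w - c * x) ^+ 2 + (b * w - c * y) ^+ 2).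
  have -> : t * t * (a * a + b * b + c * c - d * d) =
    t * t * (a * a + b * b + c * c) - (d * t) ^+ 2 by ring.
  have -> : d * t = a * x + b * y + c * w by lra.
  by ring.
have s0 : 0 <= (a * y - b * x) ^+ 2 + (a * w - c * x) ^+ 2 + (b * w - c * y) ^+ 2.
  by rewrite !addr_ge0 ?sqr_ge0.
have u0 : 0 < t * t - x * x - y * y - w * w by lra.
rewrite -(pmulr_rgt0 _ t0) E.
have [abc|abc] := ltP 0 (a * a + b * b + c * c).
  by rewrite ltr_pwDl // mulr_gt0.
have sq (e : R) : 0 <= e * e by rewrite -expr2 sqr_ge0.
have z1 (e : R) : e * e <= 0 -> e = 0.
  move=> h; have : e * e == 0 by rewrite eq_le h sq.
  by rewrite mulf_eq0 orbb => /eqP.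
have a0 : a = 0 by apply: z1; have := sq b; have := sq c; lra.
have b0 : b = 0 by apply: z1; have := sq a; have := sq c; lra.
have c0 : c = 0 by apply: z1; have := sq b; have := sq a; lra.
have dt : d * t = 0 by move: zp; rewrite a0 b0 c0; lra.
have d0 : d = 0.
  by apply/eqP; move/eqP: dt; rewrite mulf_eq0 => /orP[//|/eqP t00]; rewrite t00 mulr0 ltxx in t0.
case/eqP: z0; rewrite a0 b0 c0 d0.
by apply/rowP; apply: forall4; rewrite !mxE.
Qed.

Lemma mink_nondegenerate (R : fieldType) (X : 'M[R]_4) (y : 'rV[R]_4) :
  X \in unitmx -> (forall i, mink y (row i X) = 0) -> y = 0.
Proof.
move=> Xu H.
have E : y *m mink_mx R *m X^T = 0.
  by apply/rowP => i; rewrite mink_mxE row_id H mxE.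
have J2 : mink_mx R *m mink_mx R = 1%:M.
  by apply: eq_mx4; rewrite !mxE !sum4 !mxE /=; ring.
have : y *m mink_mx R *m X^T *m invmx X^T *m mink_mx R = 0 by rewrite E !mul0mx.
by rewrite -(mulmxA _ X^T) mulmxV ?unitmx_tr // mulmx1 -mulmxA J2 mulmx1.
Qed.

Lemma mulmx_inj_unitmx (R : fieldType) n (A : 'M[R]_n) :
  (forall v : 'rV[R]_n, v *m A = 0 -> v = 0) -> A \in unitmx.
Proof.
move=> H; rewrite unitmxE unitfE; apply/det0P => -[v v0 /H vA].
by rewrite vA eqxx in v0.
Qed.

(* The configuration of a truncated tetrahedron in the hyperboloid model:
   [T v] and [W c] are outward normals of the triangular and hexagonal faces,
   and [X a b] is the vertex on the edge [a b] near [a]. *)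
Record truncated_config (R : realFieldType) (T W : 'I_4 -> 'rV[R]_4)
    (X : 'I_4 -> 'I_4 -> 'rV[R]_4) : Prop := TruncatedConfig {
  cfg_time : forall a b, X a b 0 o3 = 1;
  cfg_neg : forall a b a' b', a != b -> a' != b' -> mink (X a b) (X a' b') < 0;
  cfg_W0 : forall a b c, a != b -> c != a -> c != b -> mink (W c) (X a b) = 0;
  cfg_Wl : forall a b, a != b -> mink (W a) (X a b) < 0;
  cfg_Wr : forall a b, a != b -> mink (W b) (X a b) < 0;
  cfg_T0 : forall a b, a != b -> mink (T a) (X a b) = 0;
  cfg_T : forall a b v, a != b -> v != a -> mink (T v) (X a b) < 0;
  cfg_right : forall a b c d, uniq [:: a; b; c; d] ->
    mink (X b a) (X a d) * mink (X a b) (X a b) =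
    mink (X b a) (X a b) * mink (X a d) (X a b)
}.

(** [Z] is the component of [X b a] orthogonal to [X a b]. The right angles at this vertex in the
    hexagons [c] and [d] make [Z] orthogonal to [X a c] and [X a d] as well, and [T a] is orthogonal
    to the same three vectors. As they form a basis together with [X b a], the two are proportional:
    the edge is perpendicular to the triangular face. *)
Lemma cfg_triangle (R : realFieldType) (T W : 'I_4 -> 'rV[R]_4) X a b c d :
  truncated_config T W X -> uniq [:: a; b; c; d] ->
  let k := mink (X b a) (X a b) / mink (X a b) (X a b) in
  let Z := X b a - k *: X a b in
  0 < mink Z Z /\ exists2 l : R, l < 0 & T a = l *: Z.
Proof.
move=> cfg U k Z; have [tm ng W0 Wl Wr T0 Tn rg] := cfg.
have U' : uniq [:: a; b; d; c].
  by move: U; rewrite /= !inE !negb_or (eq_sym c d) => /and4P[/and3P[-> -> ->] /andP[-> ->] ->].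
move: (U); rewrite /= !inE !negb_or => /and4P[/and3P[ab ac ad] /andP[bc bd] cd _].
have [ba ca da] : [/\ b != a, c != a & d != a] by split; rewrite eq_sym.
have [cb db dc] : [/\ c != b, d != b & d != c] by split; rewrite eq_sym.
have pp : mink (X a b) (X a b) < 0 by exact: ng.
have ppn : mink (X a b) (X a b) != 0 by rewrite lt_eqF.
have ZP : mink Z (X a b) = 0 by rewrite /Z !minkE /k; field.
have ZR e : mink (X b a) (X a e) * mink (X a b) (X a b) =
    mink (X b a) (X a b) * mink (X a e) (X a b) -> mink Z (X a e) = 0.
  move=> E; rewrite /Z !minkE /k (minkC (X a b) (X a e)).
  apply: (mulIf ppn); rewrite mul0r.
  rewrite -[RHS](subrr (mink (X b a) (X a e) * mink (X a b) (X a b))) [in X in _ = _ - X]E.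
  by field.
have ZR1 : mink Z (X a d) = 0 by apply: ZR; exact: (rg _ _ _ _ U).
have ZR2 : mink Z (X a c) = 0 by apply: ZR; exact: (rg _ _ _ _ U').
(* The four vectors are independent: on a vanishing combination, [T a], [W d], [W c] and finally the
   last coordinate annihilate the coefficients one after the other. *)
pose M : 'M[R]_4 := \matrix_(i, j) (nth 0 [:: X a b; X b a; X a d; X a c] i) 0 j.
have rM i : row i M = nth 0 [:: X a b; X b a; X a d; X a c] i.
  by apply/rowP => j; rewrite !mxE.
have Mu : M \in unitmx.
  apply: mulmx_inj_unitmx => v vM.
  have E f : v 0 o0 * mink f (X a b) + v 0 o1 * mink f (X b a)
      + v 0 o2 * mink f (X a d) + v 0 o3 * mink f (X a c) = 0.
    rewrite -[RHS](mink0l f) -vM.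
    rewrite [in RHS]/mink !(mxE, sum4) /= /mink; ring.
  have v1 : v 0 o1 = 0.
    have := E (T a); rewrite !T0 // !mulr0 add0r !addr0 => /eqP.
    by rewrite mulf_eq0 (lt_eqF (Tn _ _ _ ba ab)) orbF => /eqP.
  have v2 : v 0 o2 = 0.
    have := E (W d); rewrite (W0 a b d) // (W0 b a d) // (W0 a c d) // !mulr0 !add0r !addr0 =>
        /eqP.
    by rewrite mulf_eq0 (lt_eqF (Wr _ _ ad)) orbF => /eqP.
  have v3 : v 0 o3 = 0.
    have := E (W c); rewrite (W0 a b c) // (W0 b a c) // (W0 a d c) // !mulr0 !add0r => /eqP.
    by rewrite mulf_eq0 (lt_eqF (Wr _ _ ac)) orbF => /eqP.
  have v0 : v 0 o0 = 0.
    have /rowP/(_ o3) := vM; rewrite !(mxE, sum4) /= !tm v1 v2 v3; lra.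
  by apply/rowP; apply: forall4; rewrite mxE.
have Tq : mink (T a) (X b a) < 0 by apply: Tn => //; rewrite eq_sym.
have Zq : mink Z (X b a) = mink Z Z.
  have mZ u : mink u Z = mink u (X b a) - k * mink u (X a b).
    by rewrite minkC /Z !minkE (minkC u) (minkC u).
  by rewrite mZ ZP mulr0 subr0.
have E : mink Z (X b a) *: T a - mink (T a) (X b a) *: Z = 0.
  apply: (mink_nondegenerate Mu) => i; rewrite rM.
  move: i; apply: forall4; rewrite /= minkDl minkNl !minkZl.
  - by rewrite T0 // ZP; ring.
  - by ring.
  - by rewrite T0 // ZR1; ring.
  - by rewrite T0 // ZR2; ring.
have Zn : Z != 0.
  apply/eqP => Z0; have X1 : X b a = k *: X a b by apply/eqP; rewrite -subr_eq0 -/Z Z0.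
  have k1 : k = 1.
    by have /rowP/(_ o3) := X1; rewrite mxE !tm mulr1.
  by move: Tq; rewrite X1 k1 scale1r T0 // ltxx.
have ZZ := mink_orth_gt0 pp ZP Zn.
split => //; exists (mink (T a) (X b a) / mink Z Z).
  by rewrite nmulr_rlt0 // invr_gt0.
move/eqP: E; rewrite subr_eq0 Zq => /eqP E.
by rewrite mulrC -scalerA -E scalerA mulVf ?scale1r // gt_eqF.
Qed.

Lemma ord4_complement (a c : 'I_4) : a != c -> exists b d, uniq [:: a; b; c; d].
Proof.
move: a c; apply: forall4; apply: forall4 => // _.
- by exists o2, o3. - by exists o1, o3. - by exists o1, o2.
- by exists o2, o3. - by exists o0, o3. - by exists o0, o2.
- by exists o1, o3. - by exists o0, o3. - by exists o0, o1.
- by exists o1, o2. - by exists o0, o2. - by exists o0, o1.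
Qed.

Lemma uniq4_swap (a b c d : 'I_4) : uniq [:: a; b; c; d] -> uniq [:: b; a; c; d].
Proof.
rewrite /= !inE !negb_or (eq_sym b a).
by move=> /and4P[/and3P[-> -> ->] /andP[-> ->] ->].
Qed.

Lemma cfg_orth (R : realFieldType) (T W : 'I_4 -> 'rV[R]_4) X a c :
  truncated_config T W X -> c != a -> mink (W c) (T a) = 0.
Proof.
move=> cfg ca; have [b [d U]] : exists b d, uniq [:: a; b; c; d].
  by apply: ord4_complement; rewrite eq_sym.
have [_ [l _ ->]] := cfg_triangle cfg U.
move: (U); rewrite /= !inE !negb_or => /and4P[/and3P[ab _ _] /andP[bc _] _ _].
rewrite minkC !minkE !(minkC _ (W c)) !(cfg_W0 cfg) //; first by ring.
- by rewrite eq_sym.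
- by rewrite eq_sym.
- by rewrite eq_sym.
Qed.

Lemma ord4_complement_ab (a b : 'I_4) : a != b -> exists c d, uniq [:: a; b; c; d].
Proof.
move=> /ord4_complement[c [d]]; rewrite /= !inE !negb_or.
move=> /and4P[/and3P[ac ab ad] /andP[cb cd] bd _]; exists c, d.
by rewrite /= !inE !negb_or ab ac ad bd cd (eq_sym b c) cb.
Qed.

Lemma cfg_edge (R : realFieldType) (T W : 'I_4 -> 'rV[R]_4) X a b :
  truncated_config T W X -> a != b ->
  let p := mink (X a b) (X a b) in let q := mink (X b a) (X b a) in
  let r := mink (X a b) (X b a) in
  exists l l' : R, [/\ l < 0, l' < 0, p * q < r ^+ 2,
    T a = l *: (X b a - (r / p) *: X a b) &
    T b = l' *: (X a b - (r / q) *: X b a)].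
Proof.
move=> cfg ab p q r; have [c [d U]] := ord4_complement_ab ab.
have [ZZ [l l0 El]] := cfg_triangle cfg U.
have [ZZ' [l' l'0 El']] := cfg_triangle cfg (uniq4_swap U).
have p0 : p < 0 by exact: (cfg_neg cfg).
exists l, l'; split => //; last by rewrite El /r minkC.
move: ZZ; rewrite !(minkE, minkC _ (_ - _)) (minkC (X b a) (X a b)) -/p -/q -/r.
rewrite (_ : _ - _ = (q * p - r ^+ 2) / p); last by field; rewrite lt_eqF.
by rewrite nmulr_lgt0 ?invr_lt0 // subr_lt0 mulrC.
Qed.

Lemma cfg_TT_gt0 (R : realFieldType) (T W : 'I_4 -> 'rV[R]_4) X a :
  truncated_config T W X -> 0 < mink (T a) (T a).
Proof.
move=> cfg; have [b ab] : exists b, a != b.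
  by move: a; apply: forall4; [exists o1|exists o0|exists o0|exists o0].
have [c [d U]] := ord4_complement_ab ab.
have [ZZ [l l0 ->]] := cfg_triangle cfg U; move: ZZ; set Z := _ - _ => ZZ.
by rewrite minkZl minkC minkZl mulrA pmulr_lgt0 // nmulr_lgt0.
Qed.

(** Both normals lie in the plane spanned by the two ends of the edge, which is a common
    perpendicular of the two triangular faces. Up to scaling they are dual there to the ends, so
    their normalized product is that of the ends, minus the hyperbolic cosine of the length. *)
Lemma cfg_TT (R : rcfType) (T W : 'I_4 -> 'rV[R]_4) X a b :
  truncated_config T W X -> a != b ->
  mink (T a) (T b) = mink (X a b) (X b a) /
    Num.sqrt (mink (X a b) (X a b) * mink (X b a) (X b a)) *
    Num.sqrt (mink (T a) (T a)) * Num.sqrt (mink (T b) (T b)).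
Proof.
move=> cfg ab; have [l [l' [l0 l'0 pqr Ta Tb]]] := cfg_edge cfg ab.
have Ta0 := cfg_TT_gt0 a cfg; have Tb0 := cfg_TT_gt0 b cfg.
have p0 : mink (X a b) (X a b) < 0 by exact: (cfg_neg cfg).
have q0 : mink (X b a) (X b a) < 0 by apply: (cfg_neg cfg); rewrite eq_sym.
have TTa : mink (T a) (T a) = l ^+ 2 * ((mink (X a b) (X a b) * mink (X b a) (X b a)
    - mink (X a b) (X b a) ^+ 2) / mink (X a b) (X a b)).
  rewrite Ta !(minkE, minkC _ (_ - _), minkC _ (_ *: _)) (minkC (X b a) (X a b)).
  by field; rewrite lt_eqF.
have TTb : mink (T b) (T b) = l' ^+ 2 * ((mink (X a b) (X a b) * mink (X b a) (X b a)
    - mink (X a b) (X b a) ^+ 2) / mink (X b a) (X b a)).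
  rewrite Tb !(minkE, minkC _ (_ - _), minkC _ (_ *: _)) (minkC (X b a) (X a b)).
  by field; rewrite lt_eqF.
have TTab : mink (T a) (T b) = l * l' * (mink (X a b) (X b a) *
   (mink (X a b) (X b a) ^+ 2 - mink (X a b) (X a b) * mink (X b a) (X b a))
    / (mink (X a b) (X a b) * mink (X b a) (X b a))).
  rewrite Ta Tb !(minkE, minkC _ (_ - _), minkC _ (_ *: _)) (minkC (X b a) (X a b)).
  by field; rewrite !lt_eqF.
rewrite -mulrA -sqrtrM ?(ltW Ta0) // TTab TTa TTb.
move: p0 q0 pqr; set p := mink (X a b) (X a b); set q := mink (X b a) (X b a).
set r := mink (X a b) (X b a) => p0 q0 pqr.
have pq0 : 0 < p * q by rewrite nmulr_rgt0.
have s0 : 0 < Num.sqrt (p * q) by rewrite sqrtr_gt0.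
have s2 : Num.sqrt (p * q) ^+ 2 = p * q by rewrite sqr_sqrtr // ltW.
have -> : l ^+ 2 * ((p * q - r ^+ 2) / p) * (l' ^+ 2 * ((p * q - r ^+ 2) / q)) =
    (l * l' * (r ^+ 2 - p * q) / Num.sqrt (p * q)) ^+ 2.
  rewrite exprMn exprVn s2; field; by rewrite !lt_eqF.
rewrite sqrtr_sqr ger0_norm; last first.
  by rewrite ltW // divr_gt0 // mulr_gt0 ?subr_gt0 // nmulr_rgt0.
rewrite -[in LHS]s2; move: s0; set s := Num.sqrt _ => s0.
rewrite -s2 -/s; field; by rewrite gt_eqF.
Qed.

Lemma cfg_WT_lt0 (R : realFieldType) (T W : 'I_4 -> 'rV[R]_4) X a :
  truncated_config T W X -> mink (W a) (T a) < 0.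
Proof.
move=> cfg; have [b ab] : exists b, a != b.
  by move: a; apply: forall4; [exists o1|exists o0|exists o0|exists o0].
have [l [l' [l0 l'0 pqr Ta Tb]]] := cfg_edge cfg ab.
have p0 : mink (X a b) (X a b) < 0 by exact: (cfg_neg cfg).
have q0 : mink (X b a) (X b a) < 0 by apply: (cfg_neg cfg); rewrite eq_sym.
have ba : b != a by rewrite eq_sym.
have WTb : mink (W a) (X a b) = mink (X a b) (X b a) / mink (X b a) (X b a) * mink (W a) (X b a).
  have := cfg_orth cfg ab; rewrite minkC Tb !minkE => /eqP.
  rewrite mulf_eq0 lt_eqF //= subr_eq0 => /eqP.
  by rewrite !(minkC _ (W a)).
have Wq : mink (W a) (X b a) < 0 by exact: (cfg_Wr cfg).
rewrite minkC Ta !minkE !(minkC _ (W a)) WTb.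
move: p0 q0 pqr Wq; set p := mink (X a b) (X a b); set q := mink (X b a) (X b a).
set r := mink (X a b) (X b a); set w := mink (W a) (X b a) => p0 q0 pqr Wq.
have -> : l * (w - r / p * (r / q * w)) = l * (w * ((p * q - r ^+ 2) / (p * q))).
  by field; rewrite !lt_eqF.
rewrite nmulr_rlt0 // nmulr_rgt0 // pmulr_llt0 ?invr_gt0 ?nmulr_rgt0 //.
by rewrite subr_lt0.
Qed.

(** Let [N] have as rows the normalized [T i], and [V] the [W i]. Then [N *m J *m N^T] is the Gram
    matrix, whence [gdel = (\det N) ^+ 2], and [N *m J *m V^T] is diagonal by [cfg_orth]. Hence [V]
    is a diagonal matrix times [H *m N], which gives the products of the [W i]. *)
Lemma cfg_gram (R : rcfType) (T W : 'I_4 -> 'rV[R]_4) X (a : 'I_4 -> 'I_4 -> R) :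
  truncated_config T W X -> (forall i j, a i j = a j i) ->
  (forall i j, i != j -> a i j = - mink (X i j) (X j i) /
    Num.sqrt (mink (X i j) (X i j) * mink (X j i) (X j i))) ->
  0 < gdel (a o0 o1) (a o0 o2) (a o0 o3) (a o1 o2) (a o1 o3) (a o2 o3) /\
  let H := gram_inv (a o0 o1) (a o0 o2) (a o0 o3) (a o1 o2) (a o1 o3) (a o2 o3) in
  exists2 nu : 'I_4 -> R, (forall c, nu c < 0) &
    forall c d, mink (W c) (W d) = nu c * nu d * H c d.
Proof.
move=> cfg asym aE; pose t i := Num.sqrt (mink (T i) (T i)).
have t0 i : 0 < t i by rewrite sqrtr_gt0 (cfg_TT_gt0 _ cfg).
have t2 i : t i ^+ 2 = mink (T i) (T i) by rewrite sqr_sqrtr // ltW // (cfg_TT_gt0 _ cfg).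
pose N : 'M[R]_4 := \matrix_(i, j) ((t i)^-1 * T i 0 j).
pose V : 'M[R]_4 := \matrix_(i, j) W i 0 j.
have rN i : row i N = (t i)^-1 *: T i by apply/rowP => j; rewrite !mxE.
have rV i : row i V = W i by apply/rowP => j; rewrite !mxE.
pose J := mink_mx R.
have NN : N *m J *m N^T = gram (a o0 o1) (a o0 o2) (a o0 o3) (a o1 o2) (a o1 o3) (a o2 o3).
  apply/matrixP => i j; rewrite mink_mxE !rN minkZl minkC minkZl minkC.
  have [<-|ij] := eqVneq i j.
    have -> : gram (a o0 o1) (a o0 o2) (a o0 o3) (a o1 o2) (a o1 o3) (a o2 o3) i i = 1.
      by move: i; apply: forall4; rewrite mxE.
    by rewrite -t2; field; rewrite gt_eqF.
  have -> : gram (a o0 o1) (a o0 o2) (a o0 o3) (a o1 o2) (a o1 o3) (a o2 o3) i j = - a i j.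
    by move: i j ij; apply: forall4; apply: forall4 => // _; rewrite mxE //= asym.
  rewrite (cfg_TT cfg ij) aE // -/(t i) -/(t j) mulNr opprK.
  set u := _ / _; by field; rewrite !gt_eqF.
have JJ : J *m J = 1%:M by apply: eq_mx4; rewrite !mxE !sum4 !mxE /=; ring.
have detJ : \det J = -1.
  have -> : J = diag_mx (\row_(i < 4) nth 0 [:: 1; 1; 1; -1] i).
    by apply: eq_mx4; rewrite !mxE.
  by rewrite det_diag !big_ord_recl big_ord0 !mxE /=; ring.
pose nu c := mink (W c) (T c) / t c.
have nu0 c : nu c < 0 by rewrite pmulr_llt0 ?invr_gt0 // (cfg_WT_lt0 _ cfg).
have NV : N *m J *m V^T = diag_mx (\row_i nu i).
  apply/matrixP => i j; rewrite mink_mxE rN rV minkZl !mxE minkC.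
  have [<-|ij] := eqVneq i j; first by rewrite mulr1n mulrC.
  by rewrite (cfg_orth cfg) ?mulr0 // eq_sym.
have gd : - gdel (a o0 o1) (a o0 o2) (a o0 o3) (a o1 o2) (a o1 o3) (a o2 o3) = - \det N ^+ 2.
  by rewrite -det_gram -NN !det_mulmx det_tr detJ; ring.
have Nu : \det N != 0.
  apply/eqP => N0; have /eqP : \det (N *m J *m V^T) = 0 by rewrite !det_mulmx N0 !mul0r.
  rewrite NV det_diag prodf_seq_eq0 => /hasP[i _].
  by rewrite mxE /= lt_eqF.
have D0 : 0 < gdel (a o0 o1) (a o0 o2) (a o0 o3) (a o1 o2) (a o1 o3) (a o2 o3).
  by rewrite -[gdel _ _ _ _ _ _]opprK gd opprK lt0r sqr_ge0 expf_eq0 /= Nu.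
split => //= ; exists nu => // c d.
have GH := gram_mul_inv (lt0r_neq0 D0).
set H := gram_inv _ _ _ _ _ _ in GH *.
have Nun : N \in unitmx by rewrite unitmxE unitfE.
have JT : J^T = J by apply: eq_mx4; rewrite !mxE.
have VJN : V *m J *m N^T = diag_mx (\row_i nu i).
  by rewrite -[RHS]tr_diag_mx -NV !trmx_mul trmxK JT mulmxA.
have Uu : J *m N^T \in unitmx.
  by rewrite unitmx_mul unitmx_tr Nun andbT; case/mulmx1_unit: JJ.
have VE : V = diag_mx (\row_i nu i) *m H *m N.
  rewrite -[V](mulmxK Uu) -[RHS](mulmxK Uu); congr (_ *m _).
  by rewrite mulmxA VJN -!mulmxA (mulmxA N) NN (mulmx1C GH) mulmx1.
have -> : mink (W c) (W d) = (V *m J *m V^T) c d by rewrite mink_mxE !rV.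
rewrite {1}VE -!mulmxA (mulmxA N) NV mul_mx_diag mul_diag_mx !mxE; ring.
Qed.

(** * Functions of class C^k *)

(** Complete normed structure on matrices, for the fixed point theorem in [local_surjective]. *)
HB.instance Definition _ (R : realType) (m n : nat) := Complete.on 'M[R]_(m, n).

Lemma diff_eps (R : realType) (V W : normedModType R) (f : V -> W) x :
  differentiable f x -> forall e, 0 < e ->
  \forall h \near 0, `|f (h + x) - f x - 'd f x h| <= e * `|h|.
Proof.
move=> df e e0.
have [g] : exists g : {o_(nbhs (0 : V)) (id : V -> V)},
    f \o shift x = cst (f x) + 'd f x + g.
  by eexists; exact: (diff_locally df).
move=> E; have := littleoP g e0; apply: filterS => h /=.
have := congr1 (fun F => F h) E; rewrite /= !fctE /= => ->.
by rewrite [_ + g h]addrC [f x + _]addrC addrA !addrK.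
Qed.

(** Also identifies the differential, by uniqueness; this is how the derivative of a local inverse
    is found. *)
Lemma eps_diff (R : realType) (V W : normedModType R) (f : V -> W) x
    (L : {linear V -> W}) :
  continuous L -> (forall e, 0 < e ->
    \forall h \near 0, `|f (h + x) - f x - L h| <= e * `|h|) ->
  differentiable f x /\ ('d f x = L :> (V -> W)).
Proof.
move=> Lc H.
have E : f \o shift x = cst (f x) + L +o_ 0 id.
  apply/eqaddoP => e e0; have := H _ e0; apply: filterS => h.
  rewrite -[X in `|X| <= _ -> _]addrA -opprD; exact.
have D := diff_unique Lc E; split => //.
apply/diff_locallyP; split; first by rewrite D.
by rewrite D.
Qed.

Lemma near_eq_differentiable (R : realType) (V W : normedModType R)
    (f g : V -> W) (x : V) :
  (\forall y \near x, f y = g y) -> differentiable f x -> differentiable g x.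
Proof.
move=> fg df.
apply: (proj1 (@eps_diff _ _ _ _ _ ('d f x) (diff_continuous df) _)) => e e0.
have H := diff_eps df e0; have E := nbhs_singleton fg.
move: fg; rewrite (near_shift 0 x) subr0 => fg.
by near do rewrite -(near fg) // -E; exact: H.
Unshelve. all: by end_near. Qed.

Lemma differentiable_row (R : realType) (V : normedModType R) n
    (f : V -> 'rV[R]_n) (x : V) :
  (forall i, differentiable (fun y => f y 0 i) x) -> differentiable f x.
Proof.
move=> H; rewrite (_ : f = \sum_i (fun y => f y 0 i *: delta_mx 0 i)).
  apply: differentiable_sum => i; exact: differentiableZl.
apply/funext => y; rewrite fct_sumE [LHS]row_sum_delta.
by [].
Qed.

Lemma differentiable_entry (R : realType) (V : normedModType R) n
    (f : V -> 'rV[R]_n) (x : V) i :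
  differentiable f x -> differentiable (fun y => f y 0 i) x.
Proof.
move=> df; apply: (@differentiable_comp _ _ _ _ f (fun M => M 0 i)) => //.
exact: differentiable_coord.
Qed.

Lemma derive_entry (R : realType) (V : normedModType R) n
    (f : V -> 'rV[R]_n) (x v : V) i :
  differentiable f x -> 'D_v (fun y => f y 0 i) x = ('D_v f x) 0 i.
Proof. by move=> df; rewrite derive_mx ?mxE //; exact: diff_derivable. Qed.

Lemma derive_comp_rV (R : realType) (V W : normedModType R) n
    (f : V -> 'rV[R]_n) (g : 'rV[R]_n -> W) (x v : V) :
  differentiable f x -> differentiable g (f x) ->
  'D_v (g \o f) x = \sum_j ('D_v f x) 0 j *: 'D_(delta_mx 0 j) g (f x).
Proof.
move=> df dg; rewrite deriveE; last exact: differentiable_comp.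
rewrite diff_comp //= -[X in 'd g _ X]deriveE // [X in 'd g _ X]row_sum_delta.
rewrite linear_sum; apply: eq_bigr => j _.
by rewrite [LHS]linearZ !deriveE.
Qed.

Lemma derive_comp1 (R : realType) (V W : normedModType R)
    (f : V -> R) (g : R -> W) (x v : V) :
  differentiable f x -> differentiable g (f x) ->
  'D_v (g \o f) x = ('D_v f x) *: 'D_1 g (f x).
Proof.
move=> df dg; rewrite deriveE; last exact: differentiable_comp.
rewrite diff_comp //= -[X in 'd g _ X]deriveE //.
by rewrite -[X in 'd g _ X]mulr1 -[X in 'd g _ X]/(_ *: _) linearZ -deriveE.
Qed.

Lemma Ck_onW (R : realType) (V W : normedModType R) k (U : set V) (f : V -> W) :
  Ck_on k.+1 U f -> Ck_on k U f.
Proof.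
elim: k f => [|k IH] f /= [df D].
  by move=> x Ux; apply: differentiable_continuous; exact: df.
by split => // v; apply: IH; exact: D.
Qed.

Lemma Ck_onS (R : realType) (V W : normedModType R) k (U U' : set V) (f : V -> W) :
  U' `<=` U -> Ck_on k U f -> Ck_on k U' f.
Proof.
move=> s; elim: k f => [|k IH] f /=; first by move=> H x /s; exact: H.
by move=> [df D]; split => [x /s|v]; [exact: df|apply: IH].
Qed.

Lemma eq_Ck_on (R : realType) (V W : normedModType R) k (U : set V) (f g : V -> W) :
  open U -> (forall x, U x -> f x = g x) -> Ck_on k U f -> Ck_on k U g.
Proof.
move=> oU; elim: k f g => [|k IH] f g fg /=.
  move=> H x Ux; have := H x Ux; rewrite /prop_for /continuous_at -fg //.
  apply: cvg_trans; apply: near_eq_cvg.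
  by have := open_nbhs_nbhs (conj oU Ux); apply: filterS.
have nfg x : U x -> \forall y \near x, f y = g y.
  by move=> Ux; have := open_nbhs_nbhs (conj oU Ux); apply: filterS.
move=> [df D]; split => [x Ux|v].
  by apply: near_eq_differentiable (df x Ux); exact: nfg.
by apply: IH (D v) => x Ux; apply: near_eq_derive; exact: nfg.
Qed.

Lemma Ck_on_cst (R : realType) (V W : normedModType R) k (U : set V) (c : W) :
  Ck_on k U (fun _ : V => c).
Proof.
elim: k c => [|k IH] c /=; first by move=> x _; exact: cvg_cst.
split => [x _|v]; first exact: differentiable_cst.
rewrite [X in Ck_on k U X](_ : _ = fun=> 0); first exact: IH.
by apply/funext => x; exact: derive_cst.
Qed.

Lemma Ck_onD (R : realType) (V W : normedModType R) k (U : set V) (f g : V -> W) :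
  open U -> Ck_on k U f -> Ck_on k U g -> Ck_on k U (fun x => f x + g x).
Proof.
move=> oU; elim: k f g => [|k IH] f g /=.
  by move=> cf cg x Ux; apply: continuousD; [exact: cf|exact: cg].
move=> [df Df] [dg Dg]; split => [x Ux|v].
  by apply: differentiableD; [exact: df|exact: dg].
apply: eq_Ck_on (IH _ _ (Df v) (Dg v)) => // x Ux.
by rewrite -deriveD //; apply: diff_derivable; [exact: df|exact: dg].
Qed.

Lemma Ck_onM (R : realType) (V : normedModType R) k (U : set V) (f g : V -> R) :
  open U -> Ck_on k U f -> Ck_on k U g -> Ck_on k U (fun x => f x * g x).
Proof.
move=> oU; elim: k f g => [|k IH] f g.
  by move=> cf cg x Ux; apply: continuousM; [exact: cf|exact: cg].
move=> cf cg; have cf' := Ck_onW cf; have cg' := Ck_onW cg.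
move: cf cg => /= [df Df] [dg Dg]; split => [x Ux|v].
  by apply: differentiableM; [exact: df|exact: dg].
apply: eq_Ck_on (Ck_onD oU (IH _ _ cf' (Dg v)) (IH _ _ cg' (Df v))) => // x Ux.
rewrite -[RHS]/('D_v (f * g) x) deriveM //.
  by apply: diff_derivable; exact: df.
by apply: diff_derivable; exact: dg.
Qed.

Lemma Ck_on_sum (R : realType) (V W : normedModType R) k (U : set V) (I : Type)
    (r : seq I) (P : pred I) (f : I -> V -> W) :
  open U -> (forall i, P i -> Ck_on k U (f i)) ->
  Ck_on k U (fun x => \sum_(i <- r | P i) f i x).
Proof.
move=> oU H; elim: r => [|i r IH].
  by apply: eq_Ck_on (Ck_on_cst k U 0) => // x _; rewrite big_nil.
case Pi : (P i); last by apply: eq_Ck_on IH => // x _; rewrite big_cons Pi.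
by apply: eq_Ck_on (Ck_onD oU (H i Pi) IH) => // x _; rewrite big_cons Pi.
Qed.

Lemma Ck_on_entry (R : realType) (V : normedModType R) k (U : set V) n
    (f : V -> 'rV[R]_n) i :
  open U -> Ck_on k U f -> Ck_on k U (fun x => f x 0 i).
Proof.
move=> oU; elim: k f => [|k IH] f /=.
  move=> cf x Ux; apply: (@continuous_comp _ _ _ f (fun M => M 0 i)).
    exact: cf.
  exact: coord_continuous.
move=> [df Df]; split => [x Ux|v].
  by apply: differentiable_entry; exact: df.
apply: eq_Ck_on (IH _ (Df v)) => // x Ux.
by rewrite derive_entry //; exact: df.
Qed.

Lemma cvg_row (R : realType) (V : normedModType R) n
    (f : V -> 'rV[R]_n) (x : V) :
  (forall i, {for x, continuous (fun y => f y 0 i)}) -> {for x, continuous f}.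
Proof.
move=> H; apply/cvgrPdist_le => e e0 /=.
near=> y; rewrite /Num.Def.normr /= mx_normrE (bigmax_le _ (ltW e0)) //= => i _.
rewrite !mxE; move: i; near: y; apply: filter_forall => /= -[i1 i2] /=.
by rewrite ord1; exact: ((cvgrPdist_le _ _).1 (H i2)).
Unshelve. all: by end_near. Qed.

Lemma Ck_on_row (R : realType) (V : normedModType R) k (U : set V) n
    (f : V -> 'rV[R]_n) :
  open U -> (forall i, Ck_on k U (fun x => f x 0 i)) -> Ck_on k U f.
Proof.
move=> oU; elim: k f => [|k IH] f H.
  by move=> x Ux; apply: cvg_row => i; exact: H.
have df x : U x -> differentiable f x.
  by move=> Ux; apply: differentiable_row => i; have [+ _] := H i; exact.
split => // v; apply: IH => i.
have [_ /(_ v)] := H i; apply: eq_Ck_on => // x Ux.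
by rewrite derive_entry //; exact: df.
Qed.

Lemma Ck_on_coord (R : realType) k n (U : set 'rV[R]_n) i :
  open U -> Ck_on k U (fun x : 'rV[R]_n => x 0 i).
Proof.
move=> oU; case: k => [|k].
  by move=> x _; exact: coord_continuous.
split => [x _|v]; first exact: differentiable_coord.
apply: eq_Ck_on (Ck_on_cst k U (v 0 i)) => // x _.
by rewrite (derive_entry (f := id)) ?derive_id.
Qed.

Lemma Ck_on_comp (R : realType) (V : normedModType R) k n (U : set V)
    (O : set 'rV[R]_n) (f : V -> 'rV[R]_n) (g : 'rV[R]_n -> R) :
  open U -> open O -> (forall x, U x -> O (f x)) ->
  Ck_on k U f -> Ck_on k O g -> Ck_on k U (fun x => g (f x)).
Proof.
move=> oU oO fUO; elim: k f g fUO => [|k IH] f g fUO.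
  move=> cf cg x Ux; apply: (@continuous_comp _ _ _ f g); first exact: cf.
  by apply: cg; exact: fUO.
move=> cf cg; have cf' := Ck_onW cf; have cg' := Ck_onW cg.
move: cf cg => [df Df] [dg Dg]; split => [x Ux|v].
  apply: (@differentiable_comp _ _ _ _ f g); first exact: df.
  by apply: dg; exact: fUO.
suff H : Ck_on k U (fun x =>
    \sum_j ('D_v f x) 0 j * 'D_(delta_mx 0 j) g (f x)).
  apply: eq_Ck_on H => // x Ux.
  by rewrite -[RHS]/('D_v (g \o f) x) derive_comp_rV //; [exact: df|exact/dg/fUO].
apply: Ck_on_sum => // j _; apply: Ck_onM => //.
  exact: (Ck_on_entry j oU (Df v)).
exact: (IH f _ fUO cf' (Dg _)).
Qed.

Lemma Ck_on_comp1 (R : realType) (V : normedModType R) k (U : set V)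
    (O : set R) (f : V -> R) (g : R -> R) :
  open U -> open O -> (forall x, U x -> O (f x)) ->
  Ck_on k U f -> Ck_on k O g -> Ck_on k U (fun x => g (f x)).
Proof.
move=> oU oO fUO; elim: k f g fUO => [|k IH] f g fUO.
  move=> cf cg x Ux; apply: (@continuous_comp _ _ _ f g); first exact: cf.
  by apply: cg; exact: fUO.
move=> cf cg; have cf' := Ck_onW cf; have cg' := Ck_onW cg.
move: cf cg => [df Df] [dg Dg]; split => [x Ux|v].
  apply: (@differentiable_comp _ _ _ _ f g); first exact: df.
  by apply: dg; exact: fUO.
suff H : Ck_on k U (fun x => 'D_v f x * 'D_1 g (f x)).
  apply: eq_Ck_on H => // x Ux.
  by rewrite -[RHS]/('D_v (g \o f) x) (derive_comp1 _ (df _ Ux)) //; exact/dg/fUO.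
apply: Ck_onM => //; first exact: Df.
exact: (IH f _ fUO cf' (Dg _)).
Qed.

Lemma derive_scale1 (R : realType) (h : R -> R) (x v : R) :
  differentiable h x -> 'D_v h x = v * 'D_1 h x.
Proof.
by move=> dh; rewrite !deriveE // -[v in LHS]mulr1 -[v * 1]/(v *: 1) linearZ.
Qed.

(** Yields the smoothness of [expR], inversion, the square root and [acos] by induction on [k], as
    the derivative of each is expressed by itself or by functions already treated. *)
Lemma Ck_on_is_derive1 (R : realType) k (O : set R) (h h' : R -> R) :
  open O -> (forall x, O x -> is_derive x 1 h (h' x)) ->
  Ck_on k O h' -> Ck_on k.+1 O h.
Proof.
move=> oO dh ch'.
have dif x : O x -> differentiable h x.
  by move=> /dh dhx; apply/derivable1_diffP; exact: ex_derive.
split => // v.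
apply: eq_Ck_on (Ck_onM oO (Ck_on_cst k O v) ch') => // x Ox.
rewrite derive_scale1; last exact: dif.
by have dhx := dh x Ox; rewrite derive_val.
Qed.

Lemma Ck_on_expR (R : realType) k : Ck_on k setT (@expR R).
Proof.
elim: k => [|k IH]; first by move=> x _; exact: continuous_expR.
exact: (Ck_on_is_derive1 openT (fun x _ => is_derive_expR x)).
Qed.

Lemma Ck_onN (R : realType) (V : normedModType R) k (U : set V) (f : V -> R) :
  open U -> Ck_on k U f -> Ck_on k U (fun x => - f x).
Proof.
move=> oU cf; apply: eq_Ck_on (Ck_onM oU (Ck_on_cst k U (-1 : R)) cf) => // x _.
by rewrite mulN1r.
Qed.

Lemma Ck_onB (R : realType) (V : normedModType R) k (U : set V) (f g : V -> R) :
  open U -> Ck_on k U f -> Ck_on k U g -> Ck_on k U (fun x => f x - g x).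
Proof. by move=> oU cf cg; apply: Ck_onD => //; exact: Ck_onN. Qed.

Lemma Ck_on_inv1 (R : realType) k : Ck_on k [set x : R | x != 0] (fun x => x^-1).
Proof.
have oO : open [set x : R | x != 0] by exact: open_neq.
elim: k => [|k IH]; first by move=> x /= x0; apply: (@continuousV R R id).
apply: (@Ck_on_is_derive1 R k _ _ (fun x => - (x^-1 * x^-1))) => //.
  move=> x /= x0; apply: (is_derive_eq (@is_deriveV R id x 1 1 x0 _)).
  by rewrite /GRing.scale /= mulr1 expr2 invfM.
by apply: Ck_onN => //; apply: Ck_onM.
Qed.

Lemma Ck_onV (R : realType) (V : normedModType R) k (U : set V) (f : V -> R) :
  open U -> (forall x, U x -> f x != 0) -> Ck_on k U f ->
  Ck_on k U (fun x => (f x)^-1).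
Proof.
move=> oU f0 cf; apply: (Ck_on_comp1 oU _ f0 cf (@Ck_on_inv1 R k)).
exact: open_neq.
Qed.

Lemma is_derive1_sqrt (R : realType) (x : R) :
  0 < x -> is_derive x 1 Num.sqrt ((2 * Num.sqrt x)^-1).
Proof.
move=> x0; have s0 : 0 < Num.sqrt x by rewrite sqrtr_gt0.
rewrite -[X in is_derive X](sqr_sqrtr (ltW x0)).
apply: (@is_derive_inverse R (fun y => y ^+ 2)).
- near=> y; rewrite sqrtr_sqr ger0_norm //; near: y.
  by apply: filterS (lt_nbhsr s0) => y /ltW.
- by near=> y; exact: exprn_continuous.
- apply: is_derive_eq. by rewrite /GRing.scale /=; ring.
- by rewrite mulf_neq0 // gt_eqF.
Unshelve. all: by end_near. Qed.

Lemma Ck_on_sqrt (R : realType) k : Ck_on k [set x : R | 0 < x] Num.sqrt.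
Proof.
have oO : open [set x : R | 0 < x] by exact: open_gt.
elim: k => [|k IH]; first by move=> x _; exact: sqrt_continuous.
apply: (Ck_on_is_derive1 oO (@is_derive1_sqrt R)).
apply: Ck_onV => // [x x0|]; first by rewrite mulf_neq0 // gt_eqF // sqrtr_gt0.
by apply: Ck_onM => //; exact: Ck_on_cst.
Qed.

Lemma Ck_on_acos (R : realType) k :
  Ck_on k [set x : R | -1 < x < 1] acos.
Proof.
have -> : [set x : R | -1 < x < 1] = [set x : R | -1 < x] `&` [set x | x < 1].
  by apply/seteqP; split => x /=; [move/andP|case=> -> ->].
have oO : open ([set x : R | -1 < x] `&` [set x | x < 1]).
  by apply: openI; [exact: open_gt|exact: open_lt].
elim: k => [|k IH].
  by move=> x [/= x1 x2]; apply: continuous_acos; rewrite x1.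
apply: (@Ck_on_is_derive1 R k _ _ (fun x => - (Num.sqrt (1 - x * x))^-1)) => //.
  by move=> x [x1 x2]; rewrite -expr2; apply: is_derive1_acos; rewrite x1.
have H x : ([set x : R | -1 < x] `&` [set x | x < 1]) x -> 0 < 1 - x * x.
  by move=> [/= x1 x2]; nra.
have cid : Ck_on k ([set x : R | -1 < x] `&` [set x | x < 1]) (fun x => x).
  case: k {IH} => [|k]; first by move=> x _; exact: cvg_id.
  split => // v; apply: eq_Ck_on (Ck_on_cst k _ v) => // x _.
  by rewrite derive_id.
apply: Ck_onN => //; apply: Ck_onV => // [x /H|].
  by rewrite -sqrtr_gt0 => /gt_eqF ->.
apply: (Ck_on_comp1 (O := [set x : R | 0 < x]) _ _ H) => //.
- apply: Ck_onB => //; first exact: Ck_on_cst.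
  exact: Ck_onM.
- exact: Ck_on_sqrt.
Qed.

Lemma Ck_on_prod (R : realType) (V : normedModType R) k (U : set V) (I : Type)
    (r : seq I) (P : pred I) (f : I -> V -> R) :
  open U -> (forall i, P i -> Ck_on k U (f i)) ->
  Ck_on k U (fun x => \prod_(i <- r | P i) f i x).
Proof.
move=> oU H; elim: r => [|i r IH].
  by apply: eq_Ck_on (Ck_on_cst k U (1 : R)) => // x _; rewrite big_nil.
case Pi : (P i); last by apply: eq_Ck_on IH => // x _; rewrite big_cons Pi.
by apply: eq_Ck_on (Ck_onM oU (H i Pi) IH) => // x _; rewrite big_cons Pi.
Qed.

Lemma Ck_on_det (R : realType) (V : normedModType R) k (U : set V) n
    (f : V -> 'M[R]_n) :
  open U -> (forall i j, Ck_on k U (fun x => f x i j)) ->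
  Ck_on k U (fun x => \det (f x)).
Proof.
move=> oU H; apply: Ck_on_sum => // s _; apply: Ck_onM => //.
  exact: Ck_on_cst.
exact: Ck_on_prod.
Qed.

Lemma Ck_on_invmx (R : realType) (V : normedModType R) k (U : set V) n
    (f : V -> 'M[R]_n) :
  open U -> (forall x, U x -> f x \in unitmx) ->
  (forall i j, Ck_on k U (fun x => f x i j)) ->
  forall i j, Ck_on k U (fun x => invmx (f x) i j).
Proof.
move=> oU fu H i j.
suff : Ck_on k U (fun x => (\det (f x))^-1 * cofactor (f x) j i).
  by apply: eq_Ck_on => // x Ux; rewrite /invmx fu // !mxE.
apply: Ck_onM => //.
  apply: Ck_onV => //; last exact: Ck_on_det.
  by move=> x /fu; rewrite unitmxE unitfE.
apply: Ck_onM => //; first exact: Ck_on_cst.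
apply: Ck_on_det => // i' j'.
apply: eq_Ck_on (H (lift j i') (lift i j')) => // x _.
by rewrite !mxE.
Qed.

(** * Inverse function theorem *)

Lemma rV_norm_le (R : realType) m n (v : 'M[R]_(m, n)) (c : R) :
  0 <= c -> (forall i j, `|v i j| <= c) -> `|v| <= c.
Proof.
move=> c0 H; rewrite /Num.Def.normr /= mx_normrE (bigmax_le _ c0) //=.
Qed.

Lemma entry_le_norm (R : realType) m n (v : 'M[R]_(m, n)) i j : `|v i j| <= `|v|.
Proof.
rewrite [leRHS]/Num.Def.normr /= mx_normrE.
exact: (le_bigmax _ (fun ij : 'I_m * 'I_n => `|v ij.1 ij.2|) (i, j)).
Qed.

Lemma mulmx_norm_le (R : realType) n (A : 'M[R]_n) :
  exists2 C : R, 0 < C & forall v : 'rV[R]_n, `|v *m A| <= C * `|v|.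
Proof.
exists (n%:R * `|A| + 1); first by rewrite ltr_wpDl // mulr_ge0.
move=> v; apply: rV_norm_le => [|i j].
  by rewrite mulr_ge0 // addr_ge0 // mulr_ge0.
rewrite mxE (le_trans (ler_norm_sum _ _ _)) //.
apply: (@le_trans _ _ (\sum_(k < n) `|v| * `|A|)).
  by apply: ler_sum => k _; rewrite normrM ler_pM // entry_le_norm.
rewrite sumr_const card_ord -[_ *+ n]mulr_natl.
have : 0 <= `|v| by []; set a := _%:R; set b := `|v|; set c := `|A| => b0; lra.
Qed.

Lemma derive_mulmxr (R : realType) (V : normedModType R) n p
    (f : V -> 'rV[R]_n) (A : 'M[R]_(n, p)) (x v : V) :
  differentiable f x ->
  differentiable (fun y => f y *m A) x /\
  'D_v (fun y => f y *m A) x = 'D_v f x *m A.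
Proof.
move=> df.
have E j : (fun y => (f y *m A) 0 j) = \sum_k (fun y => A k j *: f y 0 k).
  apply/funext => y; rewrite fct_sumE mxE; apply: eq_bigr => k _.
  by rewrite mulrC.
have dk j k : differentiable (fun y => A k j *: f y 0 k) x.
  by apply: differentiableZ; exact: differentiable_entry.
have D : differentiable (fun y => f y *m A) x.
  by apply: differentiable_row => j; rewrite E; exact: differentiable_sum.
split => //; apply/rowP => j; rewrite -derive_entry // E.
rewrite derive_sum; last by move=> k; exact: diff_derivable.
rewrite mxE; apply: eq_bigr => k _.
rewrite deriveZ; last by apply/diff_derivable/differentiable_entry.
by rewrite derive_entry // mulrC.
Qed.

Lemma is_derive_line (R : realType) (V W : normedModType R) (f : V -> W)
    (x v : V) (t : R) :
  differentiable f (x + t *: v) ->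
  is_derive t 1 (fun s : R => f (x + s *: v)) ('D_v f (x + t *: v)).
Proof.
move=> df.
have E : (fun h : R => h^-1 *: (((fun s : R => f (x + s *: v)) \o shift t) (h *: 1)
    - f (x + t *: v))) =
  (fun h : R => h^-1 *: ((f \o shift (x + t *: v)) (h *: v) - f (x + t *: v))).
  apply/funext => h /=; congr (_ *: (f _ - _)).
  by rewrite -[h *: 1]/(h * 1) mulr1 scalerDl addrCA.
have dv : derivable f (x + t *: v) v by exact: diff_derivable.
apply: DeriveDef; first by rewrite /derivable E.
by rewrite /derive E.
Qed.

Lemma mean_value_line (R : realType) (V : normedModType R) (f : V -> R) (x v : V) :
  (forall t, 0 <= t <= 1 -> differentiable f (x + t *: v)) ->
  exists2 t : R, 0 <= t <= 1 & f (x + v) - f x = 'D_v f (x + t *: v).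
Proof.
move=> df.
have [|| t t01 E] := @MVT_segment R (fun s => f (x + s *: v))
    (fun s => 'D_v f (x + s *: v)) 0 1 ler01.
- move=> t; rewrite in_itv /= => /andP[t0 t1]; apply: is_derive_line.
  by apply: df; rewrite !ltW.
- apply: derivable_within_continuous => t; rewrite in_itv /= => t01.
  by have H := is_derive_line (df _ t01); apply: ex_derive.
exists t; first by move: t01; rewrite in_itv.
by move: E; rewrite scale1r scale0r addr0 subr0 mulr1.
Qed.

Lemma derive_rV_sum (R : realType) n (f : 'rV[R]_n -> R) (x v : 'rV[R]_n) :
  differentiable f x ->
  'D_v f x = \sum_j v 0 j * 'D_(delta_mx 0 j) f x.
Proof.
move=> df; rewrite deriveE // [v in LHS]row_sum_delta linear_sum.
by apply: eq_bigr => j _; rewrite [LHS]linearZ deriveE.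
Qed.

Lemma derive_jacobian (R : realType) n (f : 'rV[R]_n -> 'rV[R]_n)
    (x v : 'rV[R]_n) : differentiable f x -> 'D_v f x = v *m jacobian f x.
Proof. exact: deriveEjacobian. Qed.

(** Vectors are rows, so the inverse Jacobian acts on the right. The map [phi x = f x *m A - x] has
    zero derivative at [x0]; near [x0] its partial derivatives are small by continuity, and the mean
    value theorem, applied to each coordinate on a segment of the ball, makes [phi] a contraction of
    ratio 1/2. *)
Lemma near_identity (R : realType) n (U : set 'rV[R]_n)
    (f : 'rV[R]_n -> 'rV[R]_n) (x0 : 'rV[R]_n) :
  open U -> Ck_on 1 U f -> U x0 -> (forall v, 'D_v f x0 = 0 -> v = 0) ->
  let A := invmx (jacobian f x0) in
  exists r : R, [/\ 0 < r, ball x0 r `<=` U,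
    (forall x v, ball x0 r x -> `|'D_v f x *m A - v| <= 2^-1 * `|v|) &
    forall x y, ball x0 r x -> ball x0 r y ->
      `|(f x - f y) *m A - (x - y)| <= 2^-1 * `|x - y|].
Proof.
move=> oU [df cD] Ux0 inj A.
have Ju : jacobian f x0 \in unitmx.
  apply: mulmx_inj_unitmx => v; rewrite -derive_jacobian; first exact: inj.
  exact: df.
pose phi x := f x *m A - x.
have dphi x v : U x -> differentiable phi x /\ 'D_v phi x = 'D_v f x *m A - v.
  move=> Ux; have [d1 d2] := derive_mulmxr A v (df x Ux).
  split; first exact: differentiableB.
  rewrite -[phi]/((fun y => f y *m A) - id) deriveB ?d2 ?derive_id //.
  exact: diff_derivable.
(* A coordinate of a derivative is a sum of [n] terms bounded by [e] times the norm of the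
   direction, hence the 1/2 in the end; [n.+1] also covers [n = 0]. *)
pose e : R := (2 * n.+1%:R)^-1.
have e0 : 0 < e by rewrite invr_gt0 mulr_gt0.
have cphi i j : \forall x \near x0, `|('D_(delta_mx 0 j) phi x) 0 i| <= e.
  have c1 : {for x0, continuous (fun x => ('D_(delta_mx 0 j) f x *m A) 0 i)}.
    have E : (fun x => ('D_(delta_mx 0 j) f x *m A) 0 i) =
        (fun x => \sum_k ('D_(delta_mx 0 j) f x) 0 k * A k i).
      by apply/funext => x; rewrite mxE.
    have H : Ck_on 0 U (fun x => \sum_k ('D_(delta_mx 0 j) f x) 0 k * A k i).
      apply: Ck_on_sum => // k _; apply: Ck_onM => //; last exact: Ck_on_cst.
      exact: (Ck_on_entry (k := 0) k oU (cD _)).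
    by rewrite E; exact: H.
  move/cvgrPdist_le : (c1) => /(_ e e0) c2.
  have Un := open_nbhs_nbhs (conj oU Ux0).
  near=> x; have Ux : U x by near: x.
  have [_ ->] := dphi x (delta_mx 0 j) Ux.
  have : `|('D_(delta_mx 0 j) f x0 *m A) 0 i - ('D_(delta_mx 0 j) f x *m A) 0 i| <= e.
    by near: x.
  rewrite derive_jacobian; last exact: df.
  rewrite -mulmxA mulmxV // mulmx1 distrC => H.
  by rewrite [X in `|X|]mxE [X in `|_ + X|]mxE.
have : \forall x \near x0, U x /\ forall i j : 'I_n, `|('D_(delta_mx 0 j) phi x) 0 i| <= e.
  have call : \forall x \near x0, forall i j : 'I_n, `|('D_(delta_mx 0 j) phi x) 0 i| <= e.
    apply: (@filter_forall _ 'I_n (fun i x => forall j : 'I_n,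
      `|('D_(delta_mx 0 j) phi x) 0 i| <= e) (nbhs x0) (nbhs_filter x0)) => i.
    apply: (@filter_forall _ 'I_n (fun j x =>
      `|('D_(delta_mx 0 j) phi x) 0 i| <= e) (nbhs x0) (nbhs_filter x0)) => j.
    exact: cphi.
  have Un := open_nbhs_nbhs (conj oU Ux0).
  by near=> x; split; near: x.
move=> /nbhs_ballP[r r0 Hr]; exists r.
have rU : ball x0 r `<=` U by move=> x /Hr[].
have bd x v : ball x0 r x -> forall i, `|('D_v phi x) 0 i| <= 2^-1 * `|v|.
  move=> /Hr[Ux He] i; have [dx _] := dphi x v Ux.
  rewrite -derive_entry // derive_rV_sum; last exact: differentiable_entry.
  rewrite (le_trans (ler_norm_sum _ _ _)) //.
  apply: (@le_trans _ _ (\sum_(j < n) `|v| * e)).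
    apply: ler_sum => j _; rewrite normrM ler_pM //; first exact: entry_le_norm.
    by rewrite derive_entry.
  rewrite sumr_const card_ord -[_ *+ n]mulr_natl mulrCA mulrC ler_wpM2r //.
  rewrite /e invfM mulrCA ler_piMr ?invr_ge0 // ler_pdivrMr // mul1r.
  by rewrite ler_nat.
split => // [x v bx|x y bx by_].
  have [_ <-] := dphi x v (rU _ bx).
  by apply: rV_norm_le => [|i j]; [rewrite mulr_ge0|rewrite ord1; exact: bd].
have E : (f x - f y) *m A - (x - y) = phi x - phi y.
  by rewrite /phi mulmxBl; apply/rowP => i; rewrite !mxE; ring.
rewrite E; apply: rV_norm_le => [|i j]; first by rewrite mulr_ge0.
rewrite ord1 [X in `|X|]mxE [X in `|_ + X|]mxE.
have bt (t : R) : 0 <= t <= 1 -> ball x0 r (y + t *: (x - y)).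
  move=> /andP[t0 t1]; move: bx by_; rewrite -ball_normE /= => bx by_.
  rewrite (_ : _ - _ = t *: (x0 - x) + (1 - t) *: (x0 - y)); last first.
    by apply/rowP => k; rewrite !mxE; ring.
  rewrite (le_lt_trans (ler_normD _ _)) // !normrZ !ger0_norm // ?subr_ge0 //.
  have [->|tn0] := eqVneq t 0; first by rewrite mul0r add0r subr0 mul1r.
  have H1 : 0 < t * (r - `|x0 - x|) by rewrite mulr_gt0 ?subr_gt0 // lt0r tn0.
  have H2 : 0 <= (1 - t) * (r - `|x0 - y|) by rewrite mulr_ge0 ?subr_ge0 // ltW.
  by move: H1 H2; set a := `|_|; set b := `|_|; lra.
have [|t t01] := @mean_value_line R _ (fun z => phi z 0 j) y (x - y).
  move=> t t01; apply: differentiable_entry; apply: (proj1 (dphi _ 0 _)).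
  exact/rU/bt.
rewrite [y + _]addrCA subrr addr0 => ->.
rewrite derive_entry; last by apply: (proj1 (dphi _ 0 _)); exact/rU/bt.
exact/bd/bt.
Unshelve. all: by end_near. Qed.

(** For [y] near [f x0], Newton's map with frozen derivative, [x + (y - f x) *m A], contracts a
    closed ball around [x0] into itself, and its fixed point is a preimage of [y]. *)
Lemma local_surjective (R : realType) n (U : set 'rV[R]_n)
    (f : 'rV[R]_n -> 'rV[R]_n) (x0 : 'rV[R]_n) :
  open U -> Ck_on 1 U f -> U x0 -> (forall v, 'D_v f x0 = 0 -> v = 0) ->
  forall N, nbhs x0 N -> nbhs (f x0) (f @` N).
Proof.
move=> oU cf Ux0 inj N /nbhs_ballP[d d0 dN].
have [r [r0 rU Hd Hr]] := near_identity oU cf Ux0 inj.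
set A := invmx _ in Hd Hr.
have Ju : jacobian f x0 \in unitmx.
  apply: mulmx_inj_unitmx => v; rewrite -derive_jacobian; first exact: inj.
  by case: cf => df _; exact: df.
have Au : A \in unitmx by rewrite unitmx_inv.
pose s := Num.min r d / 2.
have s0 : 0 < s by rewrite divr_gt0 // lt_min r0.
have sb x : `|x - x0| <= s -> ball x0 r x /\ ball x0 d x.
  have m0 : 0 < Num.min r d by rewrite lt_min r0.
  have mr : Num.min r d <= r by rewrite ge_min lexx.
  have md : Num.min r d <= d by rewrite ge_min lexx orbT.
  by move=> xs; rewrite -ball_normE /= distrC; split; rewrite (le_lt_trans xs) // /s; lra.
have [C C0 HC] := mulmx_norm_le A.
(* With this radius the term [(y - f x0) *m A] has norm at most [s / 2]; the contraction contributes
   the other half of [s]. *)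
apply/nbhs_ballP; exists (s / (2 * C)); first by rewrite /= divr_gt0 // mulr_gt0.
move=> y; rewrite -ball_normE /= => yb.
pose T x := x + (y - f x) *m A.
pose B := [set x : 'rV[R]_n | `|x - x0| <= s].
have yA : `|(y - f x0) *m A| <= s / 2.
  rewrite (le_trans (HC _)) // -ler_pdivlMl // distrC (le_trans (ltW yb)) //.
  by rewrite le_eqVlt; apply/orP; left; apply/eqP; field; rewrite gt_eqF.
have bx0 : ball x0 r x0 by exact: ballxx.
have TB : {homo T : x / B x >-> B x}.
  move=> x; rewrite /B /= => xs; rewrite /T.
  rewrite (_ : _ - _ = (y - f x0) *m A - ((f x - f x0) *m A - (x - x0))); last first.
    by rewrite !mulmxBl; apply/rowP => k; rewrite !mxE; ring.
  rewrite (le_trans (ler_normB _ _)) //.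
  have := Hr x x0 (sb _ xs).1 bx0; lra.
have [|||x Bx xT] := banach_fixed_point (U := B) (f := mkfun_fun TB).
- exists (2^-1)%:nng; split; first by rewrite /= invf_lt1 // ltr1n.
  move=> [x x'] [/= Bx Bx']; rewrite /mkfun_fun /= /mkfun /T.
  rewrite (_ : _ - _ = - ((f x - f x') *m A - (x - x'))); last first.
    by rewrite !mulmxBl; apply/rowP => k; rewrite !mxE; ring.
  by rewrite normrN; apply: Hr; [exact: (sb _ Bx).1|exact: (sb _ Bx').1].
- rewrite /B; apply: (@closed_comp _ _ (fun x : 'rV[R]_n => `|x - x0|) [set u | u <= s]).
    by move=> x _; exact: (cvg_norm (cvgB (@cvg_id _ (nbhs x)) (cvg_cst x0))).
  exact: closed_le.
- by exists x0; rewrite /B /= subrr normr0 ltW.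
exists x; first exact/dN/(sb _ Bx).2.
move: xT; rewrite /mkfun_fun /= /mkfun /T => /eqP.
rewrite -subr_eq0 opprD addNKr oppr_eq0 => /eqP E.
have : (y - f x) *m A *m invmx A = 0 by rewrite E mul0mx.
by rewrite -mulmxA mulmxV // mulmx1 => /eqP; rewrite subr_eq0 => /eqP.
Qed.

(** [near_identity] bounds the increment of [g] by [2 * C] times the norm of [h]. The remainder of
    [f] at [g y], small with respect to this increment, is thus small with respect to [h], and [A]
    maps it to the remainder of [g] up to sign. The two factors [C] explain the choice of [e']. *)
Lemma differentiable_inverse (R : realType) n (U : set 'rV[R]_n)
    (f g : 'rV[R]_n -> 'rV[R]_n) (y : 'rV[R]_n) :
  open U -> Ck_on 1 U f -> U (g y) -> (forall v, 'D_v f (g y) = 0 -> v = 0) ->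
  (\forall z \near y, f (g z) = z) -> {for y, continuous g} ->
  differentiable g y /\ forall v, 'D_v g y = v *m invmx (jacobian f (g y)).
Proof.
move=> oU cf Ugy inj fg cg; set x0 := g y; have [df _] := cf.
have fx0 : f x0 = y by exact: (nbhs_singleton fg).
have [r [r0 rU _ Hr]] := near_identity oU cf Ugy inj.
set A := invmx _ in Hr *.
have Ju : jacobian f x0 \in unitmx.
  by apply: mulmx_inj_unitmx => v; rewrite -derive_jacobian; [exact: inj|exact: df].
have [C C0 HC] := mulmx_norm_le A.
have Lc : continuous (mulmxr A : 'rV[R]_n -> 'rV[R]_n).
  move=> x; apply: differentiable_continuous.
  exact: (proj1 (derive_mulmxr (f := id) A 0 _)).
have [d D] : differentiable g y /\ 'd g y = mulmxr A :> ('rV[R]_n -> 'rV[R]_n).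
  apply: eps_diff => // e e0.
  pose e' := e / (2 * C * C).
  have e'0 : 0 < e' by rewrite divr_gt0 // !mulr_gt0.
  have He := diff_eps (df _ Ugy) e'0.
  have gx0 : \forall z \near y, ball x0 r (g z).
    by apply: cg; exact: nbhsx_ballx.
  have gd : \forall z \near y,
      `|f (g z - x0 + x0) - f x0 - 'd f x0 (g z - x0)| <= e' * `|g z - x0|.
    have c2 : (g z - x0) @[z --> y] --> (0 : 'rV[R]_n).
      by rewrite -[0](subrr x0); exact: (cvgB cg (cvg_cst x0)).
    exact: (c2 _ He).
  move: fg gx0 gd; rewrite !(near_shift 0 y) !subr0 => fg gx0 gd.
  near=> h.
  have E1 : f (g (h + y)) = h + y by near: h.
  have E2 : ball x0 r (g (h + y)) by near: h.
  have E3 : `|f (g (h + y) - x0 + x0) - f x0 - 'd f x0 (g (h + y) - x0)| <=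
    e' * `|g (h + y) - x0| by near: h.
  have E4 := Hr _ _ E2 (ballxx x0 r0).
  move: E3; rewrite subrK E1 fx0 addrK -deriveE; last exact: df.
  rewrite derive_jacobian; last exact: df.
  move: E4; rewrite E1 fx0 addrK => E4 E3.
  have E5 : `|g (h + y) - x0| <= 2 * (C * `|h|).
    have := ler_normB (h *m A) (h *m A - (g (h + y) - x0)).
    by rewrite subKr; have := HC h; move: E4; lra.
  rewrite -/x0 distrC.
  rewrite (_ : _ - _ = (h - (g (h + y) - x0) *m jacobian f x0) *m A); last first.
    by rewrite mulmxBl -mulmxA mulmxV // mulmx1.
  rewrite (le_trans (HC _)) // (le_trans (ler_wpM2l (ltW C0) E3)) //.
  rewrite (le_trans (ler_wpM2l (ltW C0) (ler_wpM2l (ltW e'0) E5))) //.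
  rewrite /e' le_eqVlt; apply/orP; left; apply/eqP; field.
  by rewrite gt_eqF.
by split => // v; rewrite deriveE // D.
Unshelve. all: by end_near. Qed.

(** Bootstrapping: the derivative of [g] is the inverse Jacobian of [f] taken at [g], so it is of
    class C^k as soon as [g] is. *)
Lemma smooth_inverse (R : realType) n (U B : set 'rV[R]_n)
    (f g : 'rV[R]_n -> 'rV[R]_n) :
  open U -> open B -> smooth_on U f ->
  (forall x v, U x -> 'D_v f x = 0 -> v = 0) ->
  (forall y, B y -> U (g y) /\ f (g y) = y) ->
  (forall y, B y -> {for y, continuous g}) -> smooth_on B g.
Proof.
move=> oU oB sf inj fg cg.
have dg y : B y -> differentiable g y /\
    forall v, 'D_v g y = v *m invmx (jacobian f (g y)).
  move=> By; have [Ugy _] := fg y By.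
  apply: (differentiable_inverse oU (sf 1%N)) => //.
  - by move=> v; exact: inj.
  - by apply: filterS (open_nbhs_nbhs (conj oB By)) => z /fg[].
  - exact: cg.
elim=> [|k IH]; first exact: cg.
split => [y /dg[]//|v]; apply: Ck_on_row => // j.
suff : Ck_on k B (fun y => \sum_i v 0 i * invmx (jacobian f (g y)) i j).
  by apply: eq_Ck_on => // y By; have [_ ->] := dg y By; rewrite mxE.
apply: Ck_on_sum => // i _; apply: Ck_onM => //; first exact: Ck_on_cst.
apply: Ck_on_invmx => // [y By|i' j'].
  have [Ugy _] := fg y By; have [df _] := sf 1%N.
  apply: mulmx_inj_unitmx => w; rewrite -derive_jacobian; last exact: df.
  exact: inj.
suff : Ck_on k B (fun y => ('D_(delta_mx 0 i') f (g y)) 0 j').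
  apply: eq_Ck_on => // y By; have [Ugy _] := fg y By; have [df _] := sf 1%N.
  by rewrite derive_jacobian ?rowE -?rowE ?mxE //; exact: df.
have [_ Df] := sf k.+1.
apply: (Ck_on_comp (g := fun x => ('D_(delta_mx 0 i') f x) 0 j') oB oU) IH _.
  by move=> y /fg[].
exact: (Ck_on_entry j' oU (Df _)).
Qed.

(** [local_surjective], applied to all neighborhoods of all points, says that [f] is open, which is
    the openness of the image and the continuity of the inverse. *)
Lemma diffeomorphism_of_injective (R : realType) n (U : set 'rV[R]_n)
    (f : 'rV[R]_n -> 'rV[R]_n) :
  open U -> smooth_on U f ->
  (forall x y, U x -> U y -> f x = f y -> x = y) ->
  (forall x v, U x -> 'D_v f x = 0 -> v = 0) ->
  diffeomorphism U (f @` U) f.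
Proof.
move=> oU sf finj dinj.
have fopen x N : U x -> nbhs x N -> nbhs (f x) (f @` N).
  move=> Ux; apply: (local_surjective oU (sf 1%N) Ux) => v; exact: dinj.
have oB : open (f @` U).
  rewrite openE => _ [x Ux <-]; apply: fopen => //.
  exact: open_nbhs_nbhs.
pose g y := xget 0 [set x | U x /\ f x = y].
have gP y : (f @` U) y -> U (g y) /\ f (g y) = y.
  by move=> [x Ux fx]; apply: (@xgetPex _ 0 [set x | U x /\ f x = y]); exists x.
have gK x : U x -> g (f x) = x.
  by move=> Ux; have [Ug Eg] := gP (f x) (imageP f Ux); exact: finj.
have cg y : (f @` U) y -> {for y, continuous g}.
  move=> By; have [Ugy fgy] := gP y By; move=> N /= gN.
  have NU : nbhs (g y) (N `&` U).
    by apply: filterI => //; exact: open_nbhs_nbhs.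
  have := fopen _ _ Ugy NU; rewrite fgy; apply: filterS.
  by move=> _ [x [Nx Ux] <-] /=; rewrite gK.
split => //; exists g; split => //.
exact: (smooth_inverse oU oB sf dinj gP cg).
Qed.

(** The inverse function theorem. On the ball of [near_identity], a difference or a direction killed
    by [f] or by its derivative has norm at most half of itself. *)
Lemma locally_injective (R : realType) n (U : set 'rV[R]_n)
    (f : 'rV[R]_n -> 'rV[R]_n) (x0 : 'rV[R]_n) :
  open U -> smooth_on U f -> U x0 -> (forall v, 'D_v f x0 = 0 -> v = 0) ->
  exists A : set 'rV[R]_n,
    [/\ A x0, A `<=` U & diffeomorphism A (f @` A) f].
Proof.
move=> oU sf Ux0 inj.
have [r [r0 rU Hd Hr]] := near_identity oU (sf 1%N) Ux0 inj.
exists (ball x0 r); split => //; first exact: ballxx.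
apply: diffeomorphism_of_injective.
- exact: ball_open.
- by move=> k; apply: Ck_onS (sf k).
- move=> x y bx by_ fxy; have := Hr x y bx by_.
  rewrite fxy subrr mul0mx sub0r normrN => H.
  apply/eqP; rewrite -subr_eq0 -normr_le0; move: H; set a := `|_|; lra.
- move=> x v bx Dv; have := Hd x v bx; rewrite Dv mul0mx sub0r normrN => H.
  apply/eqP; rewrite -normr_le0; move: H; set a := `|_|; lra.
Qed.

(** * Diffeomorphisms between cones over truncated tetrahedra *)

(** When [c] holds the coordinates of a vector in the frame of the [T i], and [al] the entries of
    the Gram matrix up to sign, [- cap al i c] is the product with [T i] ([mink_row_cap]), so
    [cap al i] vanishes on the triangular face [i]. With all coefficients equal to 2 it cuts the
    standard simplex at [bary x i = 2 / 3] ([cap_bary_vec]). *)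
Definition cap (R : ringType) (al : 'I_4 -> 'I_4 -> R) (i : 'I_4) (c : 'rV[R]_4) : R :=
  \sum_(j | j != i) al i j * c 0 j - c 0 i.

Lemma capZ (R : comRingType) (al : 'I_4 -> 'I_4 -> R) i c t :
  cap al i (t *: c) = t * cap al i c.
Proof.
rewrite /cap mulrBr mulr_sumr mxE; congr (_ - _); apply: eq_bigr => q _.
by rewrite mxE; ring.
Qed.

Definition cone (R : realType) (al : 'I_4 -> 'I_4 -> R) : set 'rV[R]_4 :=
  [set c : 'rV[R]_4 | [/\ c != 0, forall i, 0 <= c 0 i & forall i, 0 <= cap al i c]].

(* A positively homogeneous diffeomorphism between neighborhoods of two cones
   over truncated tetrahedra, matching the faces. *)
Definition cone_equiv (R : realType) (al al' : 'I_4 -> 'I_4 -> R) : Prop :=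
  exists (A B : set 'rV[R]_4) (F G : 'rV[R]_4 -> 'rV[R]_4),
  [/\ [/\ open A, open B, smooth_on A F & smooth_on B G],
      [/\ forall c, A c -> B (F c) /\ G (F c) = c,
          forall c, B c -> A (G c) /\ F (G c) = c,
          forall c t, A c -> 0 < t -> A (t *: c) /\ F (t *: c) = t *: F c &
          forall c t, B c -> 0 < t -> B (t *: c) /\ G (t *: c) = t *: G c],
      cone al `<=` A /\ cone al' `<=` B,
      forall c, cone al c -> [/\ cone al' (F c),
        forall i, (F c 0 i == 0) = (c 0 i == 0) &
        forall i, (cap al' i (F c) == 0) = (cap al i c == 0)] &
      forall c, cone al' c -> cone al (G c)].

Lemma cone_equiv_sym (R : realType) (al al' : 'I_4 -> 'I_4 -> R) :
  cone_equiv al al' -> cone_equiv al' al.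
Proof.
move=> [A [B [F [G [[oA oB sF sG] [FG GF hF hG] [cA cB] cF cG]]]]].
exists B, A, G, F; split => // c cc; last by have [] := cF c cc.
have Gc := cG c cc; have [_ E] := GF c (cB c cc).
have [_ e1 e2] := cF _ Gc.
by split => // i; rewrite -?e1 -?e2 E.
Qed.

Lemma open_preimage (R : realType) (V W : normedModType R) (A : set V) (B : set W)
    (f : V -> W) :
  open A -> open B -> (forall x, A x -> {for x, continuous f}) ->
  open (A `&` f @^-1` B).
Proof.
move=> oA oB cf; rewrite openE => x [Ax Bx]; apply: filterI.
  exact: open_nbhs_nbhs.
by apply: cf => //; exact: open_nbhs_nbhs.
Qed.

Lemma smooth_on_comp (R : realType) m n p (A : set 'rV[R]_m) (B : set 'rV[R]_n)
    (f : 'rV[R]_m -> 'rV[R]_n) (g : 'rV[R]_n -> 'rV[R]_p) :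
  open A -> open B -> (forall x, A x -> B (f x)) ->
  smooth_on A f -> smooth_on B g -> smooth_on A (g \o f).
Proof.
move=> oA oB fAB sf sg k; apply: Ck_on_row => // i.
by apply: (Ck_on_comp (g := fun y => g y 0 i) oA oB fAB (sf k)); apply: Ck_on_entry.
Qed.

Lemma smooth_onS (R : realType) (V W : normedModType R) (A A' : set V) (f : V -> W) :
  A' `<=` A -> smooth_on A f -> smooth_on A' f.
Proof. by move=> s sf k; exact: Ck_onS (sf k). Qed.

Lemma cone_equiv_trans (R : realType) (al al' al'' : 'I_4 -> 'I_4 -> R) :
  cone_equiv al al' -> cone_equiv al' al'' -> cone_equiv al al''.
Proof.
move=> [A [B [F [G [[oA oB sF sG] [FG GF hF hG] [cA cB] cF cG]]]]].
move=> [A' [B' [F' [G' [[oA' oB' sF' sG'] [FG' GF' hF' hG'] [cA' cB'] cF' cG']]]]].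
have o1 : open (A `&` F @^-1` A') by apply: open_preimage => //; exact: (sF 0%N).
have o2 : open (B' `&` G' @^-1` B) by apply: open_preimage => //; exact: (sG' 0%N).
exists (A `&` F @^-1` A'), (B' `&` G' @^-1` B), (F' \o F), (G \o G'); split.
- split => //.
    apply: (smooth_on_comp o1 oA') => //; first by move=> x [].
    by apply: smooth_onS sF => x [].
  apply: (smooth_on_comp o2 oB) => //; first by move=> x [].
  by apply: smooth_onS sG' => x [].
- split => [c [Ac A'c]|c [B'c Bc]|c t [Ac A'c] t0|c t [B'c Bc] t0] /=.
  + have [b1 b2] := FG' _ A'c; have [b3 b4] := FG _ Ac.
    by rewrite b2 b4; split => //; split => //=; rewrite /preimage /= b2.
  + have [b1 b2] := GF _ Bc; have [b3 b4] := GF' _ B'c.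
    by rewrite b2 b4; split => //; split => //=; rewrite /preimage /= b2.
  + have [b1 b2] := hF _ _ Ac t0; have [b3 b4] := hF' _ _ A'c t0.
    by rewrite b2 b4; split => //; split => //=; rewrite /preimage /= b2.
  + have [b1 b2] := hG' _ _ B'c t0; have [b3 b4] := hG _ _ Bc t0.
    by rewrite b2 b4; split => //; split => //=; rewrite /preimage /= b2.
- split => c cc; split => /=; first exact: cA.
  + by apply: cA'; have [] := cF _ cc.
  + exact: cB'.
  + by apply: cB; exact: cG'.
- move=> c cc; have [c1 e1 e2] := cF c cc; have [c2 e3 e4] := cF' _ c1.
  by split => // i /=; rewrite ?e3 ?e4 ?e1 ?e2.
- by move=> c /cG' /cG.
Qed.

Lemma mem_uniq4 (i j k l x : 'I_4) : uniq [:: i; j; k; l] -> x \in [:: i; j; k; l].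
Proof.
move=> U; apply/negPn/negP => xn.
have U5 : uniq [:: x; i; j; k; l] by rewrite cons_uniq xn.
by have := max_card (mem [:: x; i; j; k; l]); rewrite (card_uniqP U5) card_ord.
Qed.

Lemma cap4 (R : comRingType) (al : 'I_4 -> 'I_4 -> R) (c : 'rV[R]_4) (i j k l : 'I_4) :
  uniq [:: i; j; k; l] ->
  cap al i c = al i j * c 0 j + al i k * c 0 k + al i l * c 0 l - c 0 i.
Proof.
move=> U; rewrite /cap; congr (_ - _).
have := U; rewrite /= !inE !negb_or => /and4P[/and3P[ij ik il] /andP[jk jl] kl _].
rewrite (bigD1 j) 1?eq_sym //= (bigD1 k) /=; last by rewrite eq_sym ik eq_sym jk.
rewrite (bigD1 l) /=; last by rewrite eq_sym il eq_sym jl eq_sym kl.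
rewrite big_pred0 ?addr0 ?addrA // => x.
have := mem_uniq4 x U; rewrite !inE => /or4P[] /eqP ->; rewrite ?eqxx ?andbF //=.
Qed.

(* Taylor coefficients at [u = 0] of [(s + u) * (x + a u) * (y + b u) * (z + c u)]. *)
Definition tay1 (R : comRingType) (s x y z a b c : R) : R :=
  x * y * z + s * (a * y * z + b * x * z + c * x * y).
Definition tay2 (R : comRingType) (s x y z a b c : R) : R :=
  a * y * z + b * x * z + c * x * y + s * (a * b * z + a * c * y + b * c * x).
Definition tay3 (R : comRingType) (s x y z a b c : R) : R :=
  a * b * z + a * c * y + b * c * x + s * (a * b * c).

Lemma taylor4 (R : comRingType) (s x y z a b c u : R) :
  (s + u) * (x + a * u) * (y + b * u) * (z + c * u) =
  s * x * y * z + tay1 s x y z a b c * u + tay2 s x y z a b c * u ^+ 2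
  + tay3 s x y z a b c * u ^+ 3 + a * b * c * u ^+ 4.
Proof. by rewrite /tay1 /tay2 /tay3; ring. Qed.

Lemma derive_quartic (R : realType) (V : normedModType R) (f : V -> R) (x v : V)
    (k0 k1 k2 k3 k4 : R) :
  differentiable f x ->
  (forall t, f (x + t *: v) = k0 + k1 * t + k2 * t ^+ 2 + k3 * t ^+ 3 + k4 * t ^+ 4) ->
  'D_v f x = k1.
Proof.
move=> df H.
pose p : {poly R} := k0%:P + k1 *: 'X + k2 *: 'X^2 + k3 *: 'X^3 + k4 *: 'X^4.
have E : (fun t => f (x + t *: v)) = horner p.
  by apply/funext => t; rewrite H /p !hornerE.
have D : is_derive (0 : R) 1 (fun t => f (x + t *: v)) ('D_v f x).
  have := @is_derive_line R V R f x v 0; rewrite scale0r addr0; exact.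
have -> : 'D_v f x = 'D_1 (horner p) 0 by rewrite -E derive_val.
have D' := is_derive_poly p 0; rewrite derive_val.
by rewrite /p !poly.derivE !hornerE /=; ring.
Qed.

Definition upd (R : ringType) (i : 'I_4) (c : 'rV[R]_4) (t : R) : 'rV[R]_4 :=
  \row_m (if m == i then t else c 0 m).

Lemma cap_upd (R : comRingType) (al : 'I_4 -> 'I_4 -> R) i m c t :
  cap al m (upd i c t) =
  if m == i then cap al m c - (t - c 0 i) else cap al m c + al m i * (t - c 0 i).
Proof.
rewrite /cap mxE; case: eqVneq => [->|mi].
  rewrite (eq_bigr (fun j => al i j * c 0 j)); first by ring.
  by move=> j ji; rewrite mxE (negbTE ji).
rewrite (bigD1 i) 1?eq_sym //= [in RHS](bigD1 i) 1?eq_sym //= mxE eqxx.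
rewrite (eq_bigr (fun j => al m j * c 0 j)); first by ring.
by move=> j /andP[_ ji]; rewrite mxE (negbTE ji).
Qed.

Section ConeFacts.
Variables (R : realType) (al : 'I_4 -> 'I_4 -> R).
Hypothesis al1 : forall p q, p != q -> 1 < al p q.

Lemma cone_coord_gt0 c i : cone al c -> exists2 j, j != i & 0 < c 0 j.
Proof.
move=> [c0 cp ch]; apply: contrapT => H.
have z j : j != i -> c 0 j = 0.
  move=> ji; apply/eqP; rewrite eq_le cp andbT leNgt; apply/negP => h.
  by apply: H; exists j.
have := ch i; rewrite /cap big1 => [|j ji]; last by rewrite z // mulr0.
rewrite sub0r oppr_ge0 => ci; case/eqP: c0; apply/rowP => j; rewrite mxE.
have [->|ji] := eqVneq j i; first by apply/eqP; rewrite eq_le ci cp.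
exact: z.
Qed.

Lemma cone_sum_gt0 c i : cone al c -> 0 < cap al i c + c 0 i.
Proof.
move=> cc; have [j ji cj] := cone_coord_gt0 i cc; have [c0 cp ch] := cc.
rewrite /cap subrK (bigD1 j) //= ltr_pwDl //.
  by rewrite mulr_gt0 // (lt_trans ltr01) // al1 // eq_sym.
apply: sumr_ge0 => q /andP[qi _]; rewrite mulr_ge0 // ltW // (lt_trans ltr01) //.
by rewrite al1 // eq_sym.
Qed.

Lemma cap_ge_term c i j : cone al c -> j != i -> al i j * c 0 j - c 0 i <= cap al i c.
Proof.
move=> [c0 cp ch] ji; rewrite /cap (bigD1 j) //= lerD2r lerDl.
apply: sumr_ge0 => q /andP[qi _]; rewrite mulr_ge0 // ltW // (lt_trans ltr01) //.
by rewrite al1 // eq_sym.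
Qed.

(** Two triangular faces do not meet. If both caps vanished, [c 0 i] would be positive by
    [cone_sum_gt0], and [c 0 i < al j i * c 0 i <= c 0 j <= al i j * c 0 j <= c 0 i]. *)
Lemma cap_pair_gt0 c i j : cone al c -> j != i -> 0 < cap al j c + al j i * cap al i c.
Proof.
move=> cc ji; have [c0 cp ch] := cc.
have aji : 1 < al j i by exact: al1.
have aij : 1 < al i j by rewrite al1 // eq_sym.
have h1 := cap_ge_term cc ji.
have h2 : al j i * c 0 i - c 0 j <= cap al j c by apply: cap_ge_term; rewrite // eq_sym.
have cj := cp j; have ci := cp i; have wi := ch i; have wj := ch j.
have [wi0|wi0] := ltP 0 (cap al i c).
  by rewrite ltr_wpDl // mulr_gt0 // (lt_trans ltr01).
have {wi0} w0 : cap al i c = 0 by apply/eqP; rewrite eq_le wi0 wi.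
rewrite w0 mulr0 addr0 lt0r wj andbT; apply/eqP => wj0.
have s := cone_sum_gt0 i cc; rewrite w0 add0r in s.
rewrite w0 in h1; rewrite wj0 in h2.
have : c 0 i < al j i * c 0 i by rewrite ltr_pMl.
have : c 0 j <= al i j * c 0 j by rewrite ler_peMl // ltW.
lra.
Qed.

Lemma cap_two_gt0 c i j : cone al c -> j != i -> 0 < cap al i c \/ 0 < cap al j c.
Proof.
move=> cc ji; have [_ _ ch] := cc; have := cap_pair_gt0 cc ji.
have [h|h] := ltP 0 (cap al i c); first by left.
have -> : cap al i c = 0 by apply/eqP; rewrite eq_le h ch.
by rewrite mulr0 addr0; right.
Qed.

End ConeFacts.

Lemma Ck_on_cap (R : realType) (al : 'I_4 -> 'I_4 -> R) i k (U : set 'rV[R]_4) :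
  open U -> Ck_on k U (cap al i).
Proof.
move=> oU; rewrite /cap; apply: (Ck_onB oU _ (Ck_on_coord k i oU)).
apply: Ck_on_sum => // j _; apply: Ck_onM => //; first exact: Ck_on_cst.
exact: Ck_on_coord.
Qed.

Lemma open_gt0 (R : realType) (V : normedModType R) (f : V -> R) :
  Ck_on 0 setT f -> open [set x | 0 < f x].
Proof.
move=> cf; rewrite (_ : [set x | _] = setT `&` f @^-1` [set y | 0 < y]); last first.
  by apply/seteqP; split => x /= => [h|[]].
apply: open_preimage; [exact: openT|exact: open_gt|exact: cf].
Qed.

Ltac ck := do ![first [exact: Ck_on_cst | exact: Ck_on_coord | exact: Ck_on_cap
  | apply: Ck_onD => // | apply: Ck_onB => // | apply: Ck_onM => // | apply: Ck_onN => //]].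

(** * Angles and lengths of a hyperideal tetrahedron *)

Lemma sum3 (V : nmodType) (F : 'I_3 -> V) : \sum_i F i = F q0 + F q1 + F q2.
Proof.
rewrite !big_ord_recl big_ord0 addr0 !addrA.
by congr (F _ + F _ + F _); exact: val_inj.
Qed.

Lemma baryE (R : realType) (x : 'rV[R]_3) :
  [/\ bary x o0 = 1 - (x 0 q0 + x 0 q1 + x 0 q2), bary x o1 = x 0 q0,
      bary x o2 = x 0 q1 & bary x o3 = x 0 q2].
Proof.
have lE (j : 'I_3) v : v = lift ord0 j -> bary x v = x 0 j.
  by move=> ->; rewrite /bary liftK.
split; try by apply: lE; exact: val_inj.
have -> : o0 = ord0 by exact: val_inj.
by rewrite /bary unlift_none sum3.
Qed.

Lemma bary_std_vertex (R : realType) (a b v : 'I_4) : a != b ->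
  bary (std_vertex R a b) v = if v == a then 2 / 3 else if v == b then 1 / 3 else 0.
Proof.
have [e0 e1 e2 e3] := baryE (std_vertex R a b).
have L0 : lift ord0 q0 = o1 by exact: val_inj.
have L1 : lift ord0 q1 = o2 by exact: val_inj.
have L2 : lift ord0 q2 = o3 by exact: val_inj.
move: v; apply: forall4; rewrite ?e0 ?e1 ?e2 ?e3 !mxE ?L0 ?L1 ?L2 //.
move: a b {e0 e1 e2 e3}; by apply: forall4; apply: forall4 => //= _; field.
Qed.

Definition plane_vec (R : realType) (h : halfspace R) : 'rV[R]_4 :=
  \row_j nth 0 [:: normal h 0 q0; normal h 0 q1; normal h 0 q2; offset h] j.

Definition point_vec (R : realType) (x : 'rV[R]_3) : 'rV[R]_4 :=
  \row_j nth 0 [:: x 0 q0; x 0 q1; x 0 q2; 1] j.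

Lemma mink_plane_point (R : realType) (h : halfspace R) x :
  mink (plane_vec h) (point_vec x) = dotv (normal h) x - offset h.
Proof. by rewrite /mink /dotv sum3 !mxE /= mulr1. Qed.

Lemma mink_plane_plane (R : realType) (h h' : halfspace R) :
  mink (plane_vec h) (plane_vec h') = hs_form h h'.
Proof. by rewrite /mink /hs_form /dotv sum3 !mxE. Qed.

Lemma mink_point_point (R : realType) (x y : 'rV[R]_3) :
  mink (point_vec x) (point_vec y) = dotv x y - 1.
Proof. by rewrite /mink /dotv sum3 !mxE /= mulr1. Qed.

Lemma H3_mink_lt0 (R : realType) (x y : 'rV[R]_3) : H3 R x -> H3 R y ->
  mink (point_vec x) (point_vec y) < 0.
Proof.
rewrite /H3 /= mink_point_point /dotv !sum3 => hx hy.
have := sqr_ge0 (x 0 q0 - y 0 q0); have := sqr_ge0 (x 0 q1 - y 0 q1).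
have := sqr_ge0 (x 0 q2 - y 0 q2); rewrite !expr2; lra.
Qed.

Lemma acos_pi2 (R : realType) (z : R) : -1 <= z <= 1 -> acos z = pi / 2 -> z = 0.
Proof.
by move=> z1 az; rewrite -[LHS]acosK ?az ?cos_pihalf // in_itv /=.
Qed.

Lemma hyp_metric_cauchy (R : realType) (p u v : 'rV[R]_3) : H3 R p ->
  hyp_metric p u v ^+ 2 <= hyp_metric p u u * hyp_metric p v v.
Proof.
rewrite /H3 /= /hyp_metric /dotv !sum3.
move: (p 0 q0) (p 0 q1) (p 0 q2) (u 0 q0) (u 0 q1) (u 0 q2) (v 0 q0) (v 0 q1) (v 0 q2).
move=> x y z a b c d e f; set D := 1 - (_ + _) => hp.
have D0 : 0 < D by rewrite subr_gt0.
set pu := x * a + y * b + z * c; set pv := x * d + y * e + z * f.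
rewrite -subr_ge0 (_ : _ - _ =
  ((a * e - b * d) ^+ 2 + (a * f - c * d) ^+ 2 + (b * f - c * e) ^+ 2) / D ^+ 2
  + ((a * pv - d * pu) ^+ 2 + (b * pv - e * pu) ^+ 2 + (c * pv - f * pu) ^+ 2) / D ^+ 3).
  have D2 : 0 <= D ^+ 2 by rewrite exprn_ge0 // ltW.
  have D3 : 0 <= D ^+ 3 by rewrite exprn_ge0 // ltW.
  by rewrite addr_ge0 // divr_ge0 // !addr_ge0 ?sqr_ge0.
by move: D0; move: D pu pv => {hp} D pu pv D0; field; rewrite gt_eqF.
Qed.

Lemma hyp_metric_ge0 (R : realType) (p u : 'rV[R]_3) : H3 R p ->
  0 <= hyp_metric p u u.
Proof.
rewrite /H3 /= /hyp_metric /dotv !sum3 => hp.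
have D0 : 0 <= 1 - (p 0 q0 * p 0 q0 + p 0 q1 * p 0 q1 + p 0 q2 * p 0 q2).
  by rewrite subr_ge0 ltW.
have sq (w : R) : 0 <= w * w by rewrite -expr2 sqr_ge0.
by apply: addr_ge0; apply: divr_ge0; rewrite ?sqr_ge0 // !addr_ge0.
Qed.

Lemma hyp_angle_right (R : realType) (p q r : 'rV[R]_3) : H3 R p ->
  hyp_angle p q r = pi / 2 ->
  mink (point_vec q) (point_vec r) * mink (point_vec p) (point_vec p) =
  mink (point_vec q) (point_vec p) * mink (point_vec r) (point_vec p).
Proof.
move=> hp; rewrite /hyp_angle.
have C := hyp_metric_cauchy (q - p) (r - p) hp.
have Bu := hyp_metric_ge0 (q - p) hp; have Bv := hyp_metric_ge0 (r - p) hp.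
set u := hyp_metric p (q - p) (r - p) in C *.
set s := hyp_metric p (q - p) _ * _ in C *.
have s0 : 0 <= s by rewrite mulr_ge0.
(* A zero denominator would make the quotient 0 by convention; Cauchy's inequality then gives
   [u = 0] as well. It also puts the argument of [acos] in the interval where [acos] is
   injective. *)
have u0 : Num.sqrt s = 0 -> u = 0.
  move=> h; have s00 : s = 0 by rewrite -(sqr_sqrtr s0) h expr0n.
  by apply/eqP; rewrite -sqrf_eq0 eq_le sqr_ge0 andbT -s00.
have z1 : -1 <= u / Num.sqrt s <= 1.
  have [h|h] := eqVneq (Num.sqrt s) 0; first by rewrite h invr0 mulr0; lra.
  have h0 : 0 < Num.sqrt s by rewrite lt0r h sqrtr_ge0.
  rewrite -ler_norml normf_div (gtr0_norm h0) ler_pdivrMr // mul1r.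
  by rewrite -sqrtr_sqr ler_wsqrtr.
move=> /(acos_pi2 z1) /eqP; rewrite mulf_eq0 invr_eq0 => us.
have {us} : u = 0 by move: us => /orP[/eqP //|/eqP]; exact: u0.
rewrite /u /hyp_metric !mink_point_point /dotv !sum3 !mxE.
move: hp; rewrite /H3 /= /dotv !sum3.
set D := (X in X < 1) => hp.
have D0 : 1 - D != 0 by rewrite subr_eq0 gt_eqF.
move=> /(congr1 (fun w => - ((1 - D) ^+ 2 * w))); rewrite mulr0 oppr0.
rewrite -/D => E; apply/eqP; rewrite -subr_eq0; apply/eqP; rewrite -[RHS]E.
by rewrite /D in D0 *; field.
Qed.

Definition cosh (R : realType) (x : R) : R := (expR x + expR (- x)) / 2.

Lemma cosh_arcosh (R : realType) (t : R) : 1 <= t -> cosh (arcosh t) = t.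
Proof.
move=> t1; rewrite /cosh /arcosh.
have s0 : 0 <= Num.sqrt (t ^+ 2 - 1) by exact: sqrtr_ge0.
have s2 : Num.sqrt (t ^+ 2 - 1) ^+ 2 = t ^+ 2 - 1.
  by rewrite sqr_sqrtr // subr_ge0 exprn_ege1.
move: s0 s2; set s := Num.sqrt _ => s0 s2.
have ts : 0 < t + s by rewrite ltr_pwDl // (lt_le_trans ltr01).
rewrite expRN lnK ?posrE //.
have -> : (t + s)^-1 = t - s.
  by apply: (mulfI (lt0r_neq0 ts)); rewrite mulfV ?gt_eqF //; lra.
by field.
Qed.

Lemma hyp_distC (R : realType) (p q : 'rV[R]_3) : hyp_dist p q = hyp_dist q p.
Proof.
rewrite /hyp_dist [(1 - dotv p p) * _]mulrC; congr (arcosh ((1 - _) / _)).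
by rewrite /dotv !sum3; ring.
Qed.

Lemma hyp_distE (R : realType) (p q : 'rV[R]_3) :
  hyp_dist p q = arcosh (- mink (point_vec p) (point_vec q) /
    Num.sqrt (mink (point_vec p) (point_vec p) * mink (point_vec q) (point_vec q))).
Proof.
by rewrite !mink_point_point opprB -[X in Num.sqrt X]mulrNN !opprB.
Qed.

(** The marking is injective on the truncated tetrahedron and matches faces with faces. So a vertex
    lies on the plane of a face only if the corresponding standard vertex lies on the standard face,
    which makes the other inequalities strict. *)
Lemma hyperideal_config (R : realType) (P : tetrahedron R) : hyperideal P ->
  truncated_config (fun v => plane_vec (tri_side P v)) (fun c => plane_vec (hex_side P c))
    (fun a b => point_vec (tet_vertex P a b)).
Proof.
move=> [cP [U [V [tU VH [oU oV imU smU [g [smg gK]]]]]] imT faces right].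
have sT a b : a != b -> truncated_tetrahedron R (std_vertex R a b).
  move=> ab v; rewrite bary_std_vertex //; case: ifP => _; first by lra.
  by case: ifP => _; lra.
have inj a b y : a != b -> truncated_tetrahedron R y ->
    marking P y = tet_vertex P a b -> y = std_vertex R a b.
  move=> ab Ty my; rewrite -(gK _ (tU _ Ty)) my; apply: gK; exact/tU/sT.
have inP a b : a != b -> polyhedron P (tet_vertex P a b).
  by move=> ab; rewrite -imT; exists (std_vertex R a b) => //; exact: sT.
have inH a b : a != b -> H3 R (tet_vertex P a b) by move=> /inP[].
have Wle a b c : a != b ->
    mink (plane_vec (hex_side P c)) (point_vec (tet_vertex P a b)) <= 0.
  by move=> /inP[_ /(_ c)[h _]]; rewrite mink_plane_point subr_le0.
have Tle a b v : a != b ->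
    mink (plane_vec (tri_side P v)) (point_vec (tet_vertex P a b)) <= 0.
  by move=> /inP[_ /(_ v)[_ h]]; rewrite mink_plane_point subr_le0.
have W0 a b c : a != b ->
    mink (plane_vec (hex_side P c)) (point_vec (tet_vertex P a b)) = 0 ->
    bary (std_vertex R a b) c = 0.
  move=> ab; rewrite mink_plane_point => /eqP; rewrite subr_eq0 => /eqP h.
  have : (polyhedron P `&` hs_plane (hex_side P c)) (tet_vertex P a b).
    by split; [exact: inP|exact: h].
  by rewrite -(faces c).1 => -[y [Ty yc] /(inj _ _ _ ab Ty) <-].
have T0 a b v : a != b ->
    mink (plane_vec (tri_side P v)) (point_vec (tet_vertex P a b)) = 0 ->
    bary (std_vertex R a b) v = 2 / 3.
  move=> ab; rewrite mink_plane_point => /eqP; rewrite subr_eq0 => /eqP h.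
  have : (polyhedron P `&` hs_plane (tri_side P v)) (tet_vertex P a b).
    by split; [exact: inP|exact: h].
  by rewrite -(faces v).2 => -[y [Ty yc] /(inj _ _ _ ab Ty) <-].
have Wlt a b c : a != b -> (c == a) || (c == b) ->
    mink (plane_vec (hex_side P c)) (point_vec (tet_vertex P a b)) < 0.
  move=> ab cab; rewrite lt_neqAle Wle // andbT; apply/eqP => /(W0 _ _ _ ab).
  rewrite bary_std_vertex //; move: cab; case: eqP => [_ _|_ /= ->]; lra.
split.
- by move=> a b; rewrite mxE.
- by move=> a b a' b' ab ab'; apply: H3_mink_lt0; exact: inH.
- move=> a b c ab ca cb.
  have : (marking P @` std_hexagon R c) (tet_vertex P a b).
    exists (std_vertex R a b) => //; split; first exact: sT.
    by rewrite /= bary_std_vertex // (negbTE ca) (negbTE cb).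
  by rewrite (faces c).1 mink_plane_point => -[_ ->]; rewrite subrr.
- by move=> a b ab; apply: Wlt => //; rewrite eqxx.
- by move=> a b ab; apply: Wlt => //; rewrite eqxx orbT.
- move=> a b ab.
  have : (marking P @` std_triangle R a) (tet_vertex P a b).
    exists (std_vertex R a b) => //; split; first exact: sT.
    by rewrite /= bary_std_vertex // eqxx.
  by rewrite (faces a).2 mink_plane_point => -[_ ->]; rewrite subrr.
- move=> a b v ab va; rewrite lt_neqAle Tle // andbT; apply/eqP => /(T0 _ _ _ ab).
  by rewrite bary_std_vertex // (negbTE va); case: ifP => _; lra.
- move=> a b c d u; apply: hyp_angle_right; last exact: right u.
  by apply: inH; move: u; rewrite /= !inE !negb_or => /andP[/and3P[]].
Qed.

Theorem hyperideal_angles (R : realType) (P : tetrahedron R) : hyperideal P ->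
  let a i j := cosh (edge_length P i j) in
  [/\ forall i j, i != j -> 1 < a i j,
      0 < gdel (a o0 o1) (a o0 o2) (a o0 o3) (a o1 o2) (a o1 o3) (a o2 o3) &
      forall c d, let H := gram_inv (a o0 o1) (a o0 o2) (a o0 o3) (a o1 o2) (a o1 o3) (a o2 o3) in
        dihedral_angle P c d = acos (- H c d / Num.sqrt (H c c * H d d))].
Proof.
move=> hP a; have cfg := hyperideal_config hP.
pose X i j := point_vec (tet_vertex P i j).
have key i j : i != j ->
    1 < - mink (X i j) (X j i) / Num.sqrt (mink (X i j) (X i j) * mink (X j i) (X j i)).
  move=> ij; have [_ [_ [_ _ pqr _ _]]] := cfg_edge cfg ij.
  have p0 : mink (X i j) (X i j) < 0 by exact: (cfg_neg cfg).
  have q0 : mink (X j i) (X j i) < 0 by apply: (cfg_neg cfg); rewrite eq_sym.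
  have r0 : mink (X i j) (X j i) < 0 by apply: (cfg_neg cfg); rewrite // eq_sym.
  have pq0 : 0 < mink (X i j) (X i j) * mink (X j i) (X j i) by rewrite nmulr_rgt0.
  rewrite ltr_pdivlMr ?sqrtr_gt0 // mul1r -[ltRHS]gtr0_norm ?oppr_gt0 //.
  by rewrite normrN -sqrtr_sqr ltr_sqrt // (lt_trans pq0).
have aE i j : i != j ->
    a i j = - mink (X i j) (X j i) / Num.sqrt (mink (X i j) (X i j) * mink (X j i) (X j i)).
  by move=> ij; rewrite /a /edge_length hyp_distE cosh_arcosh // ltW // key.
have asym i j : a i j = a j i by rewrite /a /edge_length hyp_distC.
have [D0 [nu nu0 WW]] := cfg_gram cfg asym aE.
split => // [i j ij|c d H]; first by rewrite aE // key.
have nn i j : 0 < nu i * nu j by rewrite nmulr_rgt0.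
rewrite /dihedral_angle /interior_angle -!mink_plane_plane !WW -/H.
congr acos; rewrite (_ : _ * _ * H c c * _ = (nu c * nu d) ^+ 2 * (H c c * H d d)); last by ring.
rewrite sqrtrM ?sqr_ge0 // sqrtr_sqr gtr0_norm // -mulrN -mulf_div divff ?mul1r //.
by rewrite gt_eqF.
Qed.

(** * Equivalence of the cones with coefficients greater than 1 *)

Lemma sum3_mul_gt0 (R : realDomainType) (u v t A B C : R) :
  0 <= u -> 0 <= v -> 0 <= t -> 0 < u \/ 0 < v \/ 0 < t ->
  0 < A -> 0 < B -> 0 < C -> 0 < A * u + B * v + C * t.
Proof.
move=> u0 v0 t0 H A0 B0 C0.
have h1 := mulr_ge0 (ltW A0) u0; have h2 := mulr_ge0 (ltW B0) v0.
have h3 := mulr_ge0 (ltW C0) t0.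
by case: H => [h|[h|h]]; [have := mulr_gt0 A0 h|have := mulr_gt0 B0 h|have := mulr_gt0 C0 h]; lra.
Qed.

(* Only the [i]-th coordinate moves: [c 0 i] is sent to [c 0 i + e c * P c], where
   [P] is the product of [c 0 i] and of the other three [cap]s, so that these four
   functions keep their zeros. The factor [e c] depends only on the other three
   coordinates and is such that the end [cap al i c = 0] of the line in direction
   [i] is sent to the end [cap al' i c = 0]. Along this line the map is a quartic
   polynomial, increasing beyond [c 0 i] as soon as its Taylor coefficients there
   are positive, which defines the neighborhood [Om] of the cone. *)
Lemma row_expansion (R : realType) (al al' : 'I_4 -> 'I_4 -> R) (i : 'I_4) :
  (forall p q, p != q -> 1 < al p q) ->
  (forall q, q != i -> al i q < al' i q) ->
  (forall p q, p != i -> al' p q = al p q) -> cone_equiv al al'.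
Proof.
move=> al1 alr alo.
have al1' p q : p != q -> 1 < al' p q.
  move=> pq; have [pi|pi] := eqVneq p i; last by rewrite alo // al1.
  by rewrite pi in pq *; rewrite (lt_trans (al1 _ _ pq)) // alr // eq_sym.
have [j ij] : exists j, i != j.
  by move: i {alr alo}; apply: forall4; [exists o1|exists o0|exists o0|exists o0].
have [k [l U]] := ord4_complement_ab ij.
have := U; rewrite /= !inE !negb_or => /and4P[/and3P[_ ik il] /andP[jk jl] kl _].
have [ji ki li] : [/\ j != i, k != i & l != i] by split; rewrite eq_sym.
have [kj lj lk] : [/\ k != j, l != j & l != k] by split; rewrite eq_sym.
have capo m c : m != i -> cap al' m c = cap al m c.
  by move=> mi; rewrite /cap; congr (_ - _); apply: eq_bigr => q _; rewrite alo.
pose w := cap al i; pose w' := cap al' i.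
pose a := al j i; pose b := al k i; pose g := al l i.
pose x := cap al j; pose y := cap al k; pose z := cap al l.
have [a0 b0 g0] : [/\ 0 < a, 0 < b & 0 < g].
  by split; rewrite (lt_trans ltr01) // al1.
(* [Y c] is the value of [P] at the end [cap al i = 0] of the line, reached by adding [w c] to the
   coordinate [i]. As [D c] is the distance from this end to the one for [al'], adding [D / Y] times
   [P] moves the first onto the second. *)
pose Y (c : 'rV[R]_4) := (c 0 i + w c) * (x c + a * w c) * (y c + b * w c) * (z c + g * w c).
pose p1 (c : 'rV[R]_4) := tay1 (c 0 i) (x c) (y c) (z c) a b g.
pose p2 (c : 'rV[R]_4) := tay2 (c 0 i) (x c) (y c) (z c) a b g.
pose p3 (c : 'rV[R]_4) := tay3 (c 0 i) (x c) (y c) (z c) a b g.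
pose D (c : 'rV[R]_4) := w' c - w c.
pose e c := D c / Y c.
pose P (c : 'rV[R]_4) := c 0 i * x c * y c * z c.
pose Fi (c : 'rV[R]_4) := c 0 i + e c * P c.
pose F c := upd i c (Fi c).
(* The last condition is [0 < 1 + e c * p1 c] with the denominator [Y c] cleared: it concerns the
   linear coefficient of the quartic in [FiE]. *)
pose Om : set 'rV[R]_4 := [set c | [/\ 0 < Y c, 0 < D c, 0 < p2 c, 0 < p3 c &
    0 < Y c + D c * p1 c]].
have capE m c t : m != i -> cap al m (upd i c t) = cap al m c + al m i * (t - c 0 i).
  by move=> mi; rewrite cap_upd (negbTE mi).
have updi (c : 'rV[R]_4) t : (upd i c t) 0 i = t by rewrite mxE eqxx.
have updo (c : 'rV[R]_4) t m : m != i -> (upd i c t) 0 m = c 0 m by move=> mi;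
    rewrite mxE (negbTE mi).
have wE c t : w (upd i c t) = w c - (t - c 0 i) by rewrite /w cap_upd eqxx.
have w'E c t : w' (upd i c t) = w' c - (t - c 0 i) by rewrite /w' cap_upd eqxx.
have xE c t : x (upd i c t) = x c + a * (t - c 0 i) by rewrite /x capE.
have yE c t : y (upd i c t) = y c + b * (t - c 0 i) by rewrite /y capE.
have zE c t : z (upd i c t) = z c + g * (t - c 0 i) by rewrite /z capE.
have YE c t : Y (upd i c t) = Y c.
  by rewrite /Y wE xE yE zE updi; ring.
have DE c t : D (upd i c t) = D c by rewrite /D wE w'E; ring.
have eE c t : e (upd i c t) = e c by rewrite /e YE DE.
have PE c u : P (upd i c (c 0 i + u)) =
    P c + p1 c * u + p2 c * u ^+ 2 + p3 c * u ^+ 3 + a * b * g * u ^+ 4.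
  have uu : c 0 i + u - c 0 i = u by ring.
  by rewrite /P xE yE zE updi uu taylor4.
have YP c : Y c = P c + p1 c * w c + p2 c * w c ^+ 2 + p3 c * w c ^+ 3 + a * b * g * w c ^+ 4.
  by rewrite /Y taylor4.
have abg : 0 < a * b * g by rewrite !mulr_gt0.
have ep1 c : Om c -> 0 < 1 + e c * p1 c.
  move=> [Y0 _ _ _ h]; rewrite (_ : _ + _ = (Y c + D c * p1 c) / Y c) ?divr_gt0 //.
  by rewrite /e; field; rewrite gt_eqF.
have e0 c : Om c -> 0 < e c by move=> [Y0 D0 _ _ _]; rewrite divr_gt0.
have updK (c : 'rV[R]_4) : upd i c (c 0 i) = c.
  by apply/rowP => m; rewrite mxE; case: eqVneq => // ->.
have FiE c u : Fi (upd i c (c 0 i + u)) = Fi c + (1 + e c * p1 c) * u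
    + e c * p2 c * u ^+ 2 + e c * p3 c * u ^+ 3 + e c * (a * b * g) * u ^+ 4.
  by rewrite /Fi eE PE updi; ring.
have ckP kk V' (oV : open V') : [/\ Ck_on kk V' Y, Ck_on kk V' D, Ck_on kk V' p2,
    Ck_on kk V' p3 & Ck_on kk V' p1].
  by split; rewrite /Y /D /p1 /p2 /p3 /tay1 /tay2 /tay3 /w /w' /x /y /z; ck.
have [cY cD cp2 cp3 cp1] := ckP 0%N setT openT.
have oOm : open Om.
  rewrite (_ : Om = [set c | 0 < Y c] `&` [set c | 0 < D c] `&` [set c | 0 < p2 c]
     `&` [set c | 0 < p3 c] `&` [set c | 0 < Y c + D c * p1 c]); last first.
    by apply/seteqP; split => c; [case|move=> [[[[]]]]].
  do ?[apply: openI]; try exact: open_gt0.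
  by apply: open_gt0; apply: Ck_onD => //; [exact: openT|apply: Ck_onM => //; exact: openT].
have sFi kk : Ck_on kk Om Fi.
  have [kY kD _ _ _] := ckP kk _ oOm.
  apply: Ck_onD => //; first exact: Ck_on_coord.
  apply: Ck_onM => //; last by rewrite /P /x /y /z; ck.
  apply: Ck_onM => //; apply: Ck_onV => // c [Y0 _ _ _ _]; exact: lt0r_neq0.
have sF : smooth_on Om F.
  move=> kk; apply: Ck_on_row => // m; have [->|mi] := eqVneq m i.
    by apply: eq_Ck_on (sFi kk) => // c _; rewrite updi.
  by apply: eq_Ck_on (Ck_on_coord kk m oOm) => // c _; rewrite updo.
have injF c c' : Om c -> Om c' -> F c = F c' -> c = c'.
  wlog cc' : c c' / c 0 i <= c' 0 i => [W|] Oc Oc' FF.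
    have [h|/ltW h] := leP (c 0 i) (c' 0 i); first exact: W.
    by apply/esym; apply: W.
  have co m : m != i -> c 0 m = c' 0 m.
    move=> mi; have : F c 0 m = F c' 0 m by rewrite FF.
    by rewrite /F !updo.
  pose u := c' 0 i - c 0 i.
  have c'E : c' = upd i c (c 0 i + u).
    apply/rowP => m; rewrite mxE; case: eqVneq => [->|mi]; last by rewrite co.
    by rewrite /u addrC subrK.
  have u0 : 0 <= u by rewrite subr_ge0.
  have : F c' 0 i = F c 0 i by rewrite FF.
  rewrite /F !updi => EQ; move: EQ.
  rewrite c'E FiE; have := ep1 _ Oc; have := e0 _ Oc; have [_ _ p20 p30 _] := Oc.
  move=> ec ee EE.
  have h2 : 0 <= e c * p2 c * u ^+ 2.
    exact: (mulr_ge0 (mulr_ge0 (ltW ec) (ltW p20)) (exprn_ge0 _ u0)).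
  have h3 : 0 <= e c * p3 c * u ^+ 3.
    exact: (mulr_ge0 (mulr_ge0 (ltW ec) (ltW p30)) (exprn_ge0 _ u0)).
  have h4 : 0 <= e c * (a * b * g) * u ^+ 4.
    exact: (mulr_ge0 (mulr_ge0 (ltW ec) (ltW abg)) (exprn_ge0 _ u0)).
  have h1 : (1 + e c * p1 c) * u <= 0 by move: EE h2 h3 h4; lra.
  have uz : u = 0 by apply/eqP; rewrite eq_le u0 andbT -(pmulr_rle0 _ ee).
  by rewrite uz addr0 updK.
have derF c v : Om c -> 'D_v F c = 0 -> v = 0.
  move=> Oc Dv; have dF : differentiable F c by have [+ _] := sF 1%N; exact.
  have vo m : m != i -> v 0 m = 0.
    move=> mi; have := derive_entry v m dF; rewrite Dv mxE => <-.
    rewrite (_ : (fun y0 => _) = (fun d : 'rV[R]_4 => d 0 m)); last first.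
      by apply/funext => d; rewrite /F updo.
    by rewrite (derive_entry (f := id)) // derive_id.
  have vE t : c + t *: v = upd i c (c 0 i + t * v 0 i).
    apply/rowP => m; rewrite !mxE; case: eqVneq => [->//|mi].
    by rewrite vo // mulr0 addr0.
  have := derive_entry v i dF; rewrite Dv mxE.
  rewrite (@derive_quartic R _ (fun y0 => F y0 0 i) c v (Fi c) ((1 + e c * p1 c) * v 0 i)
     (e c * p2 c * v 0 i ^+ 2) (e c * p3 c * v 0 i ^+ 3) (e c * (a * b * g) * v 0 i ^+ 4)).
  - move=> /eqP; rewrite mulf_eq0 gt_eqF ?ep1 //= => /eqP vi.
    by apply/rowP => m; rewrite mxE; have [->|/vo] := eqVneq m i.
  - exact: differentiable_entry.
  - by move=> t; rewrite /F updi vE FiE; ring.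
have [_ oB _ _ [G [sG GF]]] := diffeomorphism_of_injective oOm sF injF derF.
have jW c : w c = al i j * c 0 j + al i k * c 0 k + al i l * c 0 l - c 0 i.
  exact: cap4.
have jX c : x c = a * c 0 i + al j k * c 0 k + al j l * c 0 l - c 0 j.
  by apply: cap4; exact: uniq4_swap.
have jY c : y c = b * c 0 i + al k j * c 0 j + al k l * c 0 l - c 0 k.
  by apply: cap4; rewrite /= !inE !negb_or ki kj kl ij il jl.
have jZ c : z c = g * c 0 i + al l j * c 0 j + al l k * c 0 k - c 0 l.
  by apply: cap4; rewrite /= !inE !negb_or li lj lk ij ik jk.
have alp p q : p != q -> 0 < al p q by move=> pq; rewrite (lt_trans ltr01) // al1.
have base (c : 'rV[R]_4) : (forall q, q != i -> 0 <= c 0 q) -> (exists2 q, q != i & 0 < c 0 q) ->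
    0 < Y c /\ 0 < D c /\ [/\ 0 < c 0 i + w c, 0 < x c + a * w c, 0 < y c + b * w c &
        0 < z c + g * w c].
  move=> cp [q qi cq].
  have H : 0 < c 0 j \/ 0 < c 0 k \/ 0 < c 0 l.
    have := mem_uniq4 q U; rewrite !inE (negbTE qi) /=.
    by case/or3P=> /eqP E; rewrite -?E; [left|right; left|right; right].
  have [cj ck cl] : [/\ 0 <= c 0 j, 0 <= c 0 k & 0 <= c 0 l] by split; exact: cp.
  have gt1 p r : p != r -> 0 < al p r * al r p - 1.
    by move=> pr; rewrite subr_gt0 mulr_egt1 // al1 // eq_sym.
  have s0 : 0 < c 0 i + w c.
    have -> : c 0 i + w c = al i j * c 0 j + al i k * c 0 k + al i l * c 0 l by rewrite jW; ring.
    by apply: sum3_mul_gt0 => //; exact: alp.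
  have x0 : 0 < x c + a * w c.
    have -> : x c + a * w c = (al j i * al i j - 1) * c 0 j + (al j k + al j i * al i k) * c 0 k
      + (al j l + al j i * al i l) * c 0 l by rewrite jX jW /a; ring.
    by apply: sum3_mul_gt0 => //; rewrite ?gt1 // addr_gt0 ?mulr_gt0 ?alp.
  have y0 : 0 < y c + b * w c.
    have -> : y c + b * w c = (al k j + al k i * al i j) * c 0 j + (al k i * al i k - 1) * c 0 k
      + (al k l + al k i * al i l) * c 0 l by rewrite jY jW /b; ring.
    by apply: sum3_mul_gt0 => //; rewrite ?gt1 // addr_gt0 ?mulr_gt0 ?alp.
  have z0 : 0 < z c + g * w c.
    have -> : z c + g * w c = (al l j + al l i * al i j) * c 0 j + (al l k + al l i * al i k)
        * c 0 k
      + (al l i * al i l - 1) * c 0 l by rewrite jZ jW /g; ring.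
    by apply: sum3_mul_gt0 => //; rewrite ?gt1 // addr_gt0 ?mulr_gt0 ?alp.
  split; first by rewrite !mulr_gt0.
  split => //.
  have -> : D c = (al' i j - al i j) * c 0 j + (al' i k - al i k) * c 0 k
    + (al' i l - al i l) * c 0 l by rewrite /D jW /w' (cap4 al' c U); ring.
  by apply: sum3_mul_gt0 => //; rewrite subr_gt0 alr.
have coneOm c : cone al c -> Om c /\ 0 <= p1 c.
  move=> cc; have [c0 cp ch] := cc.
  have [Y0 [D0 _]] : 0 < Y c /\ 0 < D c /\ _ := base c (fun q _ => cp q) (cone_coord_gt0 i cc).
  have ci := cp i; have xp : 0 <= x c := ch j; have yp : 0 <= y c := ch k.
  have zp : 0 <= z c := ch l.
  have xy : 0 < x c \/ 0 < y c by exact: cap_two_gt0.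
  have xz : 0 < x c \/ 0 < z c by exact: cap_two_gt0.
  have yz : 0 < y c \/ 0 < z c by exact: cap_two_gt0.
  have p10 : 0 <= p1 c.
    by rewrite /p1 /tay1 addr_ge0 ?mulr_ge0 // !addr_ge0 // !mulr_ge0 // ltW.
  have pr : 0 < y c * z c \/ 0 < x c * z c \/ 0 < x c * y c.
    case: xy => [x0|y0]; last first.
      by case: xz => [x0|z0]; [right; right; rewrite mulr_gt0|left; rewrite mulr_gt0].
    by case: yz => [y0|z0]; [right; right; rewrite mulr_gt0|right; left; rewrite mulr_gt0].
  have p20 : 0 < p2 c.
    rewrite /p2 /tay2 ltr_wpDr //.
      by rewrite mulr_ge0 // !addr_ge0 // !mulr_ge0 // ltW.
    by rewrite -!(mulrA _ (_ c)); apply: sum3_mul_gt0 => //; rewrite mulr_ge0.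
  have p30 : 0 < p3 c.
    rewrite /p3 /tay3 ltr_wpDr //.
      by rewrite mulr_ge0 // !mulr_ge0 // ltW.
    have -> : a * b * z c + a * g * y c + b * g * x c = b * g * x c + a * g * y c + a * b * z c.
      by ring.
    apply: sum3_mul_gt0 => //; rewrite ?mulr_gt0 //.
    by case: xy => h; [left|right; left].
  split => //; split => //.
  by rewrite ltr_pwDl // mulr_ge0 // ltW.
have FE c : F c 0 i = c 0 i * (1 + e c * (x c * y c * z c)).
  by rewrite /F updi /Fi /P; ring.
have capF c m : m != i -> cap al' m (F c) = cap al m c + al m i * (e c * P c).
  move=> mi; rewrite capo // /F capE // /Fi; congr (_ + _ * _); ring.
have capFi c : Om c -> cap al' i (F c) =
    w c * (1 + e c * (p1 c + p2 c * w c + p3 c * w c ^+ 2 + a * b * g * w c ^+ 3)).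
  move=> [Y0 _ _ _ _]; rewrite -/w' /F w'E /Fi.
  have -> : w' c = w c + e c * Y c by rewrite /e divfK ?gt_eqF // /D; ring.
  by rewrite YP; ring.
have coneF c : cone al c -> [/\ cone al' (F c),
    forall m, (F c 0 m == 0) = (c 0 m == 0) &
    forall m, (cap al' m (F c) == 0) = (cap al m c == 0)].
  move=> cc; have [Oc p10] := coneOm c cc; have [c0 cp ch] := cc.
  have ec := e0 _ Oc; have [_ _ p20 p30 _] := Oc.
  have ci := cp i; have xp : 0 <= x c := ch j; have yp : 0 <= y c := ch k.
  have zp : 0 <= z c := ch l; have wp : 0 <= w c := ch i.
  have f1 : 0 < 1 + e c * (x c * y c * z c).
    by rewrite ltr_pwDl // mulr_ge0 ?(ltW ec) // !mulr_ge0.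
  have f2 : 0 < 1 + e c * (p1 c + p2 c * w c + p3 c * w c ^+ 2 + a * b * g * w c ^+ 3).
    rewrite ltr_pwDl // mulr_ge0 ?(ltW ec) //.
    have h2 := mulr_ge0 (ltW p20) wp; have h3 := mulr_ge0 (ltW p30) (exprn_ge0 2 wp).
    have h4 := mulr_ge0 (ltW abg) (exprn_ge0 3 wp).
    exact: (addr_ge0 (addr_ge0 (addr_ge0 p10 h2) h3) h4).
  have fm m (X : R) : 0 <= X -> m != i -> 0 < 1 + al m i * e c * c 0 i * X.
    move=> X0 mi; apply: ltr_pwDl => //; have am := alp m i mi.
    exact: (mulr_ge0 (mulr_ge0 (mulr_ge0 (ltW am) (ltW ec)) ci) X0).
  have capm m : m != i -> exists2 f : R, 0 < f & cap al' m (F c) = cap al m c * f.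
    move=> mi; have := mem_uniq4 m U; rewrite !inE (negbTE mi) /= => /or3P[] /eqP ->.
    - exists (1 + al j i * e c * c 0 i * (y c * z c)); first by apply: fm => //; exact: mulr_ge0.
      by rewrite capF // /P -/x; ring.
    - exists (1 + al k i * e c * c 0 i * (x c * z c)); first by apply: fm => //; exact: mulr_ge0.
      by rewrite capF // /P -/y; ring.
    - exists (1 + al l i * e c * c 0 i * (x c * y c)); first by apply: fm => //; exact: mulr_ge0.
      by rewrite capF // /P -/z; ring.
  have z1 m : (F c 0 m == 0) = (c 0 m == 0).
    have [->|mi] := eqVneq m i; last by rewrite /F updo.
    by rewrite FE mulf_eq0 (gt_eqF f1) orbF.
  split => //; last first.
    move=> m; have [->|mi] := eqVneq m i.
      by rewrite capFi // mulf_eq0 (gt_eqF f2) orbF.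
    by have [f f0 ->] := capm m mi; rewrite mulf_eq0 (gt_eqF f0) orbF.
  split.
  - apply: contraNneq c0 => F0; apply/eqP/rowP => m; rewrite mxE; apply/eqP.
    by rewrite -z1 F0 mxE.
  - move=> m; have [->|mi] := eqVneq m i; last by rewrite /F updo.
    by rewrite FE mulr_ge0 // ltW.
  - move=> m; have [->|mi] := eqVneq m i.
      by rewrite capFi // mulr_ge0 // ltW.
    by have [f f0 ->] := capm m mi; rewrite mulr_ge0 // ltW.
have hom (c : 'rV[R]_4) t : Om c -> 0 < t -> Om (t *: c) /\ F (t *: c) = t *: F c.
  move=> [Y0 D0 p20 p30 p10] t0.
  have YZ : Y (t *: c) = t ^+ 4 * Y c by rewrite /Y /w /x /y /z !capZ mxE; ring.
  have DZ : D (t *: c) = t * D c by rewrite /D /w /w' !capZ; ring.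
  have p1Z : p1 (t *: c) = t ^+ 3 * p1 c by rewrite /p1 /tay1 /x /y /z !capZ mxE; ring.
  have p2Z : p2 (t *: c) = t ^+ 2 * p2 c by rewrite /p2 /tay2 /x /y /z !capZ mxE; ring.
  have p3Z : p3 (t *: c) = t * p3 c by rewrite /p3 /tay3 /x /y /z !capZ mxE; ring.
  split.
    split; rewrite ?YZ ?DZ ?p1Z ?p2Z ?p3Z; try by apply: mulr_gt0 => //; exact: exprn_gt0.
    have -> : t ^+ 4 * Y c + t * D c * (t ^+ 3 * p1 c) = t ^+ 4 * (Y c + D c * p1 c) by ring.
    by apply: mulr_gt0 => //; exact: exprn_gt0.
  apply/rowP => m; rewrite [RHS]mxE; have [->|mi] := eqVneq m i; last by rewrite /F !updo // mxE.
  rewrite /F !updi /Fi /e YZ DZ /P /x /y /z !capZ mxE; field.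
  by rewrite !gt_eqF.
have surjF d : cone al' d -> exists2 c, cone al c & F c = d.
  move=> cd; have [d0 dp dh] := cd.
  have [Y0 [D0 [s0p xp yp zp]]] := base d (fun q _ => dp q) (cone_coord_gt0 i cd).
  have x0 : 0 <= x d by rewrite /x -capo.
  have y0 : 0 <= y d by rewrite /y -capo.
  have z0 : 0 <= z d by rewrite /z -capo.
  have w0 : 0 <= w' d := dh i; have di := dp i.
  (* The preimage is sought on the line through [d] in direction [i]. At [s0], where [cap al i]
     vanishes, the image has coordinate [d 0 i + w' d >= d 0 i]. At [lo], the largest of the zeros
     of the four factors of [P], the coordinate is fixed and at most [d 0 i]. Between the two, the
     factors and [cap al i] are nonnegative, so the root given by the intermediate value theorem
     lies in the cone. *)
  pose s0 := d 0 i + w d.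
  pose r1 := d 0 i - x d / a; pose r2 := d 0 i - y d / b; pose r3 := d 0 i - z d / g.
  pose lo := Num.max (Num.max 0 r1) (Num.max r2 r3).
  pose p : {poly R} := 'X + e d *: ('X * ((x d)%:P + a *: ('X - (d 0 i)%:P))
    * ((y d)%:P + b *: ('X - (d 0 i)%:P)) * ((z d)%:P + g *: ('X - (d 0 i)%:P))) - (d 0 i)%:P.
  have pE s : p.[s] = s + e d * (s * (x d + a * (s - d 0 i)) * (y d + b * (s - d 0 i))
      * (z d + g * (s - d 0 i))) - d 0 i by rewrite /p !hornerE.
  have rE (u v : R) : 0 < u -> v + u * (d 0 i - v / u - d 0 i) = 0.
    by move=> u0; field; rewrite gt_eqF.
  have rle (u v s : R) : 0 < u -> (d 0 i - v / u <= s) = (0 <= v + u * (s - d 0 i)).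
    move=> u0; rewrite lerBlDr -lerBlDl -(ler_pM2l u0) [u * (v / u)]mulrC divfK ?gt_eqF //.
    by rewrite -subr_ge0; congr (_ <= _); ring.
  have los0 : lo <= s0.
    rewrite !ge_max (ltW s0p) !rle //= /s0.
    have -> : d 0 i + w d - d 0 i = w d by ring.
    by rewrite !ltW.
  have lod : lo <= d 0 i.
    by rewrite !ge_max di !rle //= subrr !mulr0 !addr0 x0 y0 z0.
  have plo : p.[lo] <= 0.
    rewrite pE; set q := _ * _ * _ * _.
    suff -> : q = 0 by rewrite mulr0 addr0 subr_le0.
    have : [\/ lo = 0, lo = r1, lo = r2 | lo = r3].
      have mx (u v : R) : Num.max u v = u \/ Num.max u v = v.
        by rewrite maxEle; case: ifP; [right|left].
      rewrite /lo; case: (mx (Num.max 0 r1) (Num.max r2 r3)) => ->.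
        by case: (mx 0 r1) => ->; [apply: Or41|apply: Or42].
      by case: (mx r2 r3) => ->; [apply: Or43|apply: Or44].
    by rewrite /q => -[] ->; rewrite ?rE // ?(mul0r, mulr0).
  have ps0 : 0 <= p.[s0].
    rewrite pE /s0.
    have -> : d 0 i + w d - d 0 i = w d by ring.
    rewrite -/(Y d) /e divfK ?gt_eqF // /D.
    have -> : d 0 i + w d + (w' d - w d) - d 0 i = w' d by ring.
    exact: w0.
  have [|s /andP[ls ss] /rootP] := @poly_ivt _ p lo s0 los0; first by rewrite plo.
  rewrite pE => ps.
  exists (upd i d s); last first.
    rewrite /F; have -> : Fi (upd i d s) = d 0 i.
      by rewrite /Fi eE /P updi xE yE zE; apply/eqP; rewrite -subr_eq0 ps.
    by apply/rowP => m; rewrite !mxE; case: eqVneq => // ->.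
  move: ls; rewrite !ge_max !rle // => /andP[/andP[sge h1] /andP[h2 h3]].
  split.
  - have [q qi dq] := cone_coord_gt0 i cd; apply/eqP => E.
    by move: dq; rewrite -(updo d s q qi) E mxE ltxx.
  - by move=> m; have [->|mi] := eqVneq m i; rewrite ?updi // updo.
  - move=> m; have := mem_uniq4 m U; rewrite !inE => /or4P[] /eqP ->.
    + by rewrite -/w wE subr_ge0 lerBlDr addrC.
    + by rewrite -/x xE.
    + by rewrite -/y yE.
    + by rewrite -/z zE.
exists Om, (F @` Om), F, G; split => //.
- split => [c Oc|d [c Oc <-{d}]|c t Oc t0|d t [c Oc <-{d}] t0].
  + by split; [exists c|exact: GF].
  + by rewrite GF.
  + exact: hom.
  + have [Ot Ft] := hom _ _ Oc t0; rewrite -Ft !GF //.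
- split=> [c /coneOm[]//|d /surjF[c /coneOm[Oc _] <-]]; by exists c.
- by move=> d /surjF[c cc <-]; rewrite GF //; have [] := coneOm _ cc.
Qed.

Lemma cone_expansion (R : realType) (al be : 'I_4 -> 'I_4 -> R) :
  (forall p q, p != q -> 1 < al p q) -> (forall p q, p != q -> al p q < be p q) ->
  cone_equiv al be.
Proof.
move=> al1 ab.
pose ga n (p q : 'I_4) := if (p < n)%N then be p q else al p q.
have ga1 n p q : p != q -> 1 < ga n p q.
  by move=> pq; rewrite /ga; case: ifP => _; rewrite ?al1 // (lt_trans (al1 _ _ pq)) // ab.
have step n : (n < 4)%N -> cone_equiv (ga n) (ga n.+1).
  move=> n4; apply: (@row_expansion _ _ _ (Ordinal n4)) => //.
  - exact: ga1.
  - move=> q qn; rewrite /ga.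
    have -> : (Ordinal n4 < n)%N = false by exact: ltnn.
    have -> : (Ordinal n4 < n.+1)%N = true by exact: ltnSn.
    by rewrite ab // eq_sym.
  - move=> p q pn; rewrite /ga ltnS leq_eqVlt.
    by have /negbTE -> : nat_of_ord p != n by apply: contra pn => /eqP pn; apply/eqP/val_inj.
have -> : al = ga 0%N by [].
have -> : be = ga 4%N by apply/funext => p; apply/funext => q; rewrite /ga ltn_ord.
apply: (cone_equiv_trans (step 0%N isT)); apply: (cone_equiv_trans (step 1%N isT)).
exact: (cone_equiv_trans (step 2%N isT) (step 3%N isT)).
Qed.

(** [al] and [be] need not be comparable, but both lie below their sum. *)
Lemma cone_equiv_of_gt1 (R : realType) (al be : 'I_4 -> 'I_4 -> R) :
  (forall p q, p != q -> 1 < al p q) -> (forall p q, p != q -> 1 < be p q) ->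
  cone_equiv al be.
Proof.
move=> al1 be1; pose ga p q := al p q + be p q.
apply: (@cone_equiv_trans _ _ ga); first by apply: cone_expansion => // p q pq;
  rewrite ltrDl (lt_trans ltr01) // be1.
apply: cone_equiv_sym; apply: cone_expansion => // p q pq.
by rewrite ltrDr (lt_trans ltr01) // al1.
Qed.

(** * Construction of hyperideal tetrahedra *)

(** Gram-Schmidt orthogonalization: the first two rows span the plane of the coordinates 0 and 3.
    The leading principal minors of the Gram matrix of orders 2, 3, 4 are the opposites of
    [a01 ^+ 2 - 1], [kap a01 a02 a12] and [gdel]; the squares of [y] and [w] are the successive
    quotients, hence positive. *)
Lemma lorentz_frame (R : rcfType) (a01 a02 a03 a12 a13 a23 : R) :
  1 < a01 -> 1 < a02 -> 1 < a12 -> 0 < gdel a01 a02 a03 a12 a13 a23 ->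
  exists T : 'M[R]_4, T *m mink_mx R *m T^T = gram a01 a02 a03 a12 a13 a23.
Proof.
move=> h01 h02 h12 D0.
have k0 := kap_gt0 h01 h02 h12.
have S0 : 0 < a01 ^+ 2 - 1 by rewrite subr_gt0 exprn_egt1.
have rt (u : R) : 0 < u -> exists2 v, 0 < v & v ^+ 2 = u.
  by move=> u0; exists (Num.sqrt u); rewrite ?sqrtr_gt0 // sqr_sqrtr // ltW.
have [s s0 sE] := rt _ S0; have [y y0 yE] := rt _ (divr_gt0 k0 S0).
have [w w0 wE] := rt _ (divr_gt0 D0 k0).
have sn := lt0r_neq0 s0; have yn := lt0r_neq0 y0; have kn := lt0r_neq0 k0;
    have Sn := lt0r_neq0 S0.
pose t := (a12 + a01 * a02) / s; pose t' := (a13 + a01 * a03) / s.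
pose z := (t * t' - a02 * a03 - a23) / y.
have ts : t * s = a12 + a01 * a02 by rewrite /t divfK.
have t's : t' * s = a13 + a01 * a03 by rewrite /t' divfK.
have zy : z * y = t * t' - a02 * a03 - a23 by rewrite /z divfK.
pose T : 'M[R]_4 := \matrix_(i, j) nth 0 (nth [::] [:: [:: 1; 0; 0; 0];
  [:: - a01; 0; 0; s]; [:: - a02; y; 0; t]; [:: - a03; z; w; t']] i) j.
have e22 : a02 ^+ 2 + y ^+ 2 - t ^+ 2 = 1.
  rewrite yE /t expr_div_n sE; move: Sn; rewrite /kap => Sn; by field.
have e33 : a03 ^+ 2 + z ^+ 2 + w ^+ 2 - t' ^+ 2 = 1.
  have tt : t * t' = (a12 + a01 * a02) * (a13 + a01 * a03) / (a01 ^+ 2 - 1).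
    by rewrite /t /t' -sE; field.
  rewrite wE /z expr_div_n yE tt /t' expr_div_n sE.
  by move: Sn kn; rewrite /kap /gdel => Sn kn; field; rewrite Sn kn.
exists T; apply: eq_mx4; rewrite mink_mxE /mink !mxE /=; move: ts t's zy e22 e33 sE;
    rewrite ?expr2; lra.
Qed.

(** If the last coordinates had opposite signs or the second one vanished, the nonpositive product
    would contradict Cauchy's inequality for the other three coordinates, which is strict for two
    timelike vectors. *)
Lemma mink_time_gt0 (R : realFieldType) (p q : 'rV[R]_4) :
  mink p p < 0 -> mink q q < 0 -> mink p q <= 0 -> 0 < p 0 o3 -> 0 < q 0 o3.
Proof.
rewrite /mink; move: (p 0 o0) (p 0 o1) (p 0 o2) (p 0 o3) (q 0 o0) (q 0 o1) (q 0 o2) (q 0 o3).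
move=> a b c d x y z t pp qq pq d0; rewrite ltNge; apply/negP => t0.
have dt : 0 <= - (d * t) by rewrite oppr_ge0 mulr_ge0_le0 // ltW.
have h1 : 0 <= - (d * t) - (a * x + b * y + c * z) by lra.
have sq (e : R) : 0 <= e * e by rewrite -expr2 sqr_ge0.
have : (d * t) ^+ 2 <= (a * x + b * y + c * z) ^+ 2.
  rewrite -subr_ge0 subr_sqr -[_ * _]opprK -mulNr -mulrN mulr_ge0 //; lra.
have : (a * x + b * y + c * z) ^+ 2 <= (a * a + b * b + c * c) * (x * x + y * y + z * z).
  rewrite -subr_ge0 (_ : _ - _ = (a * y - b * x) ^+ 2 + (a * z - c * x) ^+ 2
      + (b * z - c * y) ^+ 2).
    by rewrite !addr_ge0 ?sqr_ge0.
  by ring.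
have : (a * a + b * b + c * c) * (x * x + y * y + z * z) < (d * d) * (t * t).
  by apply: ltr_pM; rewrite ?addr_ge0 //; lra.
rewrite (_ : (d * d) * (t * t) = (d * t) ^+ 2); [lra|ring].
Qed.

Lemma hyp_metric_mink (R : realType) (p q r : 'rV[R]_3) : H3 R p ->
  hyp_metric p (q - p) (r - p) =
  (mink (point_vec q) (point_vec p) * mink (point_vec r) (point_vec p)
   - mink (point_vec q) (point_vec r) * mink (point_vec p) (point_vec p))
  / mink (point_vec p) (point_vec p) ^+ 2.
Proof.
rewrite /H3 /= => hp; rewrite /hyp_metric !mink_point_point.
have E (u v w : 'rV[R]_3) : [/\ dotv u (v - w) = dotv u v - dotv u w,
    dotv (v - w) u = dotv v u - dotv w u & dotv u v = dotv v u].
  by rewrite /dotv !sum3 !mxE; split; ring.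
have [e1 _ _] := E (q - p) r p; have [_ e2 _] := E r q p; have [_ e3 _] := E p q p.
have [e4 _ _] := E p q p; have [e5 _ _] := E p r p.
have [_ _ e6] := E q p p; have [_ _ e7] := E r p p.
rewrite e1 e2 e3 e4 e5 -e6 -e7.
have D0 : 1 - dotv p p != 0 by rewrite subr_eq0 gt_eqF.
have D1 : dotv p p - 1 != 0 by rewrite -opprB oppr_eq0.
by field; rewrite D0 D1.
Qed.

Definition klein (R : realType) (X : 'rV[R]_4) : 'rV[R]_3 :=
  \row_j (X 0 (widen_ord (isT : 3 <= 4)%N j) / X 0 o3).

Definition bary_vec (R : realType) (x : 'rV[R]_3) : 'rV[R]_4 := \row_v bary x v.

Definition bary_point (R : realType) (c : 'rV[R]_4) : 'rV[R]_3 :=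
  \row_j (c 0 (lift ord0 j) / \sum_i c 0 i).

Lemma widen34 : [/\ widen_ord (isT : 3 <= 4)%N q0 = o0, widen_ord (isT : 3 <= 4)%N q1 = o1
  & widen_ord (isT : 3 <= 4)%N q2 = o2].
Proof. by split; exact: val_inj. Qed.

Lemma point_vec_klein (R : realType) (X : 'rV[R]_4) : X 0 o3 != 0 ->
  point_vec (klein X) = (X 0 o3)^-1 *: X.
Proof.
have [w0 w1 w2] := widen34.
move=> X0; apply/rowP; apply: forall4; rewrite !mxE /= ?mxE ?w0 ?w1 ?w2 1?mulrC //.
by rewrite mulfV.
Qed.

Lemma klein_point_vec (R : realType) (z : 'rV[R]_3) (k : R) : k != 0 ->
  klein (k *: point_vec z) = z.
Proof.
have [w0 w1 w2] := widen34.
move=> k0; apply/rowP; apply: forall3; rewrite !mxE ?w0 ?w1 ?w2 /= mulr1 mulrC mulKf //.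
Qed.

Lemma sum_bary_vec (R : realType) (x : 'rV[R]_3) : \sum_i bary_vec x 0 i = 1.
Proof.
have [e0 e1 e2 e3] := baryE x.
by rewrite sum4 !mxE e0 e1 e2 e3; ring.
Qed.

Lemma bary_point_vec (R : realType) (x : 'rV[R]_3) (k : R) : k != 0 ->
  bary_point (k *: bary_vec x) = x.
Proof.
move=> k0; apply/rowP => j; rewrite mxE.
have -> : \sum_i (k *: bary_vec x) 0 i = k.
  by rewrite -[RHS]mulr1 -(sum_bary_vec x) mulr_sumr; apply: eq_bigr => i _; rewrite mxE.
by rewrite !mxE /bary liftK mulrC mulKf.
Qed.

Lemma bary_vec_point (R : realType) (c : 'rV[R]_4) : \sum_i c 0 i != 0 ->
  bary_vec (bary_point c) = (\sum_i c 0 i)^-1 *: c.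
Proof.
move=> s0; set s := \sum_i _ in s0 *.
have sE : s = c 0 o0 + c 0 o1 + c 0 o2 + c 0 o3 by rewrite /s sum4.
have [e0 e1 e2 e3] := baryE (bary_point c).
have L0 : lift ord0 q0 = o1 by exact: val_inj.
have L1 : lift ord0 q1 = o2 by exact: val_inj.
have L2 : lift ord0 q2 = o3 by exact: val_inj.
apply/rowP; apply: forall4; rewrite !mxE ?e0 ?e1 ?e2 ?e3 !mxE ?L0 ?L1 ?L2 -/s;
    try by rewrite mulrC.
have -> : c 0 o0 = s - (c 0 o1 + c 0 o2 + c 0 o3) by rewrite sE; ring.
by move: s0; move: s {sE} => s s0; field.
Qed.

Lemma cap_bary_vec (R : realType) (x : 'rV[R]_3) i :
  cap (fun _ _ => 2) i (bary_vec x) = 2 - 3 * bary x i.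
Proof.
have := sum_bary_vec x; rewrite (bigD1 i) //= /cap -mulr_sumr.
by set s := \sum_(j | _) _; rewrite !mxE; lra.
Qed.

Lemma truncated_bary_vec (R : realType) (x : 'rV[R]_3) :
  truncated_tetrahedron R x <-> cone (fun _ _ => 2) (bary_vec x).
Proof.
split=> [H|[_ H1 H2] v].
  split.
  - apply/eqP => E; have := sum_bary_vec x; rewrite E big1 => [|i _]; last by rewrite mxE.
    by move/esym/eqP; rewrite oner_eq0.
  - by move=> i; have /andP[h _] := H i; rewrite mxE.
  - by move=> i; have /andP[_ h] := H i; rewrite cap_bary_vec; lra.
have := H1 v; rewrite mxE => ->; have := H2 v; rewrite cap_bary_vec; lra.
Qed.

Lemma smooth_on_mulmxr (R : realType) m n (T : 'M[R]_(m, n)) (U : set 'rV[R]_m) :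
  open U -> smooth_on U (fun c => c *m T).
Proof.
move=> oU k; apply: Ck_on_row => // j.
rewrite (_ : (fun c => _) = fun c : 'rV[R]_m => \sum_i c 0 i * T i j); last first.
  by apply/funext => c; rewrite mxE.
apply: Ck_on_sum => // i _; apply: Ck_onM => //; [exact: Ck_on_coord|exact: Ck_on_cst].
Qed.

Lemma smooth_on_klein (R : realType) : smooth_on [set X : 'rV[R]_4 | 0 < X 0 o3] (@klein R).
Proof.
have oU : open [set X : 'rV[R]_4 | 0 < X 0 o3].
  by apply: open_gt0; apply: Ck_on_coord; exact: openT.
move=> k; apply: Ck_on_row => // j; apply: eq_Ck_on (_ : Ck_on k _ (fun X : 'rV[R]_4 =>
  X 0 (widen_ord (isT : 3 <= 4)%N j) * (X 0 o3)^-1)) => //.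
  by move=> X _; rewrite mxE.
apply: Ck_onM => //; first exact: Ck_on_coord.
by apply: Ck_onV => //; [move=> X /= h; rewrite gt_eqF|exact: Ck_on_coord].
Qed.

Lemma smooth_on_bary_vec (R : realType) (U : set 'rV[R]_3) : open U -> smooth_on U (@bary_vec R).
Proof.
move=> oU k; apply: Ck_on_row => // v.
apply: eq_Ck_on (_ : Ck_on k _ (fun x : 'rV[R]_3 => bary x v)) => //.
  by move=> x _; rewrite mxE.
rewrite /bary; case: unlift => [j|]; first exact: Ck_on_coord.
apply: Ck_onB => //; first exact: Ck_on_cst.
by apply: Ck_on_sum => // j _; exact: Ck_on_coord.
Qed.

Lemma Ck_on_row_sum (R : realType) n k (U : set 'rV[R]_n) : open U ->
  Ck_on k U (fun c : 'rV[R]_n => \sum_i c 0 i).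
Proof. by move=> oU; apply: Ck_on_sum => // i _; exact: Ck_on_coord. Qed.

Lemma smooth_on_bary_point (R : realType) :
  smooth_on [set c : 'rV[R]_4 | 0 < \sum_i c 0 i] (@bary_point R).
Proof.
have oU : open [set c : 'rV[R]_4 | 0 < \sum_i c 0 i].
  by apply: open_gt0; apply: Ck_on_row_sum; exact: openT.
move=> k; apply: Ck_on_row => // j; apply: eq_Ck_on (_ : Ck_on k _ (fun c : 'rV[R]_4 =>
  c 0 (lift ord0 j) * (\sum_i c 0 i)^-1)) => //.
  by move=> c _; rewrite mxE.
apply: Ck_onM => //; first exact: Ck_on_coord.
by apply: Ck_onV => //; [move=> X /= h; rewrite gt_eqF|exact: Ck_on_row_sum].
Qed.

Lemma smooth_on_point_vec (R : realType) (U : set 'rV[R]_3) : open U ->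
    smooth_on U (@point_vec R).
Proof.
move=> oU k; apply: Ck_on_row => // v.
apply: eq_Ck_on (_ : Ck_on k _ (fun x : 'rV[R]_3 => nth 0 [:: x 0 q0; x 0 q1; x 0 q2; 1] v)) =>
    //.
  by move=> x _; rewrite mxE.
by move: v; apply: forall4 => /=;
    [exact: Ck_on_coord|exact: Ck_on_coord|exact: Ck_on_coord|exact: Ck_on_cst].
Qed.

Lemma Ck_on_mink (R : realType) k (U : set 'rV[R]_4) (f g : 'rV[R]_4 -> 'rV[R]_4) :
  open U -> Ck_on k U f -> Ck_on k U g -> Ck_on k U (fun c => mink (f c) (g c)).
Proof.
move=> oU cf cg; rewrite /mink.
have e j := Ck_on_entry j oU cf; have e' j := Ck_on_entry j oU cg.
by apply: Ck_onB => //; [apply: Ck_onD => //; [apply: Ck_onD => //|]|]; apply: Ck_onM.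
Qed.

Lemma open_H3 (R : realType) : open (H3 R).
Proof.
rewrite (_ : H3 R = [set x | 0 < 1 - dotv x x]); last first.
  by apply/seteqP; split => x; rewrite /H3 /= subr_gt0.
apply: open_gt0; rewrite /dotv; apply: Ck_onB; [exact: openT|exact: Ck_on_cst|].
apply: Ck_on_sum => [|i _]; first exact: openT.
by apply: Ck_onM; [exact: openT|exact: Ck_on_coord openT|exact: Ck_on_coord openT].
Qed.

Lemma compact_truncated_tetrahedron (R : realType) : compact (truncated_tetrahedron R).
Proof.
have cb v : Ck_on 0 setT (fun x : 'rV[R]_3 => bary x v).
  apply: eq_Ck_on (Ck_on_entry v openT (smooth_on_bary_vec openT 0%N)) => [|x _];
      first exact: openT.
  by rewrite mxE.
apply: (subclosed_compact _ (rV_compact (fun _ : 'I_3 => @segment_compact R 0 1))).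
  rewrite -openC (_ : ~` _ = \bigcup_(v : 'I_4)
    ([set x | 0 < - bary x v] `|` [set x | 0 < bary x v - 2 / 3])).
    apply: bigcup_open => v _; apply: openU; apply: open_gt0.
      by apply: Ck_onN => //; exact: openT.
    by apply: Ck_onB => //; [exact: openT|exact: Ck_on_cst].
  apply/seteqP; split => [x /existsNP[v /negP]|x [v _ H] /(_ v)].
    rewrite negb_and -!ltNge => /orP[h|h]; exists v => //=; [left|right] => /=; lra.
  by case: H => /= h /andP[]; lra.
move=> x xT i /=; have := xT (lift ord0 i); rewrite /bary liftK in_itv /=; lra.
Qed.

Section Frame.
Variables (R : realType) (a : 'I_4 -> 'I_4 -> R) (T : 'M[R]_4).
Hypothesis aC : forall i j, a i j = a j i.
Hypothesis a1 : forall i j, i != j -> 1 < a i j.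
Hypothesis TJ : T *m mink_mx R *m T^T =
  gram (a o0 o1) (a o0 o2) (a o0 o3) (a o1 o2) (a o1 o3) (a o2 o3).

Lemma gram_entry i j :
  gram (a o0 o1) (a o0 o2) (a o0 o3) (a o1 o2) (a o1 o3) (a o2 o3) i j =
  if i == j then 1 else - a i j.
Proof. by move: i j; apply: forall4; apply: forall4; rewrite mxE //= aC. Qed.

Lemma mink_row_row i j : mink (row i T) (row j T) = if i == j then 1 else - a i j.
Proof. by rewrite -mink_mxE TJ gram_entry. Qed.

Lemma mink_row_cap i c : mink (row i T) (c *m T) = - cap a i c.
Proof.
rewrite -[X in mink _ X](row_id 0) -mink_mxE trmx_mul mulmxA TJ mxE (bigD1 i) //=.
rewrite gram_entry eqxx mul1r mxE /cap opprB; congr (_ + _); rewrite -sumrN.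
by apply: eq_bigr => j ji; rewrite gram_entry eq_sym (negbTE ji) mulNr mxE.
Qed.

Lemma mink_cone_vec c c' : mink (c *m T) (c' *m T) = - \sum_i c 0 i * cap a i c'.
Proof.
rewrite -[X in mink X](row_id 0) -[X in mink _ X](row_id 0) -mink_mxE -!mulmxA mxE -sumrN.
apply: eq_bigr => i _; rewrite mulmxA mink_mxE row_id mink_row_cap; ring.
Qed.

(** The product is minus the sum of the terms [c 0 i * cap a i c], all nonnegative. Two coordinates
    are positive and the two corresponding caps are not both zero, so some term is positive. *)
Lemma mink_cone_lt0 c : cone a c -> mink (c *m T) (c *m T) < 0.
Proof.
move=> cc; have [c0 cp ch] := cc; rewrite mink_cone_vec oppr_lt0.
have [i _ ci] := cone_coord_gt0 o0 cc; have [j ji cj] := cone_coord_gt0 i cc.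
have pos k : 0 < c 0 k -> 0 < cap a k c -> 0 < \sum_i c 0 i * cap a i c.
  move=> ck wk; rewrite (bigD1 k) //= ltr_pwDl ?mulr_gt0 //.
  by apply: sumr_ge0 => m _; exact: mulr_ge0.
by have [] := cap_two_gt0 a1 cc ji; [exact: pos|exact: pos].
Qed.

Lemma cone_time_gt0 c c' : cone a c -> cone a c' ->
  0 < (c *m T) 0 o3 -> 0 < (c' *m T) 0 o3.
Proof.
move=> cc cc'; apply: mink_time_gt0; try exact: mink_cone_lt0.
rewrite mink_cone_vec oppr_le0; have [_ cp _] := cc; have [_ _ ch] := cc'.
by apply: sumr_ge0 => i _; exact: mulr_ge0.
Qed.

Lemma cone_const1 : cone a (const_mx 1).
Proof.
split.
- apply/eqP => /rowP/(_ o0); rewrite !mxE => /eqP; by rewrite oner_eq0.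
- by move=> i; rewrite mxE.
- move=> i; have [j ij] : exists j, i != j.
    by move: i; apply: forall4; [exists o1|exists o0|exists o0|exists o0].
  rewrite /cap (bigD1 j) 1?eq_sym //= !mxE mulr1.
  have h1 := a1 ij.
  have h2 : 0 <= \sum_(k | (k != i) && (k != j)) a i k * (const_mx 1 : 'rV[R]_4) 0 k.
    apply: sumr_ge0 => k /andP[ki _]; rewrite mxE mulr1 ltW // (lt_trans ltr01) // a1 //.
    by rewrite eq_sym.
  lra.
Qed.

End Frame.

Lemma future_lorentz_frame (R : realType) (a : 'I_4 -> 'I_4 -> R) :
  (forall i j, a i j = a j i) -> (forall i j, i != j -> 1 < a i j) ->
  0 < gdel (a o0 o1) (a o0 o2) (a o0 o3) (a o1 o2) (a o1 o3) (a o2 o3) ->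
  exists T : 'M[R]_4, [/\ T *m mink_mx R *m T^T =
     gram (a o0 o1) (a o0 o2) (a o0 o3) (a o1 o2) (a o1 o3) (a o2 o3),
     T \in unitmx & forall c, cone a c -> 0 < (c *m T) 0 o3].
Proof.
move=> aC a1 D0.
have [T TJ] := lorentz_frame (a1 o0 o1 isT) (a1 o0 o2 isT) (a1 o1 o2 isT) D0.
have unit (S : 'M[R]_4) : S *m mink_mx R *m S^T =
     gram (a o0 o1) (a o0 o2) (a o0 o3) (a o1 o2) (a o1 o3) (a o2 o3) -> S \in unitmx.
  move=> /(congr1 determinant); rewrite !det_mulmx det_gram => E.
  rewrite unitmxE unitfE; apply/eqP => S0; move: E; rewrite S0 !mul0r => /eqP.
  by rewrite eq_sym oppr_eq0 gt_eqF.
have cc := cone_const1 a1.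
have : (const_mx 1 *m T : 'rV[R]_4) 0 o3 != 0.
  apply/eqP => t0; have := mink_cone_lt0 aC a1 TJ cc.
  rewrite /mink t0 mul0r subr0; apply/negP; rewrite -leNgt.
  by rewrite -!expr2 !addr_ge0 // sqr_ge0.
rewrite neq_lt => /orP[t0|t0]; last first.
  by exists T; split => //; [exact: unit|move=> c ccc; exact: (cone_time_gt0 aC a1 TJ cc)].
(* If the cone lies in the past, the frame is composed with time reversal, whose matrix is [mink_mx]
   itself. *)
have TJ' : T *m mink_mx R *m mink_mx R *m (T *m mink_mx R)^T =
     gram (a o0 o1) (a o0 o2) (a o0 o3) (a o1 o2) (a o1 o3) (a o2 o3).
  have J2 : mink_mx R *m mink_mx R = 1%:M.
    by apply: eq_mx4; rewrite !mxE !sum4 !mxE /=; ring.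
  have JT : (mink_mx R)^T = mink_mx R.
    by apply/matrixP; apply: forall4; apply: forall4; rewrite !mxE.
  by rewrite -(mulmxA T) J2 mulmx1 trmx_mul JT mulmxA.
exists (T *m mink_mx R); split => //; first exact: unit.
move=> c ccc; apply: (cone_time_gt0 aC a1 TJ' cc) => //.
by rewrite mulmxA mxE sum4 !mxE /= !mulr0 !add0r mulrN1 oppr_gt0; move: t0; rewrite mxE.
Qed.

Lemma hyperideal_exists (R : realType) (a : 'I_4 -> 'I_4 -> R) :
  (forall i j, a i j = a j i) -> (forall i j, i != j -> 1 < a i j) ->
  0 < gdel (a o0 o1) (a o0 o2) (a o0 o3) (a o1 o2) (a o1 o3) (a o2 o3) ->
  exists P : tetrahedron R, hyperideal P /\
    forall i j, i != j -> edge_length P i j = arcosh (a i j).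
Proof.
move=> aC a1 D0; have [T [TJ Tu Tfut]] := future_lorentz_frame aC a1 D0.
have al1 (p q : 'I_4) : p != q -> 1 < (2 : R) by rewrite ltr1n.
(* The cone over the standard truncated tetrahedron has all its coefficients equal to 2. *)
have [A [B [F [G [[oA oB sF sG] [FG GF hF hG] [cA cB] cF cG]]]]] :=
  cone_equiv_of_gt1 al1 a1.
pose phi x := F (bary_vec x) *m T.
pose cz z : 'rV[R]_4 := point_vec z *m invmx T.
have czT z : cz z *m T = point_vec z by rewrite /cz -mulmxA mulVmx ?mulmx1.
have czphi x : phi x 0 o3 != 0 -> cz (klein (phi x)) = (phi x 0 o3)^-1 *: F (bary_vec x).
  by move=> h; rewrite /cz point_vec_klein // -scalemxAl mulmxK.
(* The hexagonal half-space [c] says that the coordinate [c] of [cz z] is nonnegative, whence the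
   opposite of a column of [invmx T]; the triangular half-space [v] is given by the row [v] of
   [T]. *)
pose P := Tetrahedron
  (fun c => HalfSpace (\row_j (- invmx T (widen_ord (isT : 3 <= 4)%N j) c)) (invmx T o3 c))
  (fun v => HalfSpace (\row_j T v (widen_ord (isT : 3 <= 4)%N j)) (T v o3))
  (fun x => klein (phi x)).
have [w0 w1 w2] := widen34.
have hexE c z : dotv (normal (hex_side P c)) z - offset (hex_side P c) = - cz z 0 c.
  by rewrite /dotv sum3 /= !mxE sum4 !mxE /= w0 w1 w2; ring.
have triE v z : dotv (normal (tri_side P v)) z - offset (tri_side P v) = - cap a v (cz z).
  rewrite -(mink_row_cap aC TJ) czT -mink_plane_point; congr (mink _ _).
  by apply/rowP; apply: forall4; rewrite !mxE /= ?mxE ?w0 ?w1 ?w2.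
have cz0 z : cz z != 0.
  apply/eqP => E; have := czT z; rewrite E mul0mx => /rowP/(_ o3)/eqP.
  by rewrite !mxE /= eq_sym oner_eq0.
have pvH z : mink (point_vec z) (point_vec z) < 0 -> H3 R z.
  by rewrite mink_point_point subr_lt0.
have polyE z : polyhedron P z <-> cone a (cz z).
  split=> [[_ H]|cc].
    split => // i; have [h1 h2] := H i.
    - by rewrite -oppr_le0 -hexE subr_le0.
    - by rewrite -oppr_le0 -triE subr_le0.
  have [_ cp ch] := cc; split; first by apply: pvH; rewrite -czT; exact: (mink_cone_lt0 aC a1 TJ).
  by move=> v; split; rewrite /hs_set /= -subr_le0 ?hexE ?triE oppr_le0.
(* The future timelike vectors: [klein] is smooth on them and sends them into the ball. *)
pose N : set 'rV[R]_4 := [set c | 0 < (c *m T) 0 o3 /\ 0 < - mink (c *m T) (c *m T)].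
have oN : open N.
  have cT := smooth_on_mulmxr T openT 0%N.
  apply: openI; apply: open_gt0; first exact: (Ck_on_entry _ openT cT).
  by apply: (Ck_onN openT); exact: (Ck_on_mink openT).
pose U : set 'rV[R]_3 := [set x | A (bary_vec x) /\ N (F (bary_vec x))].
(* The sum of the coordinates has to be positive for [bary_point] to invert [bary_vec] up to a
   positive factor, which homogeneity absorbs. *)
pose V : set 'rV[R]_3 := [set z | H3 R z /\ B (cz z) /\ 0 < \sum_i G (cz z) 0 i].
have oAF : open (A `&` F @^-1` N) by apply: open_preimage => //; exact: (sF 0%N).
have oU : open U.
  rewrite (_ : U = setT `&` @bary_vec R @^-1` (A `&` F @^-1` N)); last first.
    by apply/seteqP; split => x //= -[].
  by apply: open_preimage => //; [exact: openT|exact: (smooth_on_bary_vec openT 0%N)].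
have scz : smooth_on setT cz.
  exact: (smooth_on_comp openT openT _ (smooth_on_point_vec openT) (smooth_on_mulmxr _ openT)).
have oS : open [set c : 'rV[R]_4 | 0 < \sum_i c 0 i].
  by apply: open_gt0; apply: Ck_on_row_sum; exact: openT.
have oV : open V.
  rewrite (_ : V = H3 R `&` cz @^-1` (B `&` G @^-1` [set c | 0 < \sum_i c 0 i])) //.
  apply: open_preimage; [exact: open_H3| |by move=> x _; exact: (scz 0%N)].
  by apply: open_preimage => //; exact: (sG 0%N).
have sm : smooth_on U (marking P).
  have s1 : smooth_on U (F \o @bary_vec R).
    by apply: (smooth_on_comp oU oA) => //; [move=> x []|exact: smooth_on_bary_vec].
  have s2 : smooth_on U (fun x => (F \o @bary_vec R) x *m T).
    exact: (smooth_on_comp oU openT _ s1 (smooth_on_mulmxr T openT)).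
  apply: (smooth_on_comp oU _ _ s2 (@smooth_on_klein R)); last by move=> x [_ []].
  by apply: open_gt0; apply: Ck_on_coord; exact: openT.
have sg : smooth_on V (fun z => bary_point (G (cz z))).
  have s1 : smooth_on V cz by apply: smooth_onS scz.
  have s2 : smooth_on V (fun z => G (cz z)) by apply: (smooth_on_comp oV oB _ s1 sG) => z [_ []].
  by apply: (smooth_on_comp oV oS _ s2 (@smooth_on_bary_point R)) => z [_ []].
have gm x : U x -> V (marking P x) /\ bary_point (G (cz (marking P x))) = x.
  move=> [Ax [X0 Xn]]; have [BF GFx] := FG _ Ax.
  have k0 : 0 < (phi x 0 o3)^-1 by rewrite invr_gt0.
  have [Bk Gk] := hG _ _ BF k0.
  have E : cz (marking P x) = (phi x 0 o3)^-1 *: F (bary_vec x) by rewrite czphi // gt_eqF.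
  rewrite E Gk GFx bary_point_vec ?gt_eqF //; split => //; split.
    apply: pvH; rewrite point_vec_klein ?gt_eqF // minkZl minkC minkZl pmulr_rlt0 //.
    by rewrite pmulr_rlt0 // -oppr_gt0.
  rewrite E Gk GFx; split => //.
  under eq_bigr do rewrite mxE.
  by rewrite -mulr_sumr sum_bary_vec mulr1.
have mg z : V z -> U (bary_point (G (cz z))) /\ marking P (bary_point (G (cz z))) = z.
  move=> [Hz [Bz Sz]]; set S := \sum_i _ in Sz.
  have k0 : 0 < S^-1 by rewrite invr_gt0.
  have [Az FGz] := GF _ Bz; have [Ak Fk] := hF _ _ Az k0.
  have E : bary_vec (bary_point (G (cz z))) = S^-1 *: G (cz z).
    by apply: bary_vec_point; rewrite gt_eqF.
  have E2 : phi (bary_point (G (cz z))) = S^-1 *: point_vec z.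
    by rewrite /phi E Fk FGz -scalemxAl czT.
  split; last by rewrite /= E2 klein_point_vec // gt_eqF.
  split; first by rewrite E.
  split; first by rewrite -/(phi _) E2 !mxE /= mulr1.
  rewrite -/(phi _) E2 minkZl minkC minkZl oppr_gt0 pmulr_rlt0 // pmulr_rlt0 //.
  by rewrite mink_point_point subr_lt0.
have TU x : truncated_tetrahedron R x -> U x /\ cone a (F (bary_vec x)).
  move=> /truncated_bary_vec cx; have [cFx _ _] := cF _ cx.
  split => //; split; first exact: cA.
  by split; [exact: Tfut|rewrite oppr_gt0; exact: (mink_cone_lt0 aC a1 TJ)].
have coneZ (be : 'I_4 -> 'I_4 -> R) c k : 0 < k -> cone be c -> cone be (k *: c).
  move=> k0 [c0 cp ch]; split.
  - by rewrite scaler_eq0 gt_eqF.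
  - by move=> i; rewrite mxE mulr_ge0 // ltW.
  - by move=> i; rewrite capZ mulr_ge0 // ltW.
have imT : marking P @` truncated_tetrahedron R = polyhedron P.
  apply/seteqP; split => [_ [x /TU[[Ax [X0 _]] cc] <-]|z /polyE cc].
    apply/polyE; rewrite czphi; first by apply: coneZ => //; rewrite invr_gt0.
    by rewrite gt_eqF.
  have cGz := cG _ cc.
  have Sz : 0 < \sum_i G (cz z) 0 i.
    have [_ cp _] := cGz; have [j _ cj] := cone_coord_gt0 o0 cGz.
    by rewrite (bigD1 j) //= ltr_pwDl // sumr_ge0.
  have Vz : V z.
    split; last by split => //; exact: cB.
    by have [] := (polyE z).2 cc.
  have [_ mz] := mg z Vz; exists (bary_point (G (cz z))) => //.
  apply/truncated_bary_vec; rewrite bary_vec_point ?gt_eqF //.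
  by apply: coneZ => //; rewrite invr_gt0.
have inv x y : truncated_tetrahedron R x -> truncated_tetrahedron R y ->
    marking P x = marking P y -> x = y.
  by move=> /TU[Ux _] /TU[Uy _] E; rewrite -(gm x Ux).2 E (gm y Uy).2.
have face (Q : set 'rV[R]_3) (K : set 'rV[R]_3) :
    (forall x, truncated_tetrahedron R x -> (K x <-> Q (marking P x))) ->
    marking P @` (truncated_tetrahedron R `&` K) = polyhedron P `&` Q.
  move=> KQ; apply/seteqP; split => [_ [x [xT Kx] <-]|z].
    by split; [rewrite -imT; exists x|apply/KQ].
  by rewrite -imT => -[[x xT <-] Qx]; exists x => //; split => //; apply/KQ.
have czE x : truncated_tetrahedron R x ->
    exists2 k : R, 0 < k & cz (marking P x) = k *: F (bary_vec x).
  move=> /TU[[_ [X0 _]] _]; exists (phi x 0 o3)^-1; first by rewrite invr_gt0.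
  by rewrite czphi // gt_eqF.
have faces v : marking P @` std_hexagon R v = polyhedron P `&` hs_plane (hex_side P v) /\
    marking P @` std_triangle R v = polyhedron P `&` hs_plane (tri_side P v).
  have P0 (u w : R) : (u == w) = (u - w == 0) by rewrite subr_eq0.
  have eqiff (u u' w w' : R) : (u == u') = (w == w') -> (u = u' <-> w = w').
    by move=> E; split => /eqP h; apply/eqP; [rewrite -E|rewrite E].
  split; apply: face => x xT; have /truncated_bary_vec cx := xT; have [_ z1 z2] := cF _ cx;
    have [k k0 kE] := czE _ xT.
    apply: (eqiff (bary x v) 0 _ (offset (hex_side P v))).
    by rewrite [RHS]P0 hexE kE mxE oppr_eq0 mulf_eq0 (gt_eqF k0) /= z1 mxE.
  apply: (eqiff (bary x v) (2 / 3) _ (offset (tri_side P v))).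
  rewrite [RHS]P0 triE kE capZ oppr_eq0 mulf_eq0 (gt_eqF k0) /= z2.
  rewrite cap_bary_vec; apply/eqP/eqP; lra.
(* At this vertex only the coordinates [i] and [j] are nonzero and the cap at [i] vanishes, which
   fixes their ratio and hence the direction of the vector. *)
have tv i j : i != j -> exists2 k : R, 0 < k &
    point_vec (tet_vertex P i j) = k *: (a i j *: row i T + row j T).
  move=> ij; have xT : truncated_tetrahedron R (std_vertex R i j).
    move=> v; rewrite bary_std_vertex //; case: ifP => _; first by lra.
    by case: ifP => _; lra.
  have /truncated_bary_vec cx := xT; have [cc z1 z2] := cF _ cx.
  set c := F _ in cc z1 z2.
  have [m [n Uq]] := ord4_complement_ab ij.
  have := Uq; rewrite /= !inE !negb_or => /and4P[/and3P[_ im iN] /andP[jm jn] mn _].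
  have cm : c 0 m = 0.
    by apply/eqP; rewrite z1 mxE bary_std_vertex // (eq_sym m i) (negbTE im) (eq_sym m j)
        (negbTE jm).
  have cn : c 0 n = 0.
    by apply/eqP; rewrite z1 mxE bary_std_vertex // (eq_sym n i) (negbTE iN) (eq_sym n j)
        (negbTE jn).
  have ci : c 0 i = a i j * c 0 j.
    have /eqP : cap a i c == 0.
      by rewrite z2 cap_bary_vec bary_std_vertex // eqxx; apply/eqP; lra.
    rewrite (cap4 a c Uq) cm cn; lra.
  have cj : 0 < c 0 j.
    have [q qi cq] := cone_coord_gt0 i cc.
    have := mem_uniq4 q Uq; rewrite !inE (negbTE qi) /= => /or3P[] /eqP E; rewrite E in cq => //.
      by rewrite cm ltxx in cq.
    by rewrite cn ltxx in cq.
  have cT : c *m T = c 0 j *: (a i j *: row i T + row j T).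
    rewrite mulmx_sum_row (bigD1 i) //= (bigD1 j) 1?eq_sym //= big1 => [|q /andP[qi qj]].
      by rewrite addr0 ci scalerDr scalerA mulrC.
    have := mem_uniq4 q Uq; rewrite !inE (negbTE qi) (negbTE qj) /= => /orP[] /eqP ->.
      by rewrite cm scale0r.
    by rewrite cn scale0r.
  have t0 : 0 < (c *m T) 0 o3 by exact: Tfut.
  exists (((c *m T) 0 o3)^-1 * c 0 j); first by rewrite mulr_gt0 // invr_gt0.
  by rewrite /tet_vertex /= /phi -/c point_vec_klein ?gt_eqF // -scalerA -cT.
have mDr (u v w : 'rV[R]_4) : mink w (u + v) = mink w u + mink w v.
  by rewrite minkC minkDl !(minkC w).
have mZr (k : R) (u w : 'rV[R]_4) : mink w (k *: u) = k * mink w u.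
  by rewrite minkC minkZl (minkC w).
exists P; split; last first.
  move=> i j ij; have ji : j != i by rewrite eq_sym.
  have [k k0 kE] := tv _ _ ij; have [k' k'0 k'E] := tv _ _ ji.
  set s := a i j ^+ 2 - 1.
  have s1 : 0 < s by rewrite subr_gt0 exprn_egt1 // a1.
  have e1 : mink (point_vec (tet_vertex P i j)) (point_vec (tet_vertex P i j)) = - (k ^+ 2 * s).
    rewrite kE !(minkDl, minkZl, mDr, mZr) !(mink_row_row aC TJ).
    by rewrite !eqxx (negbTE ij) (negbTE ji) (aC j i) /s; ring.
  have e2 : mink (point_vec (tet_vertex P j i)) (point_vec (tet_vertex P j i)) = - (k' ^+ 2 * s).
    rewrite k'E !(minkDl, minkZl, mDr, mZr) !(mink_row_row aC TJ).
    by rewrite !eqxx (negbTE ij) (negbTE ji) (aC j i) /s; ring.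
  have e3 : mink (point_vec (tet_vertex P i j)) (point_vec (tet_vertex P j i)) =
      - (k * k' * s * a i j).
    rewrite kE k'E !(minkDl, minkZl, mDr, mZr) !(mink_row_row aC TJ).
    by rewrite !eqxx (negbTE ij) (negbTE ji) (aC j i) /s; ring.
  rewrite /edge_length hyp_distE e1 e2 e3 opprK.
  have -> : - (k ^+ 2 * s) * - (k' ^+ 2 * s) = (k * k' * s) ^+ 2 by ring.
  have p0 : 0 < k * k' * s by rewrite !mulr_gt0.
  by rewrite sqrtr_sqr (gtr0_norm p0) mulrC mulKf ?gt_eqF.
split => //.
- rewrite -imT; apply: continuous_compact; last exact: compact_truncated_tetrahedron.
  apply: continuous_in_subspaceT => x; rewrite inE => /TU[Ux _]; exact: (sm 0%N).
- exists U, V; split; [by move=> x /TU[]|by move=> z []|].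
  split => //; last by exists (fun z => bary_point (G (cz z))); split => // x /gm[].
  apply/seteqP; split => [_ [x /gm[Vx _] <-] //|z /mg[Uz zE]].
  by exists (bary_point (G (cz z))).
- move=> c i j d Uq.
  have := Uq; rewrite /= !inE !negb_or => /and4P[/and3P[ij ic iD] /andP[jc jd] cd _].
  have ji : j != i by rewrite eq_sym.
  have [k k0 kE] := tv _ _ ij; have [k' k'0 k'E] := tv _ _ ji; have [h h0 hE] := tv _ _ iD.
  rewrite /hyp_angle hyp_metric_mink; last first.
    apply: pvH; rewrite kE !(minkDl, minkZl, mDr, mZr) !(mink_row_row aC TJ).
    rewrite !eqxx (negbTE ij) (negbTE ji) (aC j i).
    have s1 : 0 < k ^+ 2 * (a i j ^+ 2 - 1).
      by rewrite mulr_gt0 ?exprn_gt0 // subr_gt0 exprn_egt1 // a1.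
    by move: s1; rewrite !expr2; lra.
  set nu := _ - _; suff -> : nu = 0 by rewrite !mul0r acos0.
  rewrite /nu kE k'E hE !(minkDl, minkZl, mDr, mZr) !(mink_row_row aC TJ).
  rewrite !eqxx (negbTE ij) (negbTE ji) (negbTE iD) (negbTE jd) (eq_sym d i) (eq_sym d j).
  by rewrite (negbTE iD) (negbTE jd) (aC j i) (aC d i) (aC d j); ring.
Qed.

(** * Edges of a triangulation *)

(** By [glueK], the gluing through the image of the face [f] carries the edge back. *)
Lemma glued_edges_sym (T : face_pairing) : symmetric (@glued_edges T).
Proof.
suff H (y z : 'I_(ntet T) * {set 'I_4}) : glued_edges y z -> glued_edges z y by move=> y z;
    apply/idP/idP; exact: H.
case: y => t s; case: z => t' s' /existsP[f /andP[fs /eqP[-> ->]]].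
apply/existsP; exists ((Defs.glue t f).2 f); rewrite /= glueK /=; apply/andP; split.
  by rewrite mem_imset //; exact: perm_inj.
apply/eqP; congr (_, _); rewrite -imset_comp; apply/esym.
rewrite -[RHS]imset_id; apply: eq_imset => v /=; exact: permK.
Qed.

Lemma edges_partition (T : face_pairing)   : finset.partition (edges T) (tet_edge T).
Proof.
apply: finset.equivalence_partitionP => x y z _ _ _; split; first exact: connect0.
move=> xy; exact: (same_connect (sym_connect_sym (@glued_edges_sym T)) xy).
Qed.

Lemma edge_classP (T : face_pairing) (y : 'I_(ntet T) * {set 'I_4}) :
  #|y.2| = 2 -> exists i, forall j, (y \in edge j) = (j == i).
Proof.
move=> y2; have /and3P[/eqP cv tr _] := edges_partition T.
have : y \in finset.cover (edges T) by rewrite cv inE y2.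
move=> /finset.bigcupP[B BE yB].
have ex : exists i : 'I_(nedges T), edge i = B.
  by exists (enum_rank_in BE B); rewrite /edge enum_rankK_in.
have [i iB] := ex; exists i => j; apply/idP/eqP => [yj|->]; last by rewrite iB.
apply: enum_val_inj; rewrite -/(edge j) -/(edge i) iB; apply/eqP/negPn/negP => jB.
have := finset.trivIsetP tr _ _ (enum_valP j) BE jB.
by move/disjoint_setI0/setP/(_ y); rewrite !inE /= -/(edge j) yj yB.
Qed.

Lemma edge_nonempty (T : face_pairing) (i : 'I_(nedges T)) :
  exists t a b, a != b /\ (t, [set a; b]%SET) \in edge i.
Proof.
have /and3P[/eqP cv tr n0] := edges_partition T.
have iE : edge i \in edges T by exact: enum_valP.
have : edge i != finset.set0 by apply: contraNneq n0 => <-.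
case/set0Pn => -[t s] ti; exists t.
have : (t, s) \in finset.cover (edges T) by apply/finset.bigcupP; exists (edge i).
rewrite cv inE => /cards2P[a [b [ab /= sE]]]; exists a, b; split => //; by rewrite -sE.
Qed.

(** For [a = b] the index is arbitrary; that there is some edge to choose from is shown by the edge
    joining [o0] and [o1] in the same simplex. The symmetry comes from the encoding of edges as sets
    of vertices. *)
Lemma edge_index (T : face_pairing) :
  exists ix : 'I_(ntet T) -> 'I_4 -> 'I_4 -> 'I_(nedges T),
  (forall t a b, a != b -> forall i, ((t, [set a; b]%SET) \in edge i) = (i == ix t a b)) /\
  (forall t a b, ix t a b = ix t b a).
Proof.
have H (x : 'I_(ntet T) * {set 'I_4}) : exists i : 'I_(nedges T),
    #|x.2| = 2 -> forall j, (x \in edge j) = (j == i).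
  have [h|h] := eqVneq #|x.2| 2.
    by have [i iE] := edge_classP h; exists i.
  have [i iE] := @edge_classP T (x.1, [set o0; o1]%SET) (cards2 _ _).
  by exists i => h'; rewrite h' eqxx in h.
have [f fE] := choice H.
exists (fun t a b => f (t, [set a; b]%SET)); split => [t a b ab i|t a b].
  by rewrite fE //= cards2 ab.
by rewrite finset.setUC.
Qed.

(** * Cone angles as functions of the edge lengths *)

Definition sinh (R : realType) (x : R) : R := (expR x - expR (- x)) / 2.

Lemma cosh_sub1 (R : realType) (x : R) : cosh x ^+ 2 - 1 = sinh x ^+ 2.
Proof.
have e : expR x * expR (- x) = 1 by rewrite -expRD subrr expR0.
rewrite /cosh /sinh; move: e; move: (expR (- x)) (expR x) => v u uv.
apply/eqP; rewrite -subr_eq0; apply/eqP.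
by transitivity (u * v - 1); [field|rewrite uv subrr].
Qed.

Lemma sinh_gt0 (R : realType) (x : R) : 0 < x -> 0 < sinh x.
Proof. by move=> x0; rewrite divr_gt0 // subr_gt0 ltr_expR; lra. Qed.

Lemma cosh_gt1 (R : realType) (x : R) : 0 < x -> 1 < cosh x.
Proof.
move=> x0; have c0 : 0 <= cosh x by rewrite divr_ge0 // addr_ge0 // expR_ge0.
rewrite -(@ltr_pXn2r _ 2) ?nnegrE // expr1n -subr_gt0 cosh_sub1 exprn_gt0 //.
exact: sinh_gt0.
Qed.

Lemma arcosh_cosh (R : realType) (x : R) : 0 < x -> arcosh (cosh x) = x.
Proof.
move=> x0; rewrite /arcosh cosh_sub1 sqrtr_sqr gtr0_norm ?sinh_gt0 // /cosh /sinh.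
have -> : (expR x + expR (- x)) / 2 + (expR x - expR (- x)) / 2 = expR x by field.
exact: expRK.
Qed.

Lemma is_derive1_cosh (R : realType) (x : R) :
  is_derive x 1 (@cosh R) (sinh x).
Proof.
rewrite /sinh.
have d1 := is_derive_expR x.
have d2 : is_derive x 1 (fun y : R => expR (- y)) (- expR (- x)).
  apply: is_derive_eq; rewrite /GRing.scale /=; ring.
rewrite (_ : @cosh R = fun y => (expR y + expR (- y)) * 2^-1) //.
apply: is_derive_eq; rewrite /GRing.scale /=; ring.
Qed.

Lemma Ck_on_cosh (R : realType) k : Ck_on k setT (@cosh R).
Proof.
rewrite (_ : @cosh R = fun y => (expR y + expR (- y)) * 2^-1) //.
apply: Ck_onM; [exact: openT| |exact: Ck_on_cst].
apply: Ck_onD; [exact: openT|exact: Ck_on_expR|].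
have -> : (fun y : R => expR (- y)) = fun y => (expR y)^-1.
  by apply/funext => y; rewrite expRN.
apply: Ck_onV; [exact: openT|by move=> y _; rewrite gt_eqF // expR_gt0|exact: Ck_on_expR].
Qed.

Lemma open_forall_gt0 (R : realType) (V : normedModType R) (I : finType) (f : I -> V -> R) :
  (forall i, Ck_on 0 setT (f i)) -> open [set x | forall i, 0 < f i x].
Proof.
move=> cf; rewrite openE => x Hx; apply: filter_forall => i.
by apply: open_nbhs_nbhs; split; [exact: open_gt0|exact: Hx].
Qed.

Lemma derive_comp_is_derive (R : realType) (V : normedModType R) (f : V -> R) (g : R -> R)
    (x v : V) (d : R) :
  differentiable f x -> is_derive (f x) 1 g d ->
  differentiable (fun y => g (f y)) x /\ 'D_v (fun y => g (f y)) x = d * 'D_v f x.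
Proof.
move=> df [dg gE]; have dg' : differentiable g (f x) by apply/derivable1_diffP.
split; first exact: (@differentiable_comp _ _ _ _ f g).
by rewrite (derive_comp1 v df dg') gE mulrC.
Qed.

Lemma derive_angle (R : realType) (V : normedModType R) (p q r : V -> R) (x v : V) :
  differentiable p x -> differentiable q x -> differentiable r x ->
  0 < p x -> 0 < q x -> 0 < p x * q x - r x ^+ 2 ->
  'D_v (fun y => acos (- r y / Num.sqrt (p y * q y))) x =
  ('D_v r x - r x / 2 * ('D_v p x / p x + 'D_v q x / q x)) / Num.sqrt (p x * q x - r x ^+ 2).
Proof.
move=> dp dq dr p0 q0 m0.
have pq0 : 0 < p x * q x by rewrite mulr_gt0.
have s0 : 0 < Num.sqrt (p x * q x) by rewrite sqrtr_gt0.
have n0 : 0 < Num.sqrt (p x * q x - r x ^+ 2) by rewrite sqrtr_gt0.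
have ss : Num.sqrt (p x * q x) ^+ 2 = p x * q x by rewrite sqr_sqrtr // ltW.
have dpq : differentiable (fun y => p y * q y) x by exact: differentiableM.
have Dpq : 'D_v (fun y => p y * q y) x = p x * 'D_v q x + q x * 'D_v p x.
  by rewrite (@deriveM R V p q x v) //; exact: diff_derivable.
have [ds Ds] := derive_comp_is_derive v dpq (is_derive1_sqrt pq0).
have hi : is_derive (Num.sqrt (p x * q x)) 1 (fun y : R => y^-1)
    (- ((Num.sqrt (p x * q x))^-1 * (Num.sqrt (p x * q x))^-1)).
  apply: (is_derive_eq (@is_deriveV R id _ 1 1 (lt0r_neq0 s0) _)).
  by rewrite /GRing.scale /= mulr1 expr2 invfM.
have [di Di] := derive_comp_is_derive v ds hi.
have dnr : differentiable (fun y => - r y) x by exact: differentiableN.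
have Dnr : 'D_v (fun y => - r y) x = - 'D_v r x.
  by rewrite (@deriveN R V R r x v) //; exact: diff_derivable.
have du : differentiable (fun y => - r y / Num.sqrt (p y * q y)) x by exact: differentiableM.
have Du : 'D_v (fun y => - r y / Num.sqrt (p y * q y)) x =
    - r x * 'D_v (fun y => (Num.sqrt (p y * q y))^-1) x + (Num.sqrt (p x * q x))^-1 * - 'D_v r x.
  rewrite -Dnr (@deriveM R V (fun y => - r y) (fun y => (Num.sqrt (p y * q y))^-1) x v) //;
    exact: diff_derivable.
pose u := - r x / Num.sqrt (p x * q x).
have u2 : 1 - u ^+ 2 = (p x * q x - r x ^+ 2) / (p x * q x).
  by rewrite /u expr_div_n sqrrN ss; field; rewrite !gt_eqF.
have u1 : -1 < u < 1.
  rewrite -ltr_norml -sqrtr_sqr -(@ltr_pXn2r _ 2) ?nnegrE ?sqrtr_ge0 // sqr_sqrtr ?sqr_ge0 //.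
  by rewrite expr1n -subr_gt0 u2 divr_gt0.
have [_ ->] := derive_comp_is_derive v du (is_derive1_acos u1).
rewrite -/u u2 sqrtrM ?ltW // sqrtrV ?ltW // Du Di Ds Dpq.
move: (Num.sqrt (p x * q x)) (Num.sqrt (_ - _)) s0 n0 ss => s n s0 n0 ss.
have -> : q x = s ^+ 2 / p x by rewrite ss mulrC mulKf // gt_eqF.
by field; rewrite !gt_eqF.
Qed.

Lemma derive_inverse_mx (R : realType) (V : normedModType R) n (U : set V)
    (G H : V -> 'M[R]_n) (x v : V) :
  open U -> U x -> (forall y, U y -> G y *m H y = 1%:M) ->
  (forall i j, differentiable (fun y => G y i j) x) ->
  (forall i j, differentiable (fun y => H y i j) x) ->
  \matrix_(i, j) 'D_v (fun y => H y i j) x =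
  - (H x *m (\matrix_(i, j) 'D_v (fun y => G y i j) x) *m H x).
Proof.
move=> oU Ux GH dG dH; set dHx := \matrix_(i, j) _; set dGx := \matrix_(i, j) _.
have E : G x *m dHx + dGx *m H x = 0.
  apply/matrixP => i j; rewrite !mxE -big_split /=.
  transitivity ('D_v (fun y => (G y *m H y) i j) x); last first.
    rewrite (@near_eq_derive _ _ _ _ (cst ((1%:M : 'M[R]_n) i j))) ?derive_cst //.
    by near=> y; rewrite GH //; near: y; exact: open_nbhs_nbhs.
  rewrite (_ : (fun y => _) = \sum_(k < n) (fun y => G y i k * H y k j)); last first.
    by apply/funext => y; rewrite fct_sumE mxE.
  rewrite derive_sum; last first.
    by move=> k; apply: derivableM; exact: diff_derivable.
  apply: eq_bigr => k _; rewrite !mxE.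
  rewrite (_ : (fun y => _) = (fun y => G y i k) * (fun y => H y k j)) // deriveM;
      try exact: diff_derivable.
  by rewrite /GRing.scale /=; ring.
have HG : H x *m G x = 1%:M by apply: mulmx1C; exact: GH.
transitivity (H x *m (G x *m dHx)); first by rewrite mulmxA HG mul1mx.
by rewrite (eqP (_ : G x *m dHx == - (dGx *m H x))) -?addr_eq0 ?E // mulmxN mulmxA.
Unshelve. all: by end_near.
Qed.

(** [s i j] is the coordinate that carries the length of the edge [i j] of one tetrahedron. It need
    not be injective, as several edges of a tetrahedron may be identified. *)
Section TetrahedronAngles.
Variables (R : realType) (n : nat) (s : 'I_4 -> 'I_4 -> 'I_n).

Definition edge_cosh (x : 'rV[R]_n) (i j : 'I_4) : R := cosh (x 0 (s i j)).

Definition tet_gdel (x : 'rV[R]_n) : R :=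
  gdel (edge_cosh x o0 o1) (edge_cosh x o0 o2) (edge_cosh x o0 o3)
       (edge_cosh x o1 o2) (edge_cosh x o1 o3) (edge_cosh x o2 o3).

Definition tet_gram (x : 'rV[R]_n) : 'M[R]_4 :=
  gram (edge_cosh x o0 o1) (edge_cosh x o0 o2) (edge_cosh x o0 o3)
       (edge_cosh x o1 o2) (edge_cosh x o1 o3) (edge_cosh x o2 o3).

Definition tet_inv (x : 'rV[R]_n) : 'M[R]_4 :=
  gram_inv (edge_cosh x o0 o1) (edge_cosh x o0 o2) (edge_cosh x o0 o3)
           (edge_cosh x o1 o2) (edge_cosh x o1 o3) (edge_cosh x o2 o3).

Definition tet_angle (x : 'rV[R]_n) (c d : 'I_4) : R :=
  acos (- tet_inv x c d / Num.sqrt (tet_inv x c c * tet_inv x d d)).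

Definition tet_var (x v : 'rV[R]_n) : 'M[R]_4 :=
  let A i j := - (sinh (x 0 (s i j)) * v 0 (s i j)) in
  sym4 0 0 0 0 (A o0 o1) (A o0 o2) (A o0 o3) (A o1 o2) (A o1 o3) (A o2 o3).

Definition admissible (x : 'rV[R]_n) : Prop := (forall i, 0 < x 0 i) /\ 0 < tet_gdel x.

Lemma Ck_on_edge_cosh k (U : set 'rV[R]_n) i j :
  open U -> Ck_on k U (fun x => edge_cosh x i j).
Proof.
move=> oU; apply: (@Ck_on_comp1 _ _ k U setT (fun x : 'rV[R]_n => x 0 (s i j)) (@cosh R)) => //.
- exact: openT.
- exact: Ck_on_coord.
- exact: Ck_on_cosh.
Qed.

Ltac cke := do ![first [exact: Ck_on_cst | exact: Ck_on_edge_cosh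
  | apply: Ck_onD => // | apply: Ck_onB => // | apply: Ck_onM => // | apply: Ck_onN => //
  | apply: Ck_onV => //]].

Lemma Ck_on_tet_gdel k (U : set 'rV[R]_n) : open U -> Ck_on k U tet_gdel.
Proof. by move=> oU; rewrite /tet_gdel /gdel; cke. Qed.

Variable U : set 'rV[R]_n.
Hypothesis oU : open U.
Hypothesis adm : forall x, U x -> admissible x.

Lemma Ck_on_tet_inv k i j : Ck_on k U (fun x => tet_inv x i j).
Proof.
have d0 x : U x -> tet_gdel x != 0 by move=> /adm[_ h]; rewrite gt_eqF.
have cd := Ck_on_tet_gdel k oU.
(* Each entry is an explicit rational expression in the [edge_cosh]; unification reads it off in
   [reflexivity], and [cke] then follows its shape. *)
move: i j; apply: forall4; apply: forall4;
  (eapply (eq_Ck_on oU); first by move=> x _; rewrite mxE /= -/(tet_gdel x); reflexivity);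
  rewrite /kap /cofo; by cke.
Qed.

Definition tet_minor (x : 'rV[R]_n) c d : R :=
  tet_inv x c c * tet_inv x d d - tet_inv x c d ^+ 2.

Lemma admissible_gt1 x i j : admissible x -> 1 < edge_cosh x i j.
Proof. by move=> [x0 _]; exact: cosh_gt1. Qed.

Lemma tet_inv_diag_gt0 x i : admissible x -> 0 < tet_inv x i i.
Proof.
move=> ax; have [_ d0] := ax.
by apply: gram_inv_diag_gt0 => //; exact: admissible_gt1.
Qed.

Lemma tet_angle_arg x c d : admissible x -> 0 < tet_minor x c d ->
  -1 < - tet_inv x c d / Num.sqrt (tet_inv x c c * tet_inv x d d) < 1.
Proof.
move=> ax m0; have cc := tet_inv_diag_gt0 c ax; have dd := tet_inv_diag_gt0 d ax.
have p0 : 0 < tet_inv x c c * tet_inv x d d by rewrite mulr_gt0.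
rewrite -ltr_norml normrM normfV normrN (gtr0_norm (_ : 0 < Num.sqrt _)) ?sqrtr_gt0 //.
by rewrite ltr_pdivrMr ?sqrtr_gt0 // mul1r -sqrtr_sqr ltr_sqrt // -subr_gt0.
Qed.

Lemma Ck_on_tet_angle k c d : (forall x, U x -> 0 < tet_minor x c d) ->
  Ck_on k U (fun x => tet_angle x c d).
Proof.
move=> m0; rewrite /tet_angle.
have oO : open [set y : R | -1 < y < 1].
  rewrite (_ : [set y | _] = [set y : R | -1 < y] `&` [set y | y < 1]).
    by apply: openI; [exact: open_gt|exact: open_lt].
  by apply/seteqP; split => y /=; [move/andP|case=> -> ->].
apply: (Ck_on_comp1 oU oO _ _ (@Ck_on_acos R k)).
  by move=> x Ux; apply: tet_angle_arg; [exact: adm|exact: m0].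
have p0 x : U x -> 0 < tet_inv x c c * tet_inv x d d.
  by move=> Ux; rewrite mulr_gt0 // tet_inv_diag_gt0 //; exact: adm.
apply: Ck_onM => //; first by apply: Ck_onN => //; exact: Ck_on_tet_inv.
apply: Ck_onV => //; first by move=> x /p0 h; rewrite gt_eqF // sqrtr_gt0.
apply: (Ck_on_comp1 oU _ p0 _ (@Ck_on_sqrt R k)); first exact: open_gt.
by apply: Ck_onM => //; exact: Ck_on_tet_inv.
Qed.

Lemma derive_tet_gram x v :
  \matrix_(i, j) 'D_v (fun y => tet_gram y i j) x = tet_var x v.
Proof.
have D i j : 'D_v (fun y => - edge_cosh y i j) x = - (sinh (x 0 (s i j)) * v 0 (s i j)).
  have dx : differentiable (fun y : 'rV[R]_n => y 0 (s i j)) x.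
    by have [+ _] := Ck_on_coord 1 (s i j) (@openT 'rV[R]_n); exact.
  have [de E] := derive_comp_is_derive v dx (is_derive1_cosh _).
  rewrite (@deriveN R _ _ (fun y => edge_cosh y i j) x v); last exact: diff_derivable.
  by rewrite E (derive_entry (f := id)) // derive_id.
apply/matrixP; apply: forall4; apply: forall4; rewrite !mxE /= -?D.
all: try by (transitivity ('D_v (cst 1 : 'rV[R]_n -> R) x); last exact: derive_cst);
  congr ('D_v _ x); apply/funext => y; rewrite !mxE.
all: by congr ('D_v _ x); apply/funext => y; rewrite !mxE.
Qed.

Lemma derive_tet_angle c d x v : U x -> 0 < tet_minor x c d ->
  'D_v (fun y => tet_angle y c d) x =
  - tau (tet_inv x) (tet_var x v) c d / Num.sqrt (tet_minor x c d).
Proof.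
move=> Ux m0; have ax := adm Ux.
have dH i j : differentiable (fun y => tet_inv y i j) x.
  by have [+ _] := Ck_on_tet_inv 1 i j; exact.
have dG i j : differentiable (fun y => tet_gram y i j) x.
  have [+ _] : Ck_on 1 U (fun y => tet_gram y i j); last exact.
  move: i j; apply: forall4; apply: forall4;
    (eapply (eq_Ck_on oU); first by move=> y _; rewrite mxE /=; reflexivity); by cke.
have GH y : U y -> tet_gram y *m tet_inv y = 1%:M.
  by move=> /adm[_ d0]; apply: gram_mul_inv; rewrite gt_eqF.
have DH := derive_inverse_mx v oU Ux GH dG dH.
rewrite derive_tet_gram in DH.
have E i j : 'D_v (fun y => tet_inv y i j) x = - (tet_inv x *m tet_var x v *m tet_inv x) i j.
  by have /matrixP/(_ i j) := DH; rewrite !mxE.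
rewrite (@derive_angle R _ (fun y => tet_inv y c c) (fun y => tet_inv y d d)
  (fun y => tet_inv y c d) x v) // ?tet_inv_diag_gt0 //.
rewrite -/(tet_minor x c d) !E /tau; congr (_ / _); ring.
Qed.

End TetrahedronAngles.

Lemma tet_minorE (R : realType) n (s : 'I_4 -> 'I_4 -> 'I_n) (x : 'rV[R]_n) :
  tet_gdel s x != 0 ->
  let m a b := sinh (x 0 (s a b)) ^+ 2 / tet_gdel s x in
  [/\ [/\ tet_minor s x o0 o1 = m o2 o3, tet_minor s x o0 o2 = m o1 o3 &
          tet_minor s x o0 o3 = m o1 o2],
      tet_minor s x o1 o2 = m o0 o3, tet_minor s x o1 o3 = m o0 o2 &
      tet_minor s x o2 o3 = m o0 o1].
Proof.
move=> d0 m; split; [split| | |]; rewrite /m -cosh_sub1 /tet_minor.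
- exact: gram_inv_minor12. - exact: gram_inv_minor13. - exact: gram_inv_minor14.
- exact: gram_inv_minor23. - exact: gram_inv_minor24. - exact: gram_inv_minor34.
Qed.

Lemma tet_minor_gt0 (R : realType) n (s : 'I_4 -> 'I_4 -> 'I_n) (x : 'rV[R]_n) (c d : 'I_4) :
  admissible s x -> (c < d)%N -> 0 < tet_minor s x c d.
Proof.
move=> ax; have [x0 d0] := ax.
have [[e01 e02 e03] e12 e13 e23] := tet_minorE (lt0r_neq0 d0).
have m0 i : 0 < sinh (x 0 i) ^+ 2 / tet_gdel s x.
  by rewrite divr_gt0 // exprn_gt0 // sinh_gt0.
by move: c d; apply: forall4; apply: forall4 => // _; rewrite ?e01 ?e02 ?e03 ?e12 ?e13 ?e23.
Qed.

(* The contribution of one tetrahedron to the cone angle at the edge [i]. *)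
Definition tet_cone (R : realType) n (s : 'I_4 -> 'I_4 -> 'I_n) (i : 'I_n) (x : 'rV[R]_n) : R :=
  (i == s o2 o3)%:R * tet_angle s x o0 o1 + (i == s o1 o3)%:R * tet_angle s x o0 o2
  + (i == s o1 o2)%:R * tet_angle s x o0 o3 + (i == s o0 o3)%:R * tet_angle s x o1 o2
  + (i == s o0 o2)%:R * tet_angle s x o1 o3 + (i == s o0 o1)%:R * tet_angle s x o2 o3.

Section TetrahedronForm.
Variables (R : realType) (n : nat) (s : 'I_4 -> 'I_4 -> 'I_n) (U : set 'rV[R]_n).
Hypothesis oU : open U.
Hypothesis adm : forall x, U x -> admissible s x.

Lemma Ck_on_tet_cone k i : Ck_on k U (tet_cone s i).
Proof.
have ca (c d : 'I_4) : (c < d)%N -> Ck_on k U (fun x => tet_angle s x c d).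
  by move=> cd; apply: Ck_on_tet_angle => // x /adm ax; exact: tet_minor_gt0.
rewrite /tet_cone.
do 5 (apply: Ck_onD => //; last by apply: Ck_onM => //; [exact: Ck_on_cst|exact: ca]).
by apply: Ck_onM => //; [exact: Ck_on_cst|exact: ca].
Qed.

Lemma sum_kronecker (v : 'rV[R]_n) j (d : R) :
  \sum_i v 0 i * ((i == j)%:R * d) = v 0 j * d.
Proof.
rewrite (bigD1 j) //= eqxx mul1r big1 ?addr0 // => i /negbTE ->.
by rewrite mul0r mulr0.
Qed.

Lemma derive_tet_cone (x v : 'rV[R]_n) i : U x ->
  let D c d := - tau (tet_inv s x) (tet_var s x v) c d / Num.sqrt (tet_minor s x c d) in
  'D_v (tet_cone s i) x =
  (i == s o2 o3)%:R * D o0 o1 + (i == s o1 o3)%:R * D o0 o2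
  + (i == s o1 o2)%:R * D o0 o3 + (i == s o0 o3)%:R * D o1 o2
  + (i == s o0 o2)%:R * D o1 o3 + (i == s o0 o1)%:R * D o2 o3.
Proof.
move=> Ux D.
have h (c d : 'I_4) : (c < d)%N -> is_derive x v (fun y => tet_angle s y c d) (D c d).
  move=> cd; have m0 y : U y -> 0 < tet_minor s y c d by move=> /adm ay; exact: tet_minor_gt0.
  apply: DeriveDef; last by rewrite (derive_tet_angle oU adm) // m0.
  by apply: diff_derivable; have [+ _] := Ck_on_tet_angle oU adm 1 m0; exact.
have h01 := h o0 o1 isT; have h02 := h o0 o2 isT; have h03 := h o0 o3 isT.
have h12 := h o1 o2 isT; have h13 := h o1 o3 isT; have h23 := h o2 o3 isT.
have hk c d (k : R) : is_derive x v (fun y => tet_angle s y c d) (D c d) ->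
    is_derive x v (fun y => k * tet_angle s y c d) (k * D c d).
  by move=> hcd; apply: (is_deriveZ k hcd).
rewrite /tet_cone.
have := is_deriveD (is_deriveD (is_deriveD (is_deriveD (is_deriveD
  (hk _ _ (i == s o2 o3)%:R h01) (hk _ _ (i == s o1 o3)%:R h02))
  (hk _ _ (i == s o1 o2)%:R h03)) (hk _ _ (i == s o0 o3)%:R h12))
  (hk _ _ (i == s o0 o2)%:R h13)) (hk _ _ (i == s o0 o1)%:R h23).
by move=> [_ <-].
Qed.

(** Summation over [i] replaces each Kronecker factor by the value of [v] at an edge of the
    tetrahedron, with multiplicity when edges are identified, so [Q] is the form of [tau_posdef] up
    to a positive factor. It controls only the coordinates of [v] at the edges of this
    tetrahedron. *)
Lemma tet_form_ge0 (x v : 'rV[R]_n) : U x -> (forall a b, s a b = s b a) ->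
  let Q := \sum_i v 0 i * 'D_v (tet_cone s i) x in
  0 <= Q /\ (Q = 0 -> forall a b, a != b -> v 0 (s a b) = 0).
Proof.
move=> Ux sC Q; have ax := adm Ux; have [x0 d0] := ax.
pose A := tet_var s x v.
pose t c d := tau (tet_inv s x) A c d.
have sh i : 0 < sinh (x 0 i) by exact: sinh_gt0.
have [[e01 e02 e03] e12 e13 e23] := tet_minorE (lt0r_neq0 d0).
have term i (u w : R) : u * (- w / Num.sqrt (sinh (x 0 i) ^+ 2 / tet_gdel s x)) =
    Num.sqrt (tet_gdel s x) * (- (sinh (x 0 i) * u) * w / (cosh (x 0 i) ^+ 2 - 1)).
  have g0 : 0 < Num.sqrt (tet_gdel s x) by rewrite sqrtr_gt0.
  rewrite cosh_sub1 sqrtrM ?sqr_ge0 // sqrtr_sqr gtr0_norm // sqrtrV ?(ltW d0) //.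
  by field; rewrite !gt_eqF.
have QE : Q = Num.sqrt (tet_gdel s x) *
  (A o0 o1 * t o2 o3 / (edge_cosh s x o0 o1 ^+ 2 - 1)
    + A o0 o2 * t o1 o3 / (edge_cosh s x o0 o2 ^+ 2 - 1)
    + A o0 o3 * t o1 o2 / (edge_cosh s x o0 o3 ^+ 2 - 1)
    + A o1 o2 * t o0 o3 / (edge_cosh s x o1 o2 ^+ 2 - 1)
    + A o1 o3 * t o0 o2 / (edge_cosh s x o1 o3 ^+ 2 - 1)
    + A o2 o3 * t o0 o1 / (edge_cosh s x o2 o3 ^+ 2 - 1)).
  rewrite /Q; under eq_bigr do rewrite derive_tet_cone // !mulrDr.
  rewrite !big_split /= !sum_kronecker e01 e02 e03 e12 e13 e23 !term !mulrDr /edge_cosh.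
  rewrite -/A -!/(t _ _).
  have [[a01 a02 a03] a12 a13 a23] : [/\ [/\ A o0 o1 = - (sinh (x 0 (s o0 o1)) * v 0 (s o0 o1)),
      A o0 o2 = - (sinh (x 0 (s o0 o2)) * v 0 (s o0 o2)) &
      A o0 o3 = - (sinh (x 0 (s o0 o3)) * v 0 (s o0 o3))],
      A o1 o2 = - (sinh (x 0 (s o1 o2)) * v 0 (s o1 o2)),
      A o1 o3 = - (sinh (x 0 (s o1 o3)) * v 0 (s o1 o3)) &
      A o2 o3 = - (sinh (x 0 (s o2 o3)) * v 0 (s o2 o3))] by rewrite !mxE.
  rewrite a01 a02 a03 a12 a13 a23.
  move: (t o0 o1) (t o0 o2) (t o0 o3) (t o1 o2) (t o1 o3) (t o2 o3) => t01 t02 t03 t12 t13 t23.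
  by ring.
have Az : [|| A o0 o1 != 0, A o0 o2 != 0, A o0 o3 != 0, A o1 o2 != 0, A o1 o3 != 0 | A o2 o3 != 0]
    -> 0 < Q.
  move=> An; rewrite QE mulr_gt0 ?sqrtr_gt0 //.
  have := tau_posdef (admissible_gt1 o0 o1 ax) (admissible_gt1 o0 o2 ax) (admissible_gt1 o0 o3 ax)
    (admissible_gt1 o1 o2 ax) (admissible_gt1 o1 o3 ax) (admissible_gt1 o2 o3 ax) d0 An.
  rewrite /t; congr (0 < _); rewrite (_ : sym4 _ _ _ _ _ _ _ _ _ _ = A) //.
  by apply: eq_mx4; rewrite !mxE.
have vz : ~~ [|| A o0 o1 != 0, A o0 o2 != 0, A o0 o3 != 0, A o1 o2 != 0,
    A o1 o3 != 0 | A o2 o3 != 0]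
    -> forall a b, a != b -> v 0 (s a b) = 0.
  have z i : - (sinh (x 0 i) * v 0 i) = 0 -> v 0 i = 0.
    by move/eqP; rewrite oppr_eq0 mulf_eq0 gt_eqF //= => /eqP.
  rewrite !negb_or !negbK => /and5P[/eqP z01 /eqP z02 /eqP z03 /eqP z12 /andP[/eqP z13 /eqP z23]].
  move: z01 z02 z03 z12 z13 z23; rewrite !mxE /= => /z z01 /z z02 /z z03 /z z12 /z z13 /z z23.
  by apply: forall4; apply: forall4 => // _; rewrite // sC.
have [An|An] := boolP [|| A o0 o1 != 0, A o0 o2 != 0, A o0 o3 != 0, A o1 o2 != 0,
    A o1 o3 != 0 | A o2 o3 != 0].
  by have Q0 := Az An; split; [exact: ltW|move=> QQ; rewrite QQ ltxx in Q0].
split; last by move=> _; exact: vz.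
move: An; rewrite !negb_or !negbK =>
    /and5P[/eqP z01 /eqP z02 /eqP z03 /eqP z12 /andP[/eqP z13 /eqP z23]].
by rewrite QE z01 z02 z03 z12 z13 z23 !mul0r !addr0 mulr0.
Qed.

End TetrahedronForm.

(** * The space of cone metrics and the derivative of the curvature *)

Lemma sum_pairs4 (R : comRingType) (Q : 'I_4 -> 'I_4 -> bool) (F : 'I_4 -> 'I_4 -> R) :
  \sum_(c : 'I_4) \sum_(d : 'I_4 | (c < d)%N && Q c d) F c d =
  (Q o0 o1)%:R * F o0 o1 + (Q o0 o2)%:R * F o0 o2 + (Q o0 o3)%:R * F o0 o3
  + (Q o1 o2)%:R * F o1 o2 + (Q o1 o3)%:R * F o1 o3 + (Q o2 o3)%:R * F o2 o3.
Proof.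
under eq_bigr do rewrite big_mkcond /= sum4.
rewrite sum4 /=.
have E (b : bool) (u : R) : (if b then u else 0) = b%:R * u by case: b; rewrite ?mul1r ?mul0r.
by rewrite !E; ring.
Qed.

Lemma setC2_ord4 : [/\ [/\ ~: [set o0; o1] = [set o2; o3], ~: [set o0; o2] = [set o1; o3] &
  ~: [set o0; o3] = [set o1; o2]], ~: [set o1; o2] = [set o0; o3],
  ~: [set o1; o3] = [set o0; o2] & ~: [set o2; o3] = [set o0; o1]]%SET.
Proof. by split; [split| | |]; apply/setP; apply: forall4; rewrite !inE. Qed.

Section ConeMetrics.
Variables (R : realType) (T : face_pairing) (ix : 'I_(ntet T) -> 'I_4 -> 'I_4 -> 'I_(nedges T)).
Hypothesis ixE : forall t a b, a != b ->
  forall i, ((t, [set a; b]%SET) \in edge i) = (i == ix t a b).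
Hypothesis ixC : forall t a b, ix t a b = ix t b a.

Lemma has_lengthsE (x : 'rV[R]_(nedges T)) P : has_lengths x P <->
  forall t, hyperideal (P t) /\ forall a b, a != b -> edge_length (P t) a b = x 0 (ix t a b).
Proof.
split=> H t; have [hP lP] := H t; split => //.
  by move=> a b ab; apply: lP => //; rewrite ixE.
by move=> i a b ab; rewrite ixE // => /eqP ->; exact: lP.
Qed.

Lemma has_lengths_angles (x : 'rV[R]_(nedges T)) P t : has_lengths x P ->
  0 < tet_gdel (ix t) x /\ forall c d, dihedral_angle (P t) c d = tet_angle (ix t) x c d.
Proof.
move=> /has_lengthsE/(_ t)[hP lP].
have [_ D0 ang] := hyperideal_angles hP.
split; first by move: D0; rewrite /tet_gdel /edge_cosh !lP.
by move=> c d; have := ang c d; rewrite /tet_angle /tet_inv /edge_cosh !lP.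
Qed.

Lemma cone_metricsE :
  cone_metrics R T = [set x : 'rV[R]_(nedges T) | (forall i, 0 < x 0 i) /\ forall t, 0 <
      tet_gdel (ix t) x].
Proof.
apply/seteqP; split => x [x0 H]; split => //.
  by move=> t; case: H => P hP; have [] := has_lengths_angles t hP.
have ex t : exists P, hyperideal P /\
    forall a b, a != b -> edge_length P a b = x 0 (ix t a b).
  have [||//|P [hP lP]] := @hyperideal_exists R (fun a b => cosh (x 0 (ix t a b))).
  - by move=> a b; rewrite ixC.
  - by move=> a b _; exact: cosh_gt1.
  - exact: (H t).
  by exists P; split => // a b ab; rewrite lP // arcosh_cosh.
have [P hP] := choice ex; exists P; apply/has_lengthsE; exact: hP.
Qed.

Lemma open_cone_metrics : open (cone_metrics R T).
Proof.
rewrite cone_metricsE; apply: openI; apply: open_forall_gt0 => i.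
  by apply: Ck_on_coord; exact: openT.
by apply: Ck_on_tet_gdel; exact: openT.
Qed.

Lemma cone_metrics_admissible t x : cone_metrics R T x -> admissible (ix t) x.
Proof. by rewrite cone_metricsE => -[x0 h]; split. Qed.

(** Whatever tetrahedra [metric_tetrahedra] chooses, their dihedral angles are those computed from
    the lengths by [has_lengths_angles]. *)
Lemma cone_anglesE i x : cone_metrics R T x ->
  cone_angles x 0 i = \sum_t tet_cone (ix t) i x.
Proof.
move=> Lx; have hl : has_lengths x (metric_tetrahedra x).
  rewrite /metric_tetrahedra; case: pselect => [e|]; first by case: (cid e).
  by case: Lx => _ + /(_ _).
rewrite mxE; apply: eq_bigr => t _; rewrite sum_pairs4 /tet_cone.
have [[-> -> ->] -> -> ->] := setC2_ord4.
by rewrite !ixE //; have [_ ang] := has_lengths_angles t hl; rewrite !ang.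
Qed.

Lemma smooth_curvature : smooth_on (cone_metrics R T) (@curvature R T).
Proof.
have oL := open_cone_metrics.
move=> k; apply: Ck_on_row => // i.
apply: (@eq_Ck_on _ _ _ _ _ (fun x => 2 * pi - \sum_t tet_cone (ix t) i x)) => //.
  by move=> x Lx; rewrite [RHS]mxE cone_anglesE.
apply: Ck_onB => //; first exact: Ck_on_cst.
apply: Ck_on_sum => // t _; apply: Ck_on_tet_cone => // x; exact: cone_metrics_admissible.
Qed.

(** Pairing the derivative with [v] gives, up to sign, a sum over the tetrahedra of nonnegative
    forms. If it is zero, each form is, so [v] vanishes at the edges of every tetrahedron; every
    coordinate occurs there by [edge_nonempty]. *)
Lemma derive_curvature_inj x v : cone_metrics R T x ->
  'D_v (@curvature R T) x = 0 -> v = 0.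
Proof.
move=> Lx Dv; have oL := open_cone_metrics.
have adm t y : cone_metrics R T y -> admissible (ix t) y by exact: cone_metrics_admissible.
have dt t i : differentiable (tet_cone (ix t) i) x.
  by have [+ _] := Ck_on_tet_cone oL (@adm t) 1 i; exact.
have Di i : \sum_t 'D_v (tet_cone (ix t) i) x = 0.
  have dc : differentiable (@curvature R T) x by have [+ _] := smooth_curvature 1%N; exact.
  have := derive_entry v i dc; rewrite Dv mxE.
  rewrite (@near_eq_derive _ _ _ _ (cst (2 * pi) - \sum_t tet_cone (ix t) i)); last first.
    near=> y; rewrite mxE cone_anglesE; last by near: y; exact: open_nbhs_nbhs.
    by rewrite [RHS]/(_ - _) fct_sumE.
  rewrite deriveB; [|exact: derivable_cst|]; last first.
    by apply: derivable_sum => t; exact: diff_derivable.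
  rewrite derive_cst derive_sum; last by move=> t; exact: diff_derivable.
  by rewrite sub0r => /eqP; rewrite oppr_eq0 => /eqP.
have S0 : \sum_t \sum_i v 0 i * 'D_v (tet_cone (ix t) i) x = 0.
  rewrite exchange_big big1 // => i _; by rewrite -mulr_sumr Di mulr0.
have form t := tet_form_ge0 oL (@adm t) v Lx (ixC t).
have Q0 t : \sum_i v 0 i * 'D_v (tet_cone (ix t) i) x = 0.
  by apply: (psumr_eq0P _ S0) => // u _; have [] := form u.
apply/rowP => i; rewrite mxE; have [t [a [b [ab ti]]]] := edge_nonempty i.
move: ti; rewrite ixE // => /eqP ->; have [_ H] := form t; exact: H (Q0 t) _ _ ab.
Unshelve. all: by end_near.
Qed.

End ConeMetrics.

Theorem theorem4 (R : realType) (M : topologicalType) (T : face_pairing)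
    (hM : manifold3_with_boundary R M) (cM : compact [set: M])
    (hbd : negative_boundary R M) (hT : ideal_triangulation R M T) :
  local_diffeomorphism (cone_metrics R T) (@curvature R T) /\
  (forall x : 'rV[R]_(nedges T), cone_metrics R T x ->
     exists U : set 'rV[R]_(nedges T),
       [/\ open U, U x, U `<=` cone_metrics R T &
           forall y z, U y -> U z -> y <> z -> cone_angles y <> cone_angles z]).
Proof.
have [ix [ixE ixC]] := edge_index T.
have loc x : cone_metrics R T x -> exists A : set 'rV[R]_(nedges T),
    [/\ A x, A `<=` cone_metrics R T & diffeomorphism A (@curvature R T @` A) (@curvature R T)].
  move=> Lx; have [A [Ax AL dA]] := locally_injective (open_cone_metrics ixE ixC)
    (smooth_curvature R ixE ixC) Lx (fun v => derive_curvature_inj ixE ixC Lx).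
  by exists A; split.
split=> x Lx; have [A [Ax AL dA]] := loc x Lx.
  by exists A, (@curvature R T @` A).
(* Equal cone angles give equal curvatures, and the curvature is injective on [A]. *)
have [oA _ _ _ [g [_ gK]]] := dA; exists A; split => // y z Ay Az yz cyz.
apply: yz; rewrite -(gK y Ay) -(gK z Az); congr g.
by apply/rowP => i; rewrite [LHS]mxE [RHS]mxE cyz.
Qed.
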